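(* Let $0<\beta<1$, $\lambda>0$, and let $h_\lambda(\cdot,t)$ denote the probability density of the inverse tempered stable subordinator $E_\lambda(t)$. Then for all $x>0$ and $t>0$, $$h_{\lambda}(x,t) = \frac{e^{\lambda^{\beta}x}}{\pi}\sum_{k=0}^{\infty}(-1)^k\frac{x^k\lambda^{\beta(k+1)}}{k!}\Big[\Gamma(1+\beta(k+1))\,\Gamma(-\beta(k+1),\lambda t)\sin((k+1)\beta\pi) -\Gamma(1+\beta k)\,\Gamma(-\beta k,\lambda t)\sin (k\beta\pi)\Big].$$
   Context: For $0<\beta<1$ and $\lambda>0$, the tempered $\beta$-stable subordinator $D_\lambda=(D_\lambda(t))_{t\ge 0}$ with tempering parameter $\lambda$ is the (strictly increasing) subordinator started at $0$ with Laplace transform $\mathbb{E}(e^{-sD_\lambda(t)})=e^{-t((s+\lambda)^{\beta}-\lambda^{\beta})}$ for $s>0$. The inverse tempered stable (ITS) subordinator is $E_\lambda(t)=\inf\{u>0: D_\lambda(u)>t\}$, $t\ge 0$, and $h_\lambda(x,t)$ denotes the density in $x$ of the random variable $E_\lambda(t)$. For $a\in\mathbb{R}$ and $u>0$, $\Gamma(a,u)=\int_u^\infty y^{a-1}e^{-y}\,dy$ is the incomplete gamma function; $\Gamma(\cdot)$ with one argument is the usual gamma function. *)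

(* Defs.v *)
From HB Require Import structures.
From mathcomp Require Import all_boot all_order all_algebra.
From mathcomp Require Import all_classical all_reals all_analysis.

Set Implicit Arguments.
Unset Strict Implicit.
Unset Printing Implicit Defensive.

Import Order.TTheory GRing.Theory Num.Theory.
Import numFieldNormedType.Exports.

Local Open Scope classical_set_scope.
Local Open Scope ring_scope.

Definition upper_gamma (R : realType) (a u : R) : R :=
  \int[@lebesgue_measure R]_(y in `]u, +oo[) (y `^ (a - 1) * expR (- y)).

(* Meaningful for [0 < a] only: otherwise the integral diverges and [Rintegral]
   returns the default value 0. *)
Definition Gamma (R : realType) (a : R) : R :=
  \int[@lebesgue_measure R]_(y in `]0, +oo[) (y `^ (a - 1) * expR (- y)).

Section processes.
Context d (T : measurableType d) (R : realType) (P : probability T R).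

(* Processes are indexed by [R]; only the times [0 <= t] are constrained. *)
Definition stationary_increments (D : R -> {RV P >-> R}) :=
  forall (s t : R) (A : set R), 0 <= s -> 0 <= t -> measurable A ->
    P [set w | A (D (s + t) w - D s w)] = P [set w | A (D t w - D 0 w)].

Definition independent_increments (D : R -> {RV P >-> R}) :=
  forall (n : nat) (t : nat -> R) (A : nat -> set R),
    0 <= t 0%N -> (forall i, (i < n)%N -> t i <= t i.+1) ->
    (forall i, (i < n)%N -> measurable (A i)) ->
    P [set w | forall i, (i < n)%N -> A i (D (t i.+1) w - D (t i) w)] =
    (\prod_(i < n) fine (P [set w | A i (D (t i.+1) w - D (t i) w)]))%:E.

(* Left limits need not be required: they exist because paths are monotone. *)
Record increasing_subordinator (D : R -> {RV P >-> R}) : Prop := {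
  subordinator0 : {ae P, forall w, D 0 w = 0} ;
  subordinator_stationary : stationary_increments D ;
  subordinator_independent : independent_increments D ;
  subordinator_increasing :
    {ae P, forall w, forall s t : R, 0 <= s -> s < t -> D s w < D t w} ;
  subordinator_right_continuous :
    {ae P, forall w, forall t : R, 0 <= t ->
      D u w @[u --> t^'+] --> D t w} }.

Definition tempered_stable_subordinator (beta lambda : R)
    (D : R -> {RV P >-> R}) : Prop :=
  increasing_subordinator D /\
  forall s t : R, 0 < s -> 0 <= t ->
    ('E_P[fun w => expR (- s * D t w)])%E =
    (expR (- t * ((s + lambda) `^ beta - lambda `^ beta)))%:E.

(* The infimum is over a nonempty set for almost every [w] when [D] is the
   tempered stable subordinator, so the convention [inf set0 = 0] is
   immaterial. *)
Definition inverse_process (D E : R -> {RV P >-> R}) : Prop :=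
  forall t : R, 0 <= t ->
    {ae P, forall w, E t w = inf [set u | 0 < u /\ t < D u w]}.

Definition is_density (X : {RV P >-> R}) (h : R -> R) : Prop :=
  [/\ measurable_fun setT h, (forall x, 0 <= h x) &
      forall A : set R, measurable A ->
        distribution P X A = (\int[@lebesgue_measure R]_(x in A) (h x)%:E)%E].

(* A density is determined almost everywhere only; the version for which a
   pointwise formula on the positive half-line makes sense is the one that is
   continuous there. *)
Definition is_continuous_density (X : {RV P >-> R}) (h : R -> R) : Prop :=
  is_density X h /\ forall x, 0 < x -> {for x, continuous h}.

End processes.

(* Main.v *)
Require Import Defs.
From HB Require Import structures.
From mathcomp Require Import all_boot all_order all_algebra.
From mathcomp Require Import all_classical all_reals all_analysis.
From mathcomp Require Import measurable_realfun ring lra.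
Import Order.TTheory GRing.Theory Num.Theory.
Import numFieldNormedType.Exports.

Local Open Scope classical_set_scope.
Local Open Scope ring_scope.

Set Implicit Arguments.
Unset Strict Implicit.
Unset Printing Implicit Defensive.

(** The Laplace transform [exp (-x ((s + l)^b - l^b))] of [D(x)] is inverted on a ray: with
[z = r e^(i th)], Cauchy's formula for [exp (-x z^b) / (s - z)] represents [exp (-x s^b)]
as an integral over the ray of angle [th], the residue being produced by a Poisson kernel
as [th] tends to 0; the integral does not depend on [th], because the derivative of the
integrand in [th] is a total derivative in [r]. For [th] slightly above [pi/2] the factor
[1 / (s - z)] is itself a Laplace transform, which exhibits an integrable function with
the transform of [D(x)], and uniqueness of Laplace transforms identifies the tail
[P(D(x) > t)] with its integral over [(t, oo)]. Rotating this tail integral to [th = pi]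
gives a real integral whose expansion in powers of [x] can be integrated term by term,
with coefficients [Gamma(1 + b k) Gamma(- b k, l t)] by Fubini. Finally [E(t) <= x] and
[D(x) > t] have the same probability, so the density is the derivative in [x] of this
power series; [x = 0] and [x -> oo] give its total mass. *)

(** * Integration on half-lines *)

Local Notation mu := lebesgue_measure.

(** Two angles are needed because the two uses of the ray compete. At [th = pi] the factor
    [exp (- x r^b cos (b pi))] does not decay when [b >= 1/2], so the ray integral is not absolutely
    convergent at [t = 0], where the whole Laplace transform has to be taken. Just above [pi/2] both
    [cos th <= 0] and [cos (b th) > 0] can be had, which bounds the integrand uniformly in the time
    variable. Once [t > 0], the factor [exp (t r cos th)] beats [exp (x r^b)] because [b < 1],
    whatever the sign of [cos (b th)], and the rotation up to [pi] becomes legitimate. Tempering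
    only shifts [s] to [s + l], that is, multiplies the density by [e^(- l y)] up to a constant; it
    also puts the transform at [s = 0], the total mass, within reach of the formula at the positive
    point [l]. All contour integrals are written through real and imaginary parts; the rays of
    angles [th] and [- th] being conjugate, only the imaginary part on the upper one is needed. *)

Lemma integrable_oneDsqrV (R : realType) :
  (@mu R).-integrable `]0, +oo[ (EFin \o (fun r : R => (1 + r ^+ 2)^-1)).
Proof.
apply: (@integrableS _ _ _ (@mu R) `[0, +oo[%classic) => //.
  by apply: subset_itvr; rewrite bnd_simp.
apply/integrableP; split.
  apply/measurable_EFinP; apply: measurable_funTS.
  by apply: continuous_measurable_fun; exact: continuous_oneDsqrV.
rewrite (_ : (\int[mu]_(x in _) _)%E = (pi / 2)%:E) ?ltry//.
rewrite -integral0y_oneDsqr; apply: eq_integral => x _ /=.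
by rewrite ger0_norm// invr_ge0 addr_ge0// sqr_ge0.
Qed.

Lemma integrable_le_oneDsqrV {R : realType} (f : R -> R) (C : R) :
  measurable_fun (`]0, +oo[ : set R) f ->
  (forall r, 0 < r -> `|f r| <= C / (1 + r ^+ 2)) ->
  (@mu R).-integrable `]0, +oo[ (EFin \o f).
Proof.
move=> mf fC.
apply: (@le_integrable _ _ R (@mu R) _ _ (EFin \o f)
  (fun r => C%:E * ((1 + r ^+ 2)^-1)%:E)%E) => //.
- exact/measurable_EFinP.
- move=> r /=; rewrite in_itv/= andbT => r0.
  by rewrite lee_fin (le_trans (fC _ r0))// ler_norm.
- by apply: integrableZl => //; exact: integrable_oneDsqrV.
Qed.

Lemma derivable_measurable_pos {R : realType} (f : R -> R) :
  (forall r, 0 < r -> derivable f r 1) -> measurable_fun (`]0, +oo[ : set R) f.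
Proof.
move=> df; apply: open_continuous_measurable_fun => // r.
rewrite inE/= in_itv/= andbT => r0.
by apply: differentiable_continuous; apply/derivable1_diffP; exact: df.
Qed.

Lemma cvg_Rintegral_dominated d (T : measurableType d) {R : realType}
  (m : {measure set T -> \bar R})
  (D : set T) (f_ : nat -> T -> R) (f g : T -> R) :
  measurable D ->
  (forall n, measurable_fun D (f_ n)) ->
  (forall x, D x -> f_ n x @[n --> \oo] --> f x) ->
  m.-integrable D (EFin \o g) ->
  (forall n x, D x -> `|f_ n x| <= g x) ->
  m.-integrable D (EFin \o f) /\
  \int[m]_(x in D) f_ n x @[n --> \oo] --> \int[m]_(x in D) f x.
Proof.
move=> mD mf ff ig fg.
have [|||||/= intf _ cf] := @dominated_convergence _ _ R m D mD
  (fun n => EFin \o f_ n) (EFin \o f) (EFin \o g).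
- by move=> n; exact/measurable_EFinP.
- apply: (@emeasurable_fun_cvg _ _ _ _ (fun n => EFin \o f_ n)).
    by move=> n; exact/measurable_EFinP.
  by move=> x Dx; apply: cvg_EFin; [exact: nearW|exact: ff].
- by apply: aeW => x Dx; apply: cvg_EFin; [exact: nearW|exact: ff].
- exact: ig.
- by apply: aeW => x n Dx /=; rewrite lee_fin fg.
split=> //; apply: fine_cvg => //.
by rewrite fineK//; exact: integrable_fin_num.
Qed.

Lemma Rintegral_FTC2 {R : realType} (f F : R -> R) (a b : R) : a < b ->
  (forall r, a <= r <= b -> is_derive r 1 F (f r)) ->
  (forall r, a <= r <= b -> {for r, continuous f}) ->
  \int[mu]_(r in `[a, b]) f r = F b - F a.
Proof.
move=> ab dF cf.
have cF r : a <= r <= b -> {for r, continuous F}.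
  move=> /dF rd; apply: differentiable_continuous; apply/derivable1_diffP.
  exact: ex_derive.
rewrite /Rintegral (@continuous_FTC2 R f F a b)//.
- apply: continuous_in_subspaceT => r /set_mem/=.
  by rewrite in_itv/=; exact: cf.
- split.
  + move=> r; rewrite in_itv/= => /andP[ar rb].
    by apply: (@ex_derive _ _ _ _ _ _ _ (dF r _)); rewrite !ltW.
  + by apply: cvg_at_right_filter; apply: cF; rewrite lexx ltW.
  + by apply: cvg_at_left_filter; apply: cF; rewrite lexx ltW.
- move=> r; rewrite in_itv/= => /andP[ar rb].
  by rewrite derive1E (@derive_val _ _ _ _ _ _ _ (dF r _))// !ltW.
Qed.

Lemma cvg_natS2_pinfty {R : realType} : (n.+2%:R : R) @[n --> \oo] --> +oo.
Proof.
apply/cvgryPge => K; near=> n.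
apply: (@le_trans _ _ n%:R); last by rewrite ler_nat -addn2 leq_addr.
by near: n; exact: nbhs_infty_ger.
Unshelve. all: by end_near. Qed.

(** The integrand may change sign, so monotone convergence is replaced by dominated convergence,
    with bound [|f|], along compact intervals exhausting the half-line. *)
Lemma Rintegral_pinfty_FTC2 {R : realType} (f F : R -> R) (a l0 loo : R) :
  (forall r : R, a < r -> is_derive r 1 F (f r)) ->
  (forall r : R, a < r -> {for r, continuous f}) ->
  (@mu R).-integrable `]a, +oo[ (EFin \o f) ->
  F r @[r --> a^'+] --> l0 -> F r @[r --> +oo] --> loo ->
  \int[mu]_(r in `]a, +oo[) f r = loo - l0.
Proof.
move=> dF cf intf F0 Foo.
(* The shift by 2 keeps the left end strictly below the right end already at [n = 0]. *)
pose I n : set R := `[a + n.+2%:R^-1, a + n.+2%:R]%classic.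
have mf : measurable_fun (`]a, +oo[ : set R) f.
  by apply/measurable_EFinP; exact: measurable_int intf.
have n1 n : a + (n.+2%:R^-1 : R) < a + n.+2%:R.
  by rewrite ltrD2l (@lt_le_trans _ _ 1) ?invf_lt1 ?ltr1n ?ler1n.
have In0 n r : a + (n.+2%:R^-1 : R) <= r -> a < r.
  by apply: lt_le_trans; rewrite ltrDl invr_gt0.
have IS n : I n `<=` (`]a, +oo[%classic : set R).
  by move=> r; rewrite /I/= !in_itv/= andbT => /andP[/In0].
have [|||||_ /=] := @cvg_Rintegral_dominated _ _ R (@mu R) `]a, +oo[%classic
  (fun n => f \_ (I n)) f (fun x => `|f x|) => //.
- move=> n; apply/(measurable_restrict f) => //.
    exact: measurable_itv.
  exact: measurable_funS mf.
- move=> r /=; rewrite in_itv/= andbT => r0.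
  apply: cvg_near_cst; near=> n.
  rewrite patchE ifT//; apply/mem_set; rewrite /I /= in_itv /=; apply/andP; split.
    rewrite -lerBrDl invf_ple ?posrE ?subr_gt0//; near: n.
    by move/cvgryPge : (@cvg_natS2_pinfty R); exact.
  rewrite -lerBlDl; near: n.
  by move/cvgryPge : (@cvg_natS2_pinfty R); exact.
- by move/integrable_norm : intf.
- by move=> n r _; rewrite patchE; case: ifPn => // _; rewrite normr0.
rewrite [X in X @ _ --> _ -> _](_ : _ =
    (fun n => F (a + n.+2%:R) - F (a + n.+2%:R^-1))); last first.
  apply/funext => n; rewrite -Rintegral_mkcondr setIidr// /I; apply: Rintegral_FTC2 => //.
  - by move=> r /andP[/In0 r0 _]; apply: dF.
  - by move=> r /andP[/In0 r0 _]; apply: cf.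
move=> cvg1; apply: (cvg_unique _ cvg1) => //; apply: cvgB.
- apply: (cvg_comp _ _ _ Foo); apply/cvgryPge => K; near=> n.
  rewrite -lerBlDl; near: n.
  by move/cvgryPge : (@cvg_natS2_pinfty R); exact.
- move/cvg_at_rightP : F0; apply; split=> [n|]; first by rewrite ltrDl invr_gt0.
  rewrite -[X in _ --> X]addr0; apply: cvgD; first exact: cvg_cst.
  apply: (gtr0_cvgV0 _).2; last exact: cvg_natS2_pinfty.
  by apply: nearW => n /=.
Unshelve. all: by end_near. Qed.

(** * Rotation of ray integrals *)

(** The function is the imaginary part of [exp (A + i B) / (u - i v)]. Leaving [A], [B], [u], [v]
    abstract lets one computation serve for differentiation both in the angle and in the radius. *)
Lemma is_derive_ray_im {R : realType} (A B u v : R -> R) (a A' B' u' v' : R) :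
  is_derive a 1 A A' -> is_derive a 1 B B' ->
  is_derive a 1 u u' -> is_derive a 1 v v' ->
  u a ^+ 2 + v a ^+ 2 != 0 ->
  is_derive a 1 (fun y => expR (A y) * (sin (B y) * u y + cos (B y) * v y) /
                          (u y ^+ 2 + v y ^+ 2))
  (expR (A a) * ((A' * (sin (B a) * u a + cos (B a) * v a) +
      B' * (cos (B a) * u a - sin (B a) * v a) + sin (B a) * u' + cos (B a) * v')
      / (u a ^+ 2 + v a ^+ 2)
      - (sin (B a) * u a + cos (B a) * v a) * (2 * u a * u' + 2 * v a * v') /
        (u a ^+ 2 + v a ^+ 2) ^+ 2)).
Proof.
move=> dA dB du dv n0.
have de := is_derive1_comp (is_derive_expR (A a)) dA.
have ds := is_derive1_comp (is_derive_sin (B a)) dB.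
have dc := is_derive1_comp (is_derive_cos (B a)) dB.
have dN := is_deriveD (is_deriveX 2 du) (is_deriveX 2 dv).
have dNV := @is_deriveV R (u ^+ 2 + v ^+ 2)%R a _ 1 n0 dN.
have dM := is_deriveM (is_deriveM de (is_deriveD (is_deriveM ds du) (is_deriveM dc dv))) dNV.
move: dM; rewrite !fctE /= => dM.
apply: (is_derive_eq dM).
rewrite /GRing.scale /=.
field.
exact: n0.
Qed.

(** Adding [pi / 2] to the phase [B] multiplies by [i] and so turns the real part into an imaginary
    part. *)
Lemma is_derive_ray_re {R : realType} (A B u v : R -> R) (a A' B' u' v' : R) :
  is_derive a 1 A A' -> is_derive a 1 B B' ->
  is_derive a 1 u u' -> is_derive a 1 v v' ->
  u a ^+ 2 + v a ^+ 2 != 0 ->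
  is_derive a 1 (fun y => expR (A y) * (cos (B y) * u y - sin (B y) * v y) /
                          (u y ^+ 2 + v y ^+ 2))
  (expR (A a) * ((A' * (cos (B a) * u a - sin (B a) * v a) -
      B' * (sin (B a) * u a + cos (B a) * v a) + cos (B a) * u' - sin (B a) * v')
      / (u a ^+ 2 + v a ^+ 2)
      - (cos (B a) * u a - sin (B a) * v a) * (2 * u a * u' + 2 * v a * v') /
        (u a ^+ 2 + v a ^+ 2) ^+ 2)).
Proof.
move=> dA dB du dv n0.
have dB2 : is_derive a 1 (fun y => B y + pi / 2) B'.
  have := is_deriveD dB (is_derive_cst (pi / 2) a 1).
  by rewrite !fctE addr0.
have := is_derive_ray_im dA dB2 du dv n0.
rewrite (_ : (fun y => _) = (fun y => expR (A y) *
  (cos (B y) * u y - sin (B y) * v y) / (u y ^+ 2 + v y ^+ 2))); last first.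
  by apply/funext => y; rewrite sinDpihalf cosDpihalf mulNr.
move=> d; apply: (is_derive_eq d).
by rewrite sinDpihalf cosDpihalf; ring.
Qed.

(* With [z = r e^(i th)], [ray_re] and [ray_im] are the real and imaginary parts of
   [exp (t z - x z^b) e^(i th) / (s - z)], and [ray_nsq] is [|s - z|^2]. *)
Definition ray_exp_re {R : realType} (b x t r th : R) : R :=
  t * r * cos th - x * r `^ b * cos (b * th).

Definition ray_exp_im {R : realType} (b x t r th : R) : R :=
  t * r * sin th - x * r `^ b * sin (b * th) + th.

Definition ray_nsq {R : realType} (s r th : R) : R :=
  (s - r * cos th) ^+ 2 + (r * sin th) ^+ 2.

Definition ray_im {R : realType} (b x s t r th : R) : R :=
  expR (ray_exp_re b x t r th) *
  (sin (ray_exp_im b x t r th) * (s - r * cos th) +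
   cos (ray_exp_im b x t r th) * (r * sin th)) / ray_nsq s r th.

Definition ray_re {R : realType} (b x s t r th : R) : R :=
  expR (ray_exp_re b x t r th) *
  (cos (ray_exp_im b x t r th) * (s - r * cos th) -
   sin (ray_exp_im b x t r th) * (r * sin th)) / ray_nsq s r th.

(* Common value of [d/dth ray_im] and [d/dr (r ray_re)]: the Cauchy-Riemann equation that
   makes the integral of [ray_im] over the ray independent of [th]. *)
Definition ray_dif {R : realType} (b x s t r th : R) : R :=
  ray_re b x s t r th *
    (1 + (t * r * cos th - x * b * r `^ b * cos (b * th)) +
     (r * cos th * (s - r * cos th) - (r * sin th) ^+ 2) / ray_nsq s r th) -
  ray_im b x s t r th *
    (t * r * sin th - x * b * r `^ b * sin (b * th) + s * (r * sin th) / ray_nsq s r th).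

Lemma is_derive_ray_im_angle {R : realType} (b x s t r th : R) :
  ray_nsq s r th != 0 ->
  is_derive th 1 (ray_im b x s t r) (ray_dif b x s t r th).
Proof.
move=> n0.
have dc := is_derive_cos th.
have ds := is_derive_sin th.
have di : is_derive th 1 (fun y : R => y) 1 by exact: is_derive_id.
have db : is_derive th 1 (fun y => b * y) b.
  by apply: (is_derive_eq (is_deriveZ b di)); rewrite /GRing.scale/= mulr1.
have dbc := is_derive1_comp (is_derive_cos (b * th)) db.
have dbs := is_derive1_comp (is_derive_sin (b * th)) db.
have dA : is_derive th 1 (ray_exp_re b x t r)
    (- (t * r * sin th - x * b * r `^ b * sin (b * th))).
  have := is_deriveB (is_deriveZ (t * r) dc) (is_deriveZ (x * r `^ b) dbc).
  rewrite !fctE /GRing.scale/= => d; apply: (is_derive_eq d); ring.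
have dB : is_derive th 1 (ray_exp_im b x t r)
    (t * r * cos th - x * b * r `^ b * cos (b * th) + 1).
  have := is_deriveD (is_deriveB (is_deriveZ (t * r) ds) (is_deriveZ (x * r `^ b) dbs))
    di.
  rewrite !fctE /GRing.scale/= => d; apply: (is_derive_eq d); ring.
have du : is_derive th 1 (fun y => s - r * cos y) (r * sin th).
  have := is_deriveB (is_derive_cst s th (1 : R)) (is_deriveZ r dc).
  rewrite !fctE /GRing.scale/= => d; apply: (is_derive_eq d); ring.
have dv : is_derive th 1 (fun y => r * sin y) (r * cos th).
  by apply: (is_derive_eq (is_deriveZ r ds)); rewrite /GRing.scale/=.
have := is_derive_ray_im dA dB du dv n0.
move=> d; apply: (is_derive_eq d).
rewrite /ray_dif /ray_im /ray_re /ray_nsq.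
field.
exact: n0.
Qed.

Lemma is_derive_ray_exp_re_radius {R : realType} (b x t r th : R) : 0 < r ->
  is_derive r 1 (fun r => ray_exp_re b x t r th)
    ((t * r * cos th - x * b * r `^ b * cos (b * th)) / r).
Proof.
move=> r0.
have di : is_derive r 1 (fun y : R => y) 1 by exact: is_derive_id.
have dp := is_derive1_powR b r0.
have rb : r `^ (b - 1) = r `^ b / r.
  by rewrite powRB ?(gt_eqF r0) ?implybT// powRr1// ltW.
have := is_deriveB (is_deriveZ (t * cos th) di) (is_deriveZ (x * cos (b * th)) dp).
rewrite !fctE /GRing.scale/= => d.
rewrite (_ : (fun r => _) =
    (fun y : R => t * cos th * y - x * cos (b * th) * y `^ b)); last first.
  by apply/funext => y; rewrite /ray_exp_re; ring.
by apply: (is_derive_eq d); rewrite rb; field; rewrite gt_eqF.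
Qed.

Lemma is_derive_ray_exp_im_radius {R : realType} (b x t r th : R) : 0 < r ->
  is_derive r 1 (fun r => ray_exp_im b x t r th)
    ((t * r * sin th - x * b * r `^ b * sin (b * th)) / r).
Proof.
move=> r0.
have di : is_derive r 1 (fun y : R => y) 1 by exact: is_derive_id.
have dp := is_derive1_powR b r0.
have rb : r `^ (b - 1) = r `^ b / r.
  by rewrite powRB ?(gt_eqF r0) ?implybT// powRr1// ltW.
have := is_deriveD (is_deriveB (is_deriveZ (t * sin th) di)
  (is_deriveZ (x * sin (b * th)) dp)) (is_derive_cst th r (1 : R)).
rewrite !fctE /GRing.scale/= => d.
rewrite (_ : (fun r => _) =
    (fun y : R => t * sin th * y - x * sin (b * th) * y `^ b + th)); last first.
  by apply/funext => y; rewrite /ray_exp_im; ring.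
by apply: (is_derive_eq d); rewrite rb; field; rewrite gt_eqF.
Qed.

Lemma is_derive_ray_den_re {R : realType} (s r th : R) :
  is_derive r 1 (fun y => s - y * cos th) (- cos th).
Proof.
have di : is_derive r 1 (fun y : R => y) 1 by exact: is_derive_id.
have := is_deriveB (is_derive_cst s r (1 : R)) (is_deriveZ (cos th) di).
rewrite !fctE /GRing.scale/= => d.
rewrite (_ : (fun r => _) = (fun y : R => s - cos th * y)); last first.
  by apply/funext => y; ring.
by apply: (is_derive_eq d); ring.
Qed.

Lemma is_derive_ray_den_im {R : realType} (r th : R) :
  is_derive r 1 (fun y => y * sin th) (sin th).
Proof.
have di : is_derive r 1 (fun y : R => y) 1 by exact: is_derive_id.
rewrite (_ : (fun r => _) = (fun y : R => sin th * y)); last first.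
  by apply/funext => y; ring.
by apply: (is_derive_eq (is_deriveZ (sin th) di)); rewrite /GRing.scale/= mulr1.
Qed.

Lemma derivable_ray_im_radius {R : realType} (b x s t r th : R) : 0 < r ->
  ray_nsq s r th != 0 -> derivable (fun r => ray_im b x s t r th) r 1.
Proof.
move=> r0 n0.
have := is_derive_ray_im (is_derive_ray_exp_re_radius b x t th r0)
  (is_derive_ray_exp_im_radius b x t th r0) (is_derive_ray_den_re s r th)
  (is_derive_ray_den_im r th) n0.
by move=> [].
Qed.

Lemma derivable_ray_re_radius {R : realType} (b x s t r th : R) : 0 < r ->
  ray_nsq s r th != 0 -> derivable (fun r => ray_re b x s t r th) r 1.
Proof.
move=> r0 n0.
have := is_derive_ray_re (is_derive_ray_exp_re_radius b x t th r0)
  (is_derive_ray_exp_im_radius b x t th r0) (is_derive_ray_den_re s r th)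
  (is_derive_ray_den_im r th) n0.
by move=> [].
Qed.

Lemma is_derive_ray_re_radius {R : realType} (b x s t r th : R) : 0 < r ->
  ray_nsq s r th != 0 ->
  is_derive r 1 (fun r => r * ray_re b x s t r th) (ray_dif b x s t r th).
Proof.
move=> r0 n0.
have di : is_derive r 1 (fun y : R => y) 1 by exact: is_derive_id.
have dV := is_derive_ray_re (is_derive_ray_exp_re_radius b x t th r0)
  (is_derive_ray_exp_im_radius b x t th r0) (is_derive_ray_den_re s r th)
  (is_derive_ray_den_im r th) n0.
have := is_deriveM di dV; rewrite !fctE /GRing.scale/= => d.
apply: (is_derive_eq d).
rewrite /ray_dif /ray_im /ray_re /ray_nsq.
field.
by rewrite n0 gt_eqF.
Qed.

Lemma derivable_continuous_at {R : realType} (f : R -> R) (r : R) :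
  derivable f r 1 -> {for r, continuous f}.
Proof. by move=> df; apply: differentiable_continuous; exact/derivable1_diffP. Qed.

Lemma continuous_ray_dif_radius {R : realType} (b x s t r th : R) : 0 < r ->
  ray_nsq s r th != 0 -> {for r, continuous (fun r => ray_dif b x s t r th)}.
Proof.
move=> r0 n0.
have cW := derivable_continuous_at (derivable_ray_im_radius r0 n0).
have cV := derivable_continuous_at (derivable_ray_re_radius r0 n0).
have cp : {for r, continuous (fun r : R => r `^ b)}.
  by apply: derivable_continuous_at; have [] := is_derive1_powR b r0.
have ci : {for r, continuous (fun r : R => r)} by exact: cvg_id.
have cc (k : R) : {for r, continuous (fun r : R => k)} by exact: cvg_cst.
have cu : {for r, continuous (fun r : R => s - r * cos th)}.
  by apply: cvgB; [exact: cc|apply: cvgM; [exact: ci|exact: cc]].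
have cv : {for r, continuous (fun r : R => r * sin th)}.
  by apply: cvgM; [exact: ci|exact: cc].
have cN : {for r, continuous (fun r : R => ray_nsq s r th)}.
  by apply: cvgD; apply: cvgM.
have cNV : {for r, continuous (fun r : R => (ray_nsq s r th)^-1)}.
  by apply: cvgV => //; exact: cN.
rewrite /ray_dif; apply: cvgB; apply: cvgM; [exact: cV| |exact: cW|].
- apply: cvgD; [apply: cvgD; [exact: cc|apply: cvgB]|].
  + by apply: cvgM; [apply: cvgM; [exact: cc|exact: ci]|exact: cc].
  + by apply: cvgM; [apply: cvgM; [exact: cc|exact: cp]|exact: cc].
  + apply: cvgM; [|exact: cNV]; apply: cvgB.
      by apply: cvgM; [apply: cvgM; [exact: ci|exact: cc]|exact: cu].
    by apply: cvgM; exact: cv.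
- apply: cvgD; [apply: cvgB|].
  + by apply: cvgM; [apply: cvgM; [exact: cc|exact: ci]|exact: cc].
  + by apply: cvgM; [apply: cvgM; [exact: cc|exact: cp]|exact: cc].
  + by apply: cvgM; [apply: cvgM; [exact: cc|exact: cv]|exact: cNV].
Qed.

(** * Decay of the integrands along a ray *)

Lemma powR_le_affine {R : realType} (b r : R) : 0 <= b -> b <= 1 -> 0 <= r ->
  r `^ b <= 1 + r.
Proof.
move=> b0 b1 r0; have [r1|r1] := leP r 1.
  rewrite (@le_trans _ _ 1) ?lerDl//.
  have := @ge0_ler_powR R b b0 r 1; rewrite powR1; apply; rewrite ?nnegrE//.
by rewrite (le_trans (ler1_powR (ltW r1) b1))// lerDr.
Qed.

Lemma ln_le_sub1 {R : realType} (y : R) : 0 < y -> ln y <= y - 1.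
Proof.
move=> y0; rewrite -ler_expR lnK ?posrE//.
by have := expR_ge1Dx (y - 1); rewrite subrKC.
Qed.

Lemma expRN_powR_le {R : realType} (a b : R) (n : nat) :
  0 < a -> 0 < b -> exists2 M, 0 < M &
  forall r : R, 0 < r -> expR (- (a * r `^ b)) <= M / (1 + r) ^+ n.+1.
Proof.
move=> a0 b0.
pose m : R := n.+1%:R / b.
have m0 : 0 < m by rewrite divr_gt0.
(* With [y = r^b], [r^(n+1) = exp (m ln y)], and [m ln y - a y <= m ln (m / a)] follows from
   [ln v <= v - 1] at [v = a y / m]. The summand 1 takes care of [r <= 1]. *)
exists (2 ^+ n.+1 * (expR (m * ln (m / a)) + 1)).
  by rewrite mulr_gt0 ?exprn_gt0// addr_gt0// expR_gt0.
move=> r r0; rewrite ler_pdivlMr ?exprn_gt0 ?addr_gt0//.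
have [r1|r1] := leP r 1.
  apply: (@le_trans _ _ (2 ^+ n.+1)); last by rewrite ler_peMr ?exprn_ge0// lerDr expR_ge0.
  rewrite -[leRHS]mul1r; apply: ler_pM; rewrite ?expR_ge0 ?exprn_ge0 ?addr_ge0 ?(ltW r0)//.
    by rewrite -expR0 ler_expR oppr_le0 mulr_ge0 ?powR_ge0// ltW.
  by rewrite lerXn2r ?nnegrE ?addr_ge0 ?(ltW r0)//; lra.
apply: (@le_trans _ _ (expR (- (a * r `^ b)) * (2 * r) ^+ n.+1)).
  rewrite ler_wpM2l ?expR_ge0// lerXn2r ?nnegrE ?addr_ge0 ?mulr_ge0 ?(ltW r0)//; lra.
rewrite exprMn mulrCA ler_wpM2l ?exprn_ge0//.
rewrite (@le_trans _ _ (expR (m * ln (m / a))))// ?lerDl//.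
rewrite -{2}[r]lnK ?posrE// -expRM_natl -expRD ler_expR.
have y0 : 0 < r `^ b by rewrite powR_gt0.
have -> : n.+1%:R * ln r = m * ln (r `^ b).
  by rewrite ln_powR /m; field; rewrite gt_eqF.
have ay0 : 0 < a * r `^ b / m by rewrite divr_gt0// mulr_gt0.
have ma0 : 0 < m / a by rewrite divr_gt0.
have -> : r `^ b = (m / a) * (a * r `^ b / m) by field; rewrite !gt_eqF.
rewrite lnM ?posrE//.
have := ln_le_sub1 ay0.
rewrite -(ler_pM2l m0) => h.
rewrite (_ : - _ = - (a * r `^ b)); last by field; rewrite !gt_eqF.
rewrite mulrDr.
have e : m * (a * r `^ b / m) = a * r `^ b by field; rewrite gt_eqF.
move: h; rewrite mulrBr e; lra.
Qed.

Lemma powR_le_eps {R : realType} (x b e : R) : 0 < b -> b < 1 -> 0 < e -> 0 < x ->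
  exists K : R, forall r, 0 <= r -> x * r `^ b <= e * r + K.
Proof.
move=> b0 b1 e0 x0.
(* [M] is the point where [x r^b] and [e r] cross; rescaling by it reduces the claim to
   [r^b <= 1 + r]. *)
pose M : R := (e / x) `^ (b - 1)^-1.
have ex0 : 0 < e / x by rewrite divr_gt0.
have M0 : 0 < M by rewrite powR_gt0.
exists (x * M `^ b) => r r0.
have -> : r = M * (r / M) by field; rewrite gt_eqF.
have rM0 : 0 <= r / M by rewrite divr_ge0// ltW.
rewrite powRM ?(ltW M0)// mulrA.
have -> : e * (M * (r / M)) = x * M `^ b * (r / M).
  rewrite mulrA; congr (_ * _).
  rewrite -(@mulr_powRB1 _ M b) ?(ltW M0)//.
  have -> : M `^ (b - 1) = e / x.
    rewrite /M -powRrM mulVf ?powRr1 ?(ltW ex0)//; lra.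
  by field; rewrite gt_eqF.
rewrite -[X in _ + X]mulr1 -mulrDr ler_wpM2l ?mulr_ge0 ?powR_ge0 ?(ltW x0)//.
by rewrite addrC powR_le_affine// ltW.
Qed.

(** Half of the rate [c] absorbs [x r^b] up to a constant factor, the other half provides the
    polynomial decay. *)
Lemma expR_affine_powR_le {R : realType} (c x b : R) (n : nat) :
  0 < c -> 0 < x -> 0 < b -> b < 1 -> exists2 M, 0 < M &
  forall r : R, 0 < r -> expR (- (c * r) + x * r `^ b) <= M / (1 + r) ^+ n.+1.
Proof.
move=> c0 x0 b0 b1.
have c20 : 0 < c / 2 by rewrite divr_gt0.
have [K HK] := powR_le_eps b0 b1 c20 x0.
have [M M0 HM] := @expRN_powR_le R (c / 2) 1 n c20 ltr01.
exists (M * expR K); first by rewrite mulr_gt0 ?expR_gt0.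
move=> r r0.
have := HM _ r0; rewrite powRr1 ?(ltW r0)// => {}HM.
rewrite mulrAC (@le_trans _ _ (expR (- (c / 2 * r)) * expR K))//; last first.
  by rewrite ler_wpM2r ?expR_ge0.
rewrite -expRD ler_expR; have := HK _ (ltW r0); lra.
Qed.

Lemma norm_ray_comb_le {R : realType} (e p q u v N n0 k : R) :
  0 < n0 -> n0 <= N -> 0 <= e -> `|p| <= 1 -> `|q| <= 1 -> `|u| + `|v| <= k ->
  `|e * (p * u + q * v) / N| <= e * k / n0.
Proof.
move=> n00 nN e0 p1 q1 uvk.
have N0 : 0 < N by rewrite (lt_le_trans n00).
rewrite normrM normrM (ger0_norm e0) (@ger0_norm _ N^-1) ?invr_ge0 ?(ltW N0)//.
apply: ler_pM; rewrite ?mulr_ge0 ?invr_ge0 ?(ltW N0)//; last first.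
  by rewrite lef_pV2.
rewrite ler_wpM2l// (le_trans (ler_normD _ _))// (le_trans _ uvk)// !normrM.
by rewrite lerD// ler_piMl.
Qed.

(** Of the six powers of [1 + r], one is spent on the numerator and two on the logarithmic
    derivative inside [ray_dif]; the remaining three cover [1 + r^2]. The constant [C] does not
    depend on the angle, as differentiation under the integral requires. *)
Lemma norm_ray_le {R : realType} (b x s t M n0 : R) :
  0 < b -> b < 1 -> 0 < x -> 0 < s -> 0 <= t -> 0 < M -> 0 < n0 ->
  exists2 C, 0 < C & forall r th, 0 < r -> n0 <= ray_nsq s r th ->
    expR (ray_exp_re b x t r th) <= M / (1 + r) ^+ 6 ->
    [/\ `|ray_im b x s t r th| <= C / (1 + r ^+ 2),
        `|r * ray_re b x s t r th| <= r * (C / (1 + r ^+ 2)) &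
        `|ray_dif b x s t r th| <= C / (1 + r ^+ 2)].
Proof.
move=> b0 b1 x0 s0 t0 M0 n00.
pose k := (s + 2) / n0.
have k0 : 0 < k by rewrite divr_gt0// addr_gt0.
pose L := 1 + t + x * b + k.
have xb0 : 0 <= x * b by rewrite mulr_ge0 ?ltW.
have L1 : 1 <= L by rewrite /L; lra.
exists (2 * M * k * L).
  have L0 : 0 < L by lra.
  by do 3 (apply: mulr_gt0 => //).
move=> r th r0 nN eM.
have N0 : 0 < ray_nsq s r th by rewrite (lt_le_trans n00).
pose q := 1 + r.
have q1 : 1 <= q by rewrite lerDl ltW.
have q0 : 0 < q by rewrite (lt_le_trans ltr01).
have c1 (y : R) : `|cos y| <= 1 by rewrite ler_norml cos_geN1 cos_le1.
have s1 (y : R) : `|sin y| <= 1 by rewrite ler_norml sin_geN1 sin_le1.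
have nv : `|r * sin th| <= r by rewrite normrM gtr0_norm// ler_piMr// ltW.
have nc : `|r * cos th| <= r by rewrite normrM gtr0_norm// ler_piMr// ltW.
have nu : `|s - r * cos th| <= s + r.
  by rewrite (le_trans (ler_normB _ _))// gtr0_norm// lerD2l.
have nuv : `|s - r * cos th| + `|r * sin th| <= (s + 2) * q.
  rewrite (le_trans (lerD nu nv))// /q.
  have : 0 <= s * r by rewrite mulr_ge0 ?ltW.
  move: r0; lra.
have WVk (p p' : R) : `|p| <= 1 -> `|p'| <= 1 ->
    `|expR (ray_exp_re b x t r th) * (p * (s - r * cos th) + p' * (r * sin th)) /
      ray_nsq s r th| <= M * k / q ^+ 5.
  move=> hp hp'; apply: (le_trans (norm_ray_comb_le n00 nN (expR_ge0 _) hp hp' nuv)).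
  rewrite (_ : M * k / q ^+ 5 = M / q ^+ 6 * ((s + 2) * q) / n0); last first.
    by rewrite /k; field; rewrite !gt_eqF.
  by rewrite ler_wpM2r ?invr_ge0 ?(ltW n00)// ler_wpM2r// mulr_ge0 ?(ltW q0)// ltW// addr_gt0.
have hW : `|ray_im b x s t r th| <= M * k / q ^+ 5 by apply: WVk.
have hV : `|ray_re b x s t r th| <= M * k / q ^+ 5.
  have := WVk (cos (ray_exp_im b x t r th)) (- sin (ray_exp_im b x t r th)).
  by rewrite mulNr normrN; apply.
have qr n : (2 <= n)%N -> (q ^+ n)^-1 <= (1 + r ^+ 2)^-1.
  move=> n2; rewrite lef_pV2 ?posrE ?exprn_gt0 ?addr_gt0 ?exprn_gt0//.
  apply: (@le_trans _ _ (q ^+ 2)); last by rewrite ler_weXn2l.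
  by rewrite /q sqrrD expr1n mul1r lerD2r lerDl mulrn_wge0// ltW.
have Mk0 : 0 <= M * k by rewrite mulr_ge0 ?ltW.
have MkC : M * k <= 2 * M * k * L.
  rewrite (_ : 2 * M * k * L = M * k * (2 * L)); last by ring.
  by rewrite ler_peMr//; lra.
have rb : r `^ b <= q by rewrite powR_le_affine// ltW.
have rq : r <= q by rewrite lerDr.
have q2 : q <= q ^+ 2 by rewrite expr2 ler_peMr// ltW.
have hX (p p' : R) : `|p| <= 1 -> `|p'| <= 1 ->
    `|t * r * p - x * b * r `^ b * p'| <= (t + x * b) * q ^+ 2.
  move=> hp hp'; rewrite (le_trans (ler_normB _ _))// mulrDl lerD//.
    rewrite -mulrA normrM (ger0_norm t0) ler_wpM2l// normrM gtr0_norm//.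
    by rewrite (le_trans _ q2)// (le_trans _ rq)// ler_piMr// ltW.
  rewrite -mulrA normrM (ger0_norm xb0) ler_wpM2l// normrM ger0_norm ?powR_ge0//.
  by rewrite (le_trans _ q2)// (le_trans _ rb)// ler_piMr// powR_ge0.
have hN (y : R) : `|y| <= (s + 2) * q ^+ 2 -> `|y / ray_nsq s r th| <= k * q ^+ 2.
  move=> hy; rewrite normrM (@ger0_norm _ (_^-1)) ?invr_ge0 ?(ltW N0)//.
  rewrite (_ : k * _ = (s + 2) * q ^+ 2 / n0); last by rewrite /k; ring.
  by apply: ler_pM; rewrite ?invr_ge0 ?(ltW N0)// lef_pV2.
have h1 : `|(r * cos th * (s - r * cos th) - (r * sin th) ^+ 2) / ray_nsq s r th| <=
    k * q ^+ 2.
  apply: hN; rewrite (le_trans (ler_normB _ _))// normrM normrX.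
  apply: (@le_trans _ _ (r * (s + r) + r ^+ 2)).
    by rewrite lerD// ?ler_pM// lerXn2r ?nnegrE ?normr_ge0// ltW.
  have sr : 0 <= s * r by rewrite mulr_ge0 ?ltW.
  rewrite /q sqrrD; nra.
have h2 : `|s * (r * sin th) / ray_nsq s r th| <= k * q ^+ 2.
  apply: hN; rewrite normrM gtr0_norm//.
  apply: (@le_trans _ _ (s * q ^+ 2)); last by rewrite ler_wpM2r ?exprn_ge0 ?(ltW q0)//; lra.
  by rewrite ler_wpM2l ?(ltW s0)// (le_trans nv)// (le_trans rq).
have q21 : 1 <= q ^+ 2 by rewrite (le_trans q1).
split.
- rewrite (le_trans hW)//; apply: ler_pM; rewrite ?invr_ge0 ?exprn_ge0 ?(ltW q0)//.
  exact: qr.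
- rewrite normrM gtr0_norm// ler_wpM2l ?(ltW r0)// (le_trans hV)//.
  apply: ler_pM; rewrite ?invr_ge0 ?exprn_ge0 ?(ltW q0)//.
  exact: qr.
- apply: (@le_trans _ _ (M * k / q ^+ 5 * (L * q ^+ 2) + M * k / q ^+ 5 * (L * q ^+ 2))).
    rewrite /ray_dif (le_trans (ler_normB _ _))//.
    rewrite (normrM (ray_re b x s t r th)) (normrM (ray_im b x s t r th)).
    apply: lerD; apply: ler_pM => //.
      rewrite (le_trans (ler_normD _ _))//.
      rewrite (_ : L * _ = q ^+ 2 + (t + x * b) * q ^+ 2 + k * q ^+ 2); last by rewrite /L; ring.
      rewrite lerD// (le_trans (ler_normD _ _))// normr1 lerD//.
      exact: hX.
    rewrite (le_trans (ler_normD _ _))//.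
    rewrite (_ : L * _ = q ^+ 2 + (t + x * b) * q ^+ 2 + k * q ^+ 2); last by rewrite /L; ring.
    rewrite lerD// (le_trans (hX _ _ (s1 _) (s1 _)))// lerDr//; lra.
  rewrite (_ : _ + _ = 2 * M * k * L / q ^+ 3); last by field; rewrite gt_eqF.
  by rewrite ler_wpM2l ?qr// (le_trans _ MkC).
Qed.

Lemma cvg_div_oneDsqr_0 {R : realType} (C : R) :
  r * (C / (1 + r ^+ 2)) @[r --> 0^'+] --> 0.
Proof.
apply: cvg_at_right_filter.
have h : {for (0 : R), continuous (fun r : R => r * (C / (1 + r ^+ 2)))}.
  apply: cvgM; first exact: cvg_id.
  apply: cvgM; first exact: cvg_cst.
  apply: cvgV; first by rewrite expr0n/= addr0 oner_neq0.
  by apply: cvgD; [exact: cvg_cst|apply: cvgM; exact: cvg_id].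
by move: h; rewrite /prop_for /continuous_at mul0r.
Qed.

Lemma cvg_div_oneDsqr_pinfty {R : realType} (C : R) : 0 < C ->
  r * (C / (1 + r ^+ 2)) @[r --> +oo] --> 0.
Proof.
move=> C0.
have h : C / r @[r --> +oo] --> 0.
  rewrite -[X in _ --> X](mulr0 C); apply: cvgM; first exact: cvg_cst.
  apply: (gtr0_cvgV0 _).2; last exact: cvg_id.
  by near=> r; near: r; exact: nbhs_pinfty_gt.
apply: (squeeze_cvgr _ (cvg_cst 0) h).
near=> r.
have r0 : 0 < r by near: r; exact: nbhs_pinfty_gt.
have n0 : 0 < 1 + r ^+ 2 by rewrite addr_gt0// exprn_gt0.
rewrite mulr_ge0 ?(ltW r0) ?divr_ge0 ?(ltW C0) ?(ltW n0)//=.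
rewrite mulrA ler_pdivrMr// -subr_ge0.
rewrite (_ : _ - _ = C / r); last by field; rewrite gt_eqF.
by rewrite divr_ge0 ?ltW.
Unshelve. all: by end_near. Qed.

Lemma integrable_div_oneDsqr {R : realType} (C : R) :
  (@mu R).-integrable `]0, +oo[ (EFin \o (fun r : R => C / (1 + r ^+ 2))).
Proof.
have m0 : measurable (`]0, +oo[%classic : set (measurableTypeR R)).
  exact: measurable_itv.
exact: (integrableZl m0 C (integrable_oneDsqrV R)).
Qed.

(** The ray stays away from the pole [s] and the exponential decays. [M] and [n0] are parameters so
    that one pair can serve a whole range of angles. *)
Definition ray_bounded {R : realType} (b x s t M n0 th : R) :=
  forall r : R, 0 < r -> n0 <= ray_nsq s r th /\
    expR (ray_exp_re b x t r th) <= M / (1 + r) ^+ 6.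

Lemma integrable_ray_im {R : realType} (b x s t M n0 th : R) :
  0 < b -> b < 1 -> 0 < x -> 0 < s -> 0 <= t -> 0 < M -> 0 < n0 ->
  ray_bounded b x s t M n0 th ->
  (@mu R).-integrable `]0, +oo[ (EFin \o (fun r => ray_im b x s t r th)).
Proof.
move=> b0 b1 x0 s0 t0 M0 n00 gth.
have [C C0 HC] := norm_ray_le b0 b1 x0 s0 t0 M0 n00.
apply: (@integrable_le_oneDsqrV _ _ C).
  apply: derivable_measurable_pos => r r0; apply: derivable_ray_im_radius => //.
  by have [nN _] := gth _ r0; rewrite gt_eqF// (lt_le_trans n00).
by move=> r r0; have [nN eM] := gth _ r0; have [] := HC _ _ r0 nN eM.
Qed.

(** The integrand is the radial derivative of [r * ray_re], which vanishes at both ends of the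
    ray. *)
Lemma Rintegral_ray_dif {R : realType} (b x s t M n0 th : R) :
  0 < b -> b < 1 -> 0 < x -> 0 < s -> 0 <= t -> 0 < M -> 0 < n0 ->
  ray_bounded b x s t M n0 th ->
  \int[mu]_(r in `]0, +oo[) ray_dif b x s t r th = 0.
Proof.
move=> b0 b1 x0 s0 t0 M0 n00 gth.
have [C C0 HC] := norm_ray_le b0 b1 x0 s0 t0 M0 n00.
have hC r (r0 : 0 < r) : ray_nsq s r th != 0 /\ _ := let: conj nN eM := gth _ r0 in
  conj (negbT (gt_eqF (lt_le_trans n00 nN))) (HC _ _ r0 nN eM).
have cd r : 0 < r -> {for r, continuous (fun r => ray_dif b x s t r th)}.
  by move=> r0; apply: continuous_ray_dif_radius => //; have [] := hC _ r0.
have dV (r : R) : 0 < r ->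
    is_derive r 1 (fun r => r * ray_re b x s t r th) (ray_dif b x s t r th).
  by move=> r0; apply: is_derive_ray_re_radius => //; have [] := hC _ r0.
rewrite -[RHS](subr0 0); apply: (Rintegral_pinfty_FTC2 dV cd).
- apply: (@integrable_le_oneDsqrV _ _ C).
    apply: open_continuous_measurable_fun => // r.
    by rewrite inE/= in_itv/= andbT; exact: cd.
  by move=> r r0; have [_ []] := hC _ r0.
- apply: norm_cvg0; apply: (squeeze_cvgr _ (cvg_cst 0) (cvg_div_oneDsqr_0 C)).
  near=> r; have r0 : 0 < r by near: r; exact: nbhs_right_gt.
  by rewrite normr_ge0/=; have [_ []] := hC _ r0.
- apply: norm_cvg0; apply: (squeeze_cvgr _ (cvg_cst 0) (cvg_div_oneDsqr_pinfty C0)).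
  near=> r; have r0 : 0 < r by near: r; exact: nbhs_pinfty_gt.
  by rewrite normr_ge0/=; have [_ []] := hC _ r0.
Unshelve. all: by end_near. Qed.

(** Both angles lie strictly inside []a, c[] because differentiating under the integral needs the
    domination on a neighbourhood of each angle. *)
Lemma ray_rotation {R : realType} (b x s t M n0 a c th1 th2 : R) :
  0 < b -> b < 1 -> 0 < x -> 0 < s -> 0 <= t -> 0 < M -> 0 < n0 ->
  (forall th, a < th < c -> ray_bounded b x s t M n0 th) ->
  a < th1 -> th1 <= th2 -> th2 < c ->
  \int[mu]_(r in `]0, +oo[) ray_im b x s t r th1 =
  \int[mu]_(r in `]0, +oo[) ray_im b x s t r th2.
Proof.
move=> b0 b1 x0 s0 t0 M0 n00 gth ath1.
rewrite le_eqVlt => /predU1P[-> //|th12] th2c.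
have [C C0 HC] := norm_ray_le b0 b1 x0 s0 t0 M0 n00.
pose F th := \int[mu]_(r in `]0, +oo[) ray_im b x s t r th.
have dW r th : 0 < r -> a < th < c ->
    is_derive th 1 (ray_im b x s t r) (ray_dif b x s t r th).
  move=> r0 thac; have [nN _] := gth _ thac _ r0.
  by apply: is_derive_ray_im_angle; rewrite gt_eqF// (lt_le_trans n00).
have iW th : a < th < c ->
    (@mu R).-integrable `]0, +oo[ (EFin \o (fun r => ray_im b x s t r th)).
  by move=> thac; apply: (integrable_ray_im b0 b1 x0 s0 t0 M0 n00); exact: gth.
pose G (r : R) := C / (1 + r ^+ 2).
have G0 r : 0 <= G r by rewrite divr_ge0 ?(ltW C0)// addr_ge0 ?sqr_ge0.
have iG : (@mu R).-integrable `]0, +oo[ (EFin \o G).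
  exact: integrable_div_oneDsqr.
have dE th r : a < th < c -> 0 < r ->
    partial1of2 (fun th r => ray_im b x s t r th) th r = ray_dif b x s t r th.
  by move=> thac r0; rewrite partial1of2E; have [_ ->] := dW _ _ r0 thac.
have dG th (r : R) : `]a, c[%classic th -> `]0, +oo[%classic r ->
    `|partial1of2 (fun th r => ray_im b x s t r th) th r| <= G r.
  rewrite /= !in_itv/= andbT => thac r0; rewrite dE//.
  by have [nN eM] := gth _ thac _ r0; have [] := HC _ _ r0 nN eM.
have iW' th : `]a, c[%classic th ->
    (@mu R).-integrable `]0, +oo[ (EFin \o (fun r => ray_im b x s t r th)).
  by rewrite /= in_itv/=; exact: iW.
have dW' th (r : R) : `]a, c[%classic th -> `]0, +oo[%classic r ->
    derivable (fun th => ray_im b x s t r th) th 1.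
  by rewrite /= !in_itv/= andbT => thac r0; have [] := dW _ _ r0 thac.
have dF th : a < th < c -> is_derive th 1 F 0.
  move=> thac.
  have thI : (`]a, c[%classic : set R) th by rewrite /= in_itv.
  have m0 : measurable (`]0, +oo[%classic : set (measurableTypeR R)) by exact: measurable_itv.
  have d1 := derivable_under_integral m0 thI iW' dW' G0 iG dG.
  have d2 := differentiation_under_integral m0 thI iW' dW' G0 iG dG.
  apply: (DeriveDef d1); rewrite -derive1E d2.
  apply: (etrans _ (Rintegral_ray_dif b0 b1 x0 s0 t0 M0 n00 (gth _ thac))).
  by apply: eq_Rintegral => r; rewrite inE/= in_itv/= andbT => r0; rewrite dE.
have [||z _ E] := @MVT R F (cst 0) _ _ th12.
- move=> y; rewrite in_itv/= => /andP[y1 y2]; apply: dF.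
  by rewrite (lt_trans ath1)// (lt_trans y2).
- apply: derivable_within_continuous => y; rewrite in_itv/= => /andP[y1 y2].
  have [] := dF y; last by [].
  by rewrite (lt_le_trans ath1)// (le_lt_trans y2).
- by move: E; rewrite mul0r => /eqP; rewrite subr_eq0 => /eqP.
Qed.

(** * Cauchy's formula on a ray *)

Lemma norm_subr_le_derive {R : realType} (f df : R -> R) (k a c : R) : a <= c ->
  (forall z : R, is_derive z 1 f (df z)) ->
  (forall z, a <= z <= c -> `|df z| <= k) -> `|f c - f a| <= k * (c - a).
Proof.
move=> ac dF dk.
have cf : {within `[a, c], continuous f}.
  by apply: derivable_within_continuous => z _; have [] := dF z.
have [z zac ->] := MVT_segment ac (fun z _ => dF z) cf.
move: zac; rewrite in_itv/= => zac.
by rewrite normrM (@ger0_norm _ (c - a)) ?subr_ge0// ler_wpM2r ?subr_ge0// dk.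
Qed.

Lemma norm_cos_le1 {R : realType} (y : R) : `|cos y| <= 1.
Proof. by rewrite ler_norml cos_geN1 cos_le1. Qed.

Lemma norm_sin_le1 {R : realType} (y : R) : `|sin y| <= 1.
Proof. by rewrite ler_norml sin_geN1 sin_le1. Qed.

Lemma norm_sin_le {R : realType} (y : R) : `|sin y| <= `|y|.
Proof.
wlog y0 : y / 0 <= y => [h|].
  have [y0|/ltW y0] := leP 0 y; first exact: h.
  by rewrite -normrN -sinN -[in leRHS]normrN h// oppr_ge0.
have := @norm_subr_le_derive R sin cos 1 0 y y0.
rewrite sin0 !subr0 mul1r (ger0_norm y0); apply=> // z _.
exact: norm_cos_le1.
Qed.

Lemma norm_cosB1_le {R : realType} (y : R) : `|cos y - 1| <= `|y|.
Proof.
wlog y0 : y / 0 <= y => [h|].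
  have [y0|/ltW y0] := leP 0 y; first exact: h.
  by rewrite -cosN -[in leRHS]normrN h// oppr_ge0.
have := @norm_subr_le_derive R cos (fun z => - sin z) 1 0 y y0.
rewrite cos0 subr0 mul1r (ger0_norm y0); apply=> // z _.
by rewrite normrN norm_sin_le1.
Qed.

Lemma norm_expRB_le {R : realType} (p q : R) : p <= 0 -> q <= 0 ->
  `|expR p - expR q| <= `|p - q|.
Proof.
wlog pq : p q / q <= p => [h|] p0 q0.
  have [pq|/ltW pq] := leP q p; first exact: h.
  by rewrite distrC (distrC p) h.
have := @norm_subr_le_derive R expR expR 1 q p pq.
rewrite mul1r (ger0_norm (_ : 0 <= p - q)) ?subr_ge0//; apply=> // z /andP[_ zp].
by rewrite ger0_norm ?expR_ge0// -expR0 ler_expR (le_trans zp).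
Qed.

Lemma cos_ge_half {R : realType} (y : R) : 0 <= y -> y <= 2^-1 -> 2^-1 <= cos y.
Proof.
move=> y0 y1; have := norm_cosB1_le y; rewrite (ger0_norm y0) ler_norml => /andP[h _].
lra.
Qed.

Lemma sin_ge_half {R : realType} (y : R) : 0 <= y -> y <= 2^-1 -> y / 2 <= sin y.
Proof.
move=> y0 y1.
have cf : {within `[0, y], continuous (@sin R)}.
  by apply: derivable_within_continuous => z _; exact: derivable_sin.
have [z zac] := MVT_segment y0 (fun z _ => is_derive_sin z) cf.
rewrite sin0 !subr0 => ->; rewrite mulrC ler_wpM2r//.
by move: zac; rewrite in_itv/= => /andP[z0 zy]; apply: cos_ge_half => //; exact: le_trans zy _.
Qed.

(** By homogeneity it is enough to compare with 1, and [y^b] lies between 1 and [y]. *)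
Lemma norm_powRB_le {R : realType} (b s r : R) : 0 < b -> b <= 1 -> 0 < s -> 0 < r ->
  `|r `^ b - s `^ b| <= s `^ b / s * `|r - s|.
Proof.
move=> b0 b1 s0 r0.
have h (y : R) : 0 < y -> `|y `^ b - 1| <= `|y - 1|.
  move=> y0; have [y1|y1] := leP 1 y.
    have yb : 1 <= y `^ b by rewrite -[leLHS](powRr0 y) ler_powR// ltW.
    by rewrite !ger0_norm ?subr_ge0// lerD2r ler1_powR.
  have yb : y `^ b <= 1.
    by have := @ge0_ler_powR R b (ltW b0) y 1; rewrite powR1; apply; rewrite ?nnegrE// ltW.
  rewrite distrC (distrC y) !ger0_norm ?subr_ge0//; last exact: ltW.
  by rewrite lerD2l lerN2 ger1_powR// y0 ltW.
have rs : r = s * (r / s) by field; rewrite gt_eqF.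
have rs0 := divr_gt0 r0 s0.
have k := h _ rs0.
have -> : r `^ b - s `^ b = s `^ b * ((r / s) `^ b - 1).
  by rewrite mulrBr mulr1 -powRM ?(ltW s0) ?(ltW rs0)// -rs.
rewrite (_ : r - s = s * (r / s - 1)); last by field; rewrite gt_eqF.
rewrite !normrM (ger0_norm (powR_ge0 _ _)) (gtr0_norm s0).
by rewrite mulrA divfK ?gt_eqF// ler_wpM2l// powR_ge0.
Qed.

(** The squared distance from [s] to the ray, decomposed at the foot [r = s cos th] of the
    perpendicular; the lower bound [(s sin th)^2] becomes visible. *)
Lemma ray_nsqE {R : realType} (s r th : R) :
  ray_nsq s r th = (s * cos th - r) ^+ 2 + (s * sin th) ^+ 2.
Proof.
rewrite /ray_nsq !sqrrB !exprMn.
have -> : sin th ^+ 2 = 1 - cos th ^+ 2 by rewrite -(cos2Dsin2 th) addrAC subrr add0r.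
ring.
Qed.

Lemma ray_nsqE' {R : realType} (s r th : R) :
  ray_nsq s r th = (r - s) ^+ 2 + 2 * r * s * (1 - cos th).
Proof.
rewrite /ray_nsq !sqrrB !exprMn.
have -> : sin th ^+ 2 = 1 - cos th ^+ 2 by rewrite -(cos2Dsin2 th) addrAC subrr add0r.
ring.
Qed.

(** At [t = 0] the factor [e^(i th)] is absorbed by [e^(i th) (s - r e^(- i th)) = s e^(i th) - r],
    which isolates the Poisson numerator [s sin th]. *)
Lemma ray_im0E {R : realType} (b x s r th : R) :
  ray_im b x s 0 r th = expR (- (x * r `^ b * cos (b * th))) *
   (cos (x * r `^ b * sin (b * th)) * (s * sin th) -
    sin (x * r `^ b * sin (b * th)) * (s * cos th - r)) / ray_nsq s r th.
Proof.
rewrite /ray_im /ray_exp_re /ray_exp_im !mul0r !sub0r sinD cosD sinN cosN.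
congr (_ * _ / _).
transitivity (cos (x * r `^ b * sin (b * th)) * (s * sin th) -
   sin (x * r `^ b * sin (b * th)) * (s * cos th - r * (cos th ^+ 2 + sin th ^+ 2))).
  ring.
by rewrite cos2Dsin2 mulr1.
Qed.

Ltac nonneg := repeat first
  [ done | by apply: ltW | exact: powR_ge0 | exact: expR_ge0 | exact: normr_ge0
  | apply: addr_ge0 | apply: mulr_ge0 | rewrite invr_ge0 | apply: exprn_ge0 ].
(** With [p = |s cos th - r|] and [q = s sin th], [ray_nsq] is [p^2 + q^2], and everything follows
    from [2 p q <= p^2 + q^2] and [q <= s th <= 2 q]; the latter uses [th <= 1/2]. *)
Lemma ray_nsq_ge {R : realType} (s r th : R) : 0 < s -> 0 < th -> th <= 2^-1 ->
  [/\ (s * th) ^+ 2 <= 4 * ray_nsq s r th,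
      `|s * cos th - r| * (s * th) <= ray_nsq s r th,
      `|r - s| * (s * sin th) <= 5 * ray_nsq s r th &
      s * sin th <= s * th].
Proof.
move=> s0 th0 th1.
rewrite ray_nsqE; set p : R := `|s * cos th - r|; set q := s * sin th.
have sth : th / 2 <= sin th by apply: sin_ge_half => //; exact: ltW.
have q0 : 0 <= q by rewrite mulr_ge0 ?(ltW s0)// (le_trans _ sth)// divr_ge0// ltW.
have thq : s * th <= 2 * q.
  by rewrite /q mulrCA ler_wpM2l ?(ltW s0)//; lra.
have st0 : 0 <= s * th by rewrite mulr_ge0// ltW.
have p0 : 0 <= p by exact: normr_ge0.
have pE : (s * cos th - r) ^+ 2 = p ^+ 2 by rewrite /p real_normK ?num_real.
have qth : q <= s * th.
  rewrite ler_wpM2l ?(ltW s0)//; have := norm_sin_le th.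
  by rewrite (gtr0_norm th0); exact: le_trans (ler_norm _).
have rs : `|r - s| <= p + 2 * q.
  rewrite (_ : r - s = - (s * cos th - r) + s * (cos th - 1)); last by ring.
  rewrite (le_trans (ler_normD _ _))// normrN lerD2l (le_trans _ thq)//.
  rewrite normrM gtr0_norm// ler_wpM2l ?(ltW s0)//.
  by have := norm_cosB1_le th; rewrite (gtr0_norm th0).
rewrite pE; split=> //.
- apply: (@le_trans _ _ ((2 * q) ^+ 2)); first by rewrite lerXn2r ?nnegrE//; lra.
  nra.
- apply: (@le_trans _ _ (p * (2 * q))); first by rewrite ler_wpM2l.
  have := sqr_ge0 (p - q); rewrite sqrrB; lra.
- apply: (@le_trans _ _ ((p + 2 * q) * q)); first by rewrite ler_wpM2r.
  have := sqr_ge0 (p - q); rewrite sqrrB; nra.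
Qed.

(* Replacing [exp (-x z^b)] by [exp (-x s^b)] leaves an error dominated uniformly in the
   angle, so that only the Poisson kernel contributes as [th] tends to 0. *)
Lemma norm_ray_im0_sub_le {R : realType} (b x s : R) :
  0 < b -> b < 1 -> 0 < x -> 0 < s ->
  exists2 C, 0 < C & forall r th, 0 < r -> 0 < th -> th <= 2^-1 ->
    `|ray_im b x s 0 r th - expR (- (x * s `^ b)) * (s * sin th / ray_nsq s r th)|
    <= C / (1 + r ^+ 2).
Proof.
move=> b0 b1 x0 s0.
have x20 : 0 < x / 2 by rewrite divr_gt0.
have [M M0 HM] := @expRN_powR_le R (x / 2) b 5 x20 b0.
pose K := 5 * x * (s `^ b / s) + 9 * x * b / s.
have K0 : 0 <= K.
  by rewrite /K; nonneg.
pose C1 := K * (1 + 2 * s) * (1 + 4 * s ^+ 2).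
pose C2 := 8 * s * (1 + (4 * s ^+ 2)^-1) + M * x * b / s.
have C10 : 0 <= C1.
  by rewrite /C1; nonneg.
have C20 : 0 <= C2.
  by rewrite /C2; nonneg.
exists (1 + C1 + C2); first by clear -C10 C20; lra.
move=> r th r0 th0 th1.
have [g1 g2 g3 g4] := ray_nsq_ge r s0 th0 th1.
set N := ray_nsq s r th in g1 g2 g3 *.
have N0 : 0 < N.
  have : 0 < (s * th) ^+ 2 by rewrite exprn_gt0// mulr_gt0.
  lra.
set rb := r `^ b.
have rb0 : 0 <= rb by exact: powR_ge0.
have bth0 : 0 <= b * th by rewrite mulr_ge0 ?ltW.
have bth : b * th <= th by rewrite ler_piMl ?ltW.
have cb : 2^-1 <= cos (b * th) by apply: cos_ge_half => //; exact: le_trans th1.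
set p := x * rb * cos (b * th); set ph := x * rb * sin (b * th).
have xrb0 : 0 <= x * rb by rewrite mulr_ge0// ltW.
have p0 : 0 <= p by rewrite mulr_ge0// (le_trans _ cb).
have phb : `|ph| <= x * b * rb * th.
  rewrite /ph normrM (ger0_norm xrb0).
  have := norm_sin_le (b * th); rewrite (ger0_norm bth0) => /(ler_wpM2l xrb0).
  by move=> /le_trans; apply; rewrite le_eqVlt; apply/orP; left; apply/eqP; ring.
have e1 : expR (- p) <= 1 by rewrite -expR0 ler_expR oppr_le0.
have eM : expR (- p) <= M / (1 + r) ^+ 6.
  rewrite (le_trans _ (HM _ r0))// ler_expR lerN2.
  rewrite (_ : x / 2 * _ = x * rb * 2^-1); last by rewrite /rb; ring.
  by rewrite ler_wpM2l.
set F := expR (- (x * s `^ b)).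
have F1 : F <= 1 by rewrite -expR0 ler_expR oppr_le0 mulr_ge0 ?powR_ge0// ltW.
have F0 : 0 <= F by exact: expR_ge0.
(* The numerator error splits into a change of phase, a change of [cos (b th)] and a change of
   [r^b]; each is of first order in [th] or in [|r - s|]. *)
have num1 : `|expR (- p) * cos ph - F| <= x * (s `^ b / s) * `|r - s| + 2 * (x * b * rb * th).
  rewrite (_ : _ - F = expR (- p) * (cos ph - 1) + (expR (- p) - F)); last by ring.
  rewrite (le_trans (ler_normD _ _))// addrC mulr2n mulrDl mul1r addrA lerD//; last first.
    rewrite normrM ger0_norm ?expR_ge0// (le_trans _ phb)// (le_trans _ (norm_cosB1_le _))//.
    by rewrite ler_piMl.
  rewrite (le_trans (norm_expRB_le _ _)) ?oppr_le0 ?mulr_ge0 ?powR_ge0 ?(ltW x0)//; first exact: le_trans cb.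
  rewrite (_ : - p - _ = - (x * (rb - s `^ b)) - x * rb * (cos (b * th) - 1)); last by rewrite /p; ring.
  rewrite (le_trans (ler_normB _ _))// normrN lerD//.
    rewrite normrM gtr0_norm// -mulrA ler_wpM2l ?(ltW x0)//.
    by apply: norm_powRB_le => //; exact: ltW.
  rewrite normrM (ger0_norm xrb0).
  have := norm_cosB1_le (b * th); rewrite (ger0_norm bth0) => /(ler_wpM2l xrb0).
  by move=> /le_trans; apply; rewrite le_eqVlt; apply/orP; left; apply/eqP; ring.
have num1' : `|expR (- p) * cos ph - F| <= 2.
  rewrite (le_trans (ler_normB _ _))// (ger0_norm F0) normrM ger0_norm ?expR_ge0//.
  have : expR (- p) * `|cos ph| <= 1 by rewrite -[leRHS]mul1r ler_pM// ?expR_ge0// norm_cos_le1.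
  lra.
have num2 : `|sin ph * (s * cos th - r)| / N <= x * b * rb / s.
  rewrite ler_pdivrMr// normrM.
  apply: (@le_trans _ _ (x * b * rb * th * `|s * cos th - r|)).
    by rewrite ler_wpM2r// (le_trans (norm_sin_le _)).
  rewrite (_ : _ * _ = x * b * rb / s * (`|s * cos th - r| * (s * th))); last first.
    by field; rewrite gt_eqF.
  by rewrite ler_wpM2l// divr_ge0 ?mulr_ge0// ltW.
have sth0 : 0 <= s * sin th.
  by rewrite mulr_ge0 ?(ltW s0)// ltW// sin_gt0_pihalf// th0/=; have := @pi_ge2 R; lra.
rewrite ray_im0E -/rb -/p -/ph -/N.
rewrite (_ : _ - _ = (expR (- p) * cos ph - F) * (s * sin th) / N -
   expR (- p) * (sin ph * (s * cos th - r)) / N); last by ring.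
apply: (le_trans (ler_normB _ _)).
set D1 := expR (- p) * cos ph - F in num1 num1' *.
set Y := sin ph * (s * cos th - r) in num2 *.
have E1 : `|D1 * (s * sin th) / N| = `|D1| * (s * sin th / N).
  by rewrite -mulrA normrM (@ger0_norm _ (_ / N)) ?divr_ge0 ?(ltW N0).
have E2 : `|expR (- p) * Y / N| = expR (- p) * (`|Y| / N).
  by rewrite -mulrA !normrM ger0_norm ?expR_ge0// (@ger0_norm _ N^-1) ?invr_ge0 ?(ltW N0).
rewrite {}E1 {}E2.
have r20 : 0 < 1 + r ^+ 2 by rewrite addr_gt0// exprn_gt0.
have rbr : rb <= 1 + r by apply: powR_le_affine; exact: ltW.
have xbs0 : 0 <= x * b / s by nonneg.
(* Up to [2 s] the first-order smallness of the numerators at the pole compensates [1 / N]. Beyond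
   [2 s], [N] is at least [r^2 / 4]: the first term needs only the crude bound 2 on its numerator,
   the second only the decay of [exp (- p)]. *)
have [rs|rs] := leP r (2 * s).
  have T1 : `|D1| * (s * sin th / N) <= 5 * x * (s `^ b / s) + 8 * (x * b / s) * rb.
    rewrite [leLHS]mulrA ler_pdivrMr// (le_trans (ler_wpM2r sth0 num1))// mulrDl.
    rewrite [leRHS]mulrDl lerD//.
      rewrite (_ : 5 * x * _ * N = x * (s `^ b / s) * (5 * N)); last by ring.
      rewrite -[leLHS]mulrA.
      by rewrite ler_wpM2l//; nonneg.
    have h : th * (s * sin th) <= 4 * N / s.
      rewrite ler_pdivlMr//; apply: le_trans g1.
      rewrite (_ : _ ^+ 2 = th * (s * th) * s); last by ring.
      by rewrite ler_wpM2r ?(ltW s0)// ler_wpM2l// ltW.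
    rewrite (_ : 2 * _ * _ = 2 * (x * b * rb) * (th * (s * sin th))); last by ring.
    rewrite (_ : 8 * _ * _ * _ = 2 * (x * b * rb) * (4 * N / s)); last by ring.
    by rewrite ler_wpM2l//; nonneg.
  have T2 : expR (- p) * (`|Y| / N) <= x * b / s * rb.
    rewrite (@le_trans _ _ (`|Y| / N))//; first by rewrite ler_piMl//; nonneg.
    by rewrite (le_trans num2)// mulrAC.
  rewrite (le_trans (lerD T1 T2))// (@le_trans _ _ (C1 / (1 + r ^+ 2)))//; last first.
    by rewrite ler_wpM2r ?invr_ge0 ?(ltW r20)//; clear -C10 C20; lra.
  rewrite ler_pdivlMr//; apply: ler_pM; [by nonneg|by nonneg| |].
    apply: (@le_trans _ _ (K * (1 + r))).
      rewrite /K [leRHS]mulrDl -addrA; apply: lerD.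
        by rewrite ler_peMr//; [nonneg|lra].
      rewrite (_ : _ + _ = 9 * x * b / s * rb); last by ring.
      by rewrite ler_wpM2l//; nonneg.
    by rewrite ler_wpM2l// lerD2l.
  rewrite lerD2l (_ : 4 * s ^+ 2 = (2 * s) ^+ 2); last by ring.
  by rewrite lerXn2r ?nnegrE//; nonneg.
have T1 : `|D1| * (s * sin th / N) <= 8 * s * (1 + (4 * s ^+ 2)^-1) / (1 + r ^+ 2).
  have Nr : r ^+ 2 / 4 <= N.
    rewrite /N ray_nsqE' (@le_trans _ _ ((r - s) ^+ 2))//.
      rewrite (_ : _ / 4 = (r / 2) ^+ 2); last by field.
      by rewrite lerXn2r ?nnegrE//; clear -r0 s0 rs; lra.
    by rewrite lerDl; nonneg; rewrite subr_ge0 cos_le1.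
  have sN : s * sin th / N <= 4 * s / r ^+ 2.
    rewrite ler_pdivrMr// (@le_trans _ _ (4 * s / r ^+ 2 * (r ^+ 2 / 4)))//; last first.
      by rewrite ler_wpM2l//; nonneg.
    rewrite (_ : _ * (_ / 4) = s); last by field; rewrite gt_eqF.
    by rewrite ler_piMr ?(ltW s0)// sin_le1.
  rewrite (@le_trans _ _ (2 * (4 * s / r ^+ 2)))//.
    by apply: ler_pM => //; nonneg.
  rewrite ler_pdivlMr//.
  rewrite (_ : _ * (1 + _) = 8 * s * (1 + (r ^+ 2)^-1)); last by field; rewrite gt_eqF.
  rewrite ler_wpM2l//; first by nonneg.
  rewrite lerD2l lef_pV2 ?posrE ?mulr_gt0 ?exprn_gt0//.
  rewrite (_ : 4 * s ^+ 2 = (2 * s) ^+ 2); last by ring.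
  by rewrite lerXn2r ?nnegrE ?(ltW rs)//; nonneg.
have T2 : expR (- p) * (`|Y| / N) <= M * x * b / s / (1 + r ^+ 2).
  rewrite (@le_trans _ _ (M / (1 + r) ^+ 6 * (x * b / s * (1 + r))))//.
    apply: ler_pM => //; first by nonneg.
    by rewrite (le_trans num2)// mulrAC ler_wpM2l.
  have q0 : 0 < 1 + r by rewrite addr_gt0.
  rewrite (_ : _ * (_ * (1 + r)) = M * x * b / s / (1 + r) ^+ 5); last first.
    by field; rewrite !gt_eqF.
  rewrite ler_wpM2l//; first by nonneg.
  rewrite lef_pV2 ?posrE ?exprn_gt0//.
  apply: (@le_trans _ _ ((1 + r) ^+ 2)); last by rewrite ler_weXn2l// lerDl ltW.
  by rewrite sqrrD expr1n mul1r lerD2r lerDl mulrn_wge0// ltW.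
rewrite (le_trans (lerD T1 T2))// -mulrDl ler_wpM2r ?invr_ge0 ?(ltW r20)//.
rewrite -/C2; clear -C10 C20; lra.
Qed.

(** As [th] tends to 0 the kernel tends to 0 off [r = s], yet its mass tends to [pi]: this is the
    residue in Cauchy's formula. *)
Lemma poisson_kernel_integral {R : realType} (s th : R) : 0 < s -> 0 < th -> th < pi ->
  (@mu R).-integrable `]0, +oo[ (EFin \o (fun r : R => s * sin th / ray_nsq s r th)) /\
  \int[mu]_(r in `]0, +oo[) (s * sin th / ray_nsq s r th) = pi - th.
Proof.
move=> s0 th0 thpi.
have S0 : 0 < sin th by rewrite sin_gt0_pi// th0.
have sS0 : 0 < s * sin th by rewrite mulr_gt0.
have N0 r : 0 < ray_nsq s r th.
  by rewrite ray_nsqE ltr_wpDl ?sqr_ge0// exprn_gt0.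
pose f (r : R) := s * sin th / ray_nsq s r th.
pose F (r : R) := atan ((r - s * cos th) / (s * sin th)).
have dF (r : R) : is_derive r 1 F (f r).
  have di : is_derive r 1 (fun y : R => y) 1 by exact: is_derive_id.
  have d1 : is_derive r 1 (fun y => (y - s * cos th) / (s * sin th)) (s * sin th)^-1.
    have := is_deriveD (is_deriveZ (s * sin th)^-1 di)
      (is_derive_cst (- (s * cos th) / (s * sin th)) r (1 : R)).
    rewrite !fctE /GRing.scale/= => d.
    rewrite (_ : (fun y => _) = (fun y : R => (s * sin th)^-1 * y +
        - (s * cos th) / (s * sin th))); last first.
      by apply/funext => y; ring.
    by apply: (is_derive_eq d); rewrite addr0 mulr1.
  apply: (is_derive_eq (is_derive1_comp (is_derive1_atan _) d1)).
  have nz : (s * cos th - r) ^+ 2 + (s * sin th) ^+ 2 != 0 by rewrite -ray_nsqE gt_eqF.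
  rewrite /f ray_nsqE; field.
  rewrite nz !gt_eqF//=.
have cf (r : R) : {for r, continuous f}.
  apply: cvgM; first exact: cvg_cst.
  apply: cvgV; first by rewrite gt_eqF.
  have ci : {for r, continuous (fun r : R => r)} by exact: cvg_id.
  apply: cvgD; apply: cvgM; (try apply: cvgB); (try exact: cvg_cst);
    apply: cvgM => //; exact: cvg_cst.
have Foo : F r @[r --> +oo] --> pi / 2.
  apply: (cvg_comp (fun r : R => (r - s * cos th) / (s * sin th)) atan _ (@cvgy_atan R)).
  apply/cvgryPge => K; near=> r.
  rewrite ler_pdivlMr// lerBrDr; near: r; apply: nbhs_pinfty_ge; exact: num_real.
(* The argument of [atan] at 0 is [- cot th = tan (th - pi / 2)]. *)
have F0 : F 0 = th - pi / 2.
  have thI : - th + pi / 2 \in `](- (pi / 2)), (pi / 2)[ by rewrite in_itv/=; lra.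
  have -> : th - pi / 2 = - (- th + pi / 2) by ring.
  rewrite -(tanK thI) -atanN /F /tan sinDpihalf cosDpihalf sinN opprK cosN.
  by congr atan; field; rewrite !gt_eqF.
have mf : measurable_fun (`]0, +oo[ : set R) f.
  by apply: open_continuous_measurable_fun => // r _; exact: cf.
have I : (\int[mu]_(r in `]0%R, +oo[) (f r)%:E = (pi - th)%:E)%E.
  rewrite integral_itv_obnd_cbnd; last exact/measurable_EFinP.
  rewrite (@ge0_continuous_FTC2y _ f F 0 (pi / 2)) //.
  - by rewrite F0 -EFinD; congr EFin; field.
  - by move=> r _; rewrite divr_ge0 ?ltW.
  - by apply: continuous_subspaceT => r; exact: cf.
  - apply: cvg_at_right_filter; apply: differentiable_continuous; apply/derivable1_diffP.
    by have [] := dF 0.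
  - by move=> r _; rewrite derive1E; have [_ ->] := dF r.
split; last by rewrite /Rintegral I.
apply/integrableP; split; first exact/measurable_EFinP.
rewrite (_ : (\int[mu]_(x in _) _)%E = (pi - th)%:E) ?ltry// -I.
apply: eq_integral => r _ /=; by rewrite ger0_norm// divr_ge0// ltW.
Unshelve. all: by end_near. Qed.

(** The exceptional null set is a single point in the applications to Lebesgue measure: the pole
    [r = s] when the angle tends to 0, and the threshold [y = t] for the tail kernels. *)
Lemma cvg_Rintegral_dominated_ae d (T : measurableType d) {R : realType}
  (m : {measure set T -> \bar R})
  (D : set T) (f_ : nat -> T -> R) (f g : T -> R) :
  measurable D ->
  (forall n, measurable_fun D (f_ n)) -> measurable_fun D f ->
  {ae m, forall x, D x -> f_ n x @[n --> \oo] --> f x} ->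
  m.-integrable D (EFin \o g) ->
  {ae m, forall x, D x -> forall n, `|f_ n x| <= g x} ->
  \int[m]_(x in D) f_ n x @[n --> \oo] --> \int[m]_(x in D) f x.
Proof.
move=> mD mf_ mf ff ig fg.
have [||||/= intf _ cf] := @dominated_convergence _ _ R m D mD
  (fun n => EFin \o f_ n) (EFin \o f) (EFin \o g) _ _ _ ig.
- by move=> n; exact/measurable_EFinP.
- exact/measurable_EFinP.
- by apply: filterS ff => x ff Dx; apply: cvg_EFin; [exact: nearW|exact: ff].
- by apply: filterS fg => x fg n Dx /=; rewrite lee_fin fg.
apply: fine_cvg => //.
by rewrite fineK//; exact: integrable_fin_num.
Qed.

(** At [t = 0] the distance to the pole is at least [s sin th], whose minimum on [[a, c]] is
    positive, and all decay comes from [cos (b th) >= cos (b c) > 0]. *)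
Lemma ray_bounded_decay {R : realType} (b x s a c : R) :
  0 < b -> b < 1 -> 0 < x -> 0 < s -> 0 < a -> a < c -> c < pi -> b * c < pi / 2 ->
  exists M n0, [/\ 0 < M, 0 < n0 &
    forall th, a < th < c -> ray_bounded b x s 0 M n0 th].
Proof.
move=> b0 b1 x0 s0 a0 ac cpi bc.
have cf : {within `[a, c], continuous (@sin R)}.
  by apply: derivable_within_continuous => z _; exact: derivable_sin.
have [th0] := EVT_min (ltW ac) cf.
rewrite in_itv/= => /andP[ath0 th0c] hmin.
have S0 : 0 < sin th0 by rewrite sin_gt0_pi// (lt_le_trans a0 ath0) (le_lt_trans th0c).
have c0 : 0 < c by rewrite (lt_trans a0).
have bc0 : 0 < b * c by rewrite mulr_gt0.
have pi0 := @pi_gt0 R.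
have C0 : 0 < cos (b * c) by rewrite cos_gt0_pihalf// bc; lra.
have [M M0 HM] := @expRN_powR_le R (x * cos (b * c)) b 5 (mulr_gt0 x0 C0) b0.
exists M, ((s * sin th0) ^+ 2); split=> //; first by rewrite exprn_gt0// mulr_gt0.
move=> th /andP[ath thc] r r0; split.
  rewrite ray_nsqE (@le_trans _ _ ((s * sin th) ^+ 2))//; last by rewrite lerDr sqr_ge0.
  have h : sin th0 <= sin th by apply: hmin; rewrite in_itv/= !ltW.
  rewrite lerXn2r ?nnegrE ?mulr_ge0 ?(ltW s0) ?(ltW S0) ?(le_trans (ltW S0) h)//.
  by rewrite ler_wpM2l// ltW.
rewrite (le_trans _ (HM _ r0))// ler_expR /ray_exp_re !mul0r sub0r lerN2.
rewrite mulrAC ler_wpM2l ?mulr_ge0 ?powR_ge0 ?(ltW x0)//.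
have th00 : 0 < b * th by rewrite mulr_gt0// (lt_trans a0).
have thbc : b * th < b * c by rewrite ltr_pM2l.
by apply: ltW; rewrite ltr_cos// in_itv/=; apply/andP; split; lra.
Qed.

Lemma ray_cauchy {R : realType} (b x s th : R) :
  0 < b -> b < 1 -> 0 < x -> 0 < s -> 0 < th -> th < pi -> b * th < pi / 2 ->
  \int[mu]_(r in `]0, +oo[) ray_im b x s 0 r th = pi * expR (- (x * s `^ b)).
Proof.
move=> b0 b1 x0 s0 th0 thpi bth.
(* Room above [th], so that [th] is interior to a range of angles with upper end [c < pi] and
   [b c < pi / 2]. *)
pose del := Num.min ((pi - th) / 2) ((pi / 2 - b * th) / 2).
have del0 : 0 < del by rewrite lt_min; apply/andP; split; lra.
have d1 : del <= (pi - th) / 2 by rewrite ge_min lexx.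
have d2 : del <= (pi / 2 - b * th) / 2 by rewrite ge_min lexx orbT.
pose c := th + del.
have cpi : c < pi by rewrite /c; lra.
have bc : b * c < pi / 2.
  have : b * del <= del by rewrite ler_piMl ?ltW.
  rewrite /c mulrDr; lra.
(* The angles [z n] decrease to 0 while staying below [th], for the rotation, and below 1/2, for the
   domination near the pole. *)
pose tau : R := Num.min th 2^-1.
have tau0 : 0 < tau by rewrite lt_min th0/= invr_gt0.
have tau1 : tau <= th by rewrite ge_min lexx.
have tau2 : tau <= 2^-1 by rewrite ge_min lexx orbT.
pose z (n : nat) : R := tau / n.+2%:R.
have z0 n : 0 < z n by rewrite divr_gt0.
have ztau n : z n <= tau by rewrite ler_pdivrMr// ler_peMr ?(ltW tau0)// ler1n.
have zth n : z n <= th by exact: le_trans tau1.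
have zh n : z n <= 2^-1 by exact: le_trans tau2.
have zcvg : z n @[n --> \oo] --> 0.
  rewrite /z -[X in _ --> X](mulr0 tau); apply: cvgM; first exact: cvg_cst.
  apply: (gtr0_cvgV0 _).2; last exact: cvg_natS2_pinfty.
  by apply: nearW => n /=.
set F := expR (- (x * s `^ b)).
pose W t r := ray_im b x s 0 r t.
pose Q t (r : R) := s * sin t / ray_nsq s r t.
pose J := \int[mu]_(r in `]0, +oo[) W th r.
(* [M] and [n0] are chosen afresh for each [n] and may degenerate as the angle shrinks; uniformity
   in [n] is needed only for the error against the Poisson kernel. *)
have rot n : (@mu R).-integrable `]0, +oo[ (EFin \o W (z n)) /\
    \int[mu]_(r in `]0, +oo[) W (z n) r = J.
  have z20 : 0 < z n / 2 by rewrite divr_gt0.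
  have zc : z n / 2 < c by have := zth n; have := z0 n; rewrite /c; lra.
  have [M [n0 [M0 n00 HM]]] := ray_bounded_decay b0 b1 x0 s0 z20 zc cpi bc.
  split.
    apply: (integrable_ray_im b0 b1 x0 s0 (lexx 0) M0 n00); apply: HM.
    by have := zth n; have := z0 n; rewrite /c; lra.
  apply: (ray_rotation b0 b1 x0 s0 (lexx 0) M0 n00 HM); last 2 first.
  - exact: zth.
  - by rewrite /c; lra.
  - by have := z0 n; lra.
have zpi n : z n < pi by exact: le_lt_trans thpi.
have Qint n := poisson_kernel_integral s0 (z0 n) (zpi n).
have [C C0 HC] := norm_ray_im0_sub_le b0 b1 x0 s0.
have mFQ n : (@mu R).-integrable `]0, +oo[ (EFin \o (fun r => F * Q (z n) r)).
  have m0 : measurable (`]0, +oo[%classic : set (measurableTypeR R)).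
    exact: measurable_itv.
  exact: (integrableZl m0 F (Qint n).1).
have lim0 : \int[mu]_(r in `]0, +oo[) (W (z n) r - F * Q (z n) r) @[n --> \oo] --> 0.
  have e0 : \int[@mu R]_(r in `]0, +oo[) (0 : R) = 0 by rewrite /Rintegral integral0.
  rewrite -[X in _ --> X]e0.
  apply: (@cvg_Rintegral_dominated_ae _ _ R (@mu R) _ _ _ (fun r => C / (1 + r ^+ 2))) => //.
  - move=> n; apply: measurable_funB.
      by apply/measurable_EFinP; exact: measurable_int (rot n).1.
    by apply/measurable_EFinP; exact: measurable_int (mFQ n).
  (* At radius [s] the denominator vanishes at angle 0; at every other radius both terms are
     continuous in the angle there. *)
  - exists [set s]; split; [exact: measurable_set1|exact: lebesgue_measure_set1|].
    move=> r /= /not_implyP[]; rewrite in_itv/= andbT => r0 nc.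
    apply: contrapT => rs; apply: nc.
    have n0 : ray_nsq s r 0 != 0.
      rewrite ray_nsqE sin0 cos0 mulr0 mulr1 expr0n/= addr0 expf_eq0/= subr_eq0.
      by apply/eqP => h; apply: rs.
    have cW : {for 0, continuous (fun t => W t r)}.
      by apply: derivable_continuous_at; have [] := is_derive_ray_im_angle b x 0 n0.
    have cs : {for 0, continuous (fun t : R => s * sin t)}.
      by apply: cvgM; [exact: cvg_cst|exact: continuous_sin].
    have cr : {for 0, continuous (fun t : R => r * sin t)}.
      by apply: cvgM; [exact: cvg_cst|exact: continuous_sin].
    have cu : {for 0, continuous (fun t : R => s - r * cos t)}.
      apply: cvgB; first exact: cvg_cst.
      by apply: cvgM; [exact: cvg_cst|exact: continuous_cos].
    have cQ : {for 0, continuous (fun t => F * Q t r)}.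
      apply: cvgM; first exact: cvg_cst.
      apply: cvgM; first exact: cs.
      apply: cvgV => //; apply: cvgD; apply: cvgM; (exact: cu || exact: cr).
    have cWQ : {for 0, continuous (fun t => W t r - F * Q t r)} by exact: cvgB.
    have E0 : W 0 r - F * Q 0 r = 0.
      by rewrite /W /Q ray_im0E !(mulr0, sin0, mul0r, subrr).
    by rewrite -[X in _ --> X]E0; exact: (cvg_comp _ _ zcvg cWQ).
  - exact: integrable_div_oneDsqr.
  - by apply: aeW => r /=; rewrite in_itv/= andbT => r0 n; exact: HC.
have E n : J = \int[mu]_(r in `]0, +oo[) (W (z n) r - F * Q (z n) r) + F * (pi - z n).
  have m0 : measurable (`]0, +oo[%classic : set (measurableTypeR R)).
    exact: measurable_itv.
  rewrite (RintegralB m0 (rot n).1 (mFQ n)) (rot n).2.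
  rewrite (RintegralZl F m0 (Qint n).1) (Qint n).2.
  by rewrite subrK.
have L : \int[mu]_(r in `]0, +oo[) (W (z n) r - F * Q (z n) r) + F * (pi - z n)
    @[n --> \oo] --> 0 + F * (pi - 0).
  apply: cvgD lim0 _; apply: cvgM; first exact: cvg_cst.
  by apply: cvgB zcvg; exact: cvg_cst.
have L' : (fun n : nat => J) @ \oo --> 0 + F * (pi - 0).
  by apply: cvg_trans L; apply: near_eq_cvg; apply: nearW => n; rewrite -E.
rewrite -[LHS]/J mulrC -[RHS]add0r -[in RHS](subr0 pi).
by apply: (cvg_unique _ _ L') => //; exact: cvg_cst.
Qed.

(** * The Laplace transform of the ray density *)

(** A bound by a product of integrable functions gives integrability for the product measure through
    Tonelli. Multiplying by the indicators of [D1] and [D2] turns the restricted integrals into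
    integrals over the whole product. *)
Lemma Rintegral_Fubini_dominated d1 d2 (T1 : measurableType d1) (T2 : measurableType d2)
    {R : realType} (m1 : {sigma_finite_measure set T1 -> \bar R})
    (m2 : {sigma_finite_measure set T2 -> \bar R})
    (D1 : set T1) (D2 : set T2) (h : T1 -> T2 -> R) (g1 : T1 -> R) (g2 : T2 -> R) :
  measurable D1 -> measurable D2 ->
  measurable_fun setT (fun p : T1 * T2 => h p.1 p.2) ->
  m1.-integrable D1 (EFin \o g1) -> m2.-integrable D2 (EFin \o g2) ->
  (forall y r, D1 y -> D2 r -> `|h y r| <= g1 y * g2 r) ->
  m1.-integrable D1 (EFin \o (fun y => \int[m2]_(r in D2) h y r)) /\
  \int[m1]_(y in D1) \int[m2]_(r in D2) h y r =
  \int[m2]_(r in D2) \int[m1]_(y in D1) h y r.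
Proof.
move=> mD1 mD2 mh ig1 ig2 hg.
pose H (p : T1 * T2) : R := (h p.1 p.2) * (\1_D1 p.1 * \1_D2 p.2).
have mH : measurable_fun setT H.
  apply: measurable_funM => //; apply: measurable_funM.
  - by apply: (measurableT_comp (measurable_indic mD1)); exact: measurable_fst.
  - by apply: (measurableT_comp (measurable_indic mD2)); exact: measurable_snd.
have mHE : measurable_fun setT (EFin \o H) by exact/measurable_EFinP.
have ih y : D1 y -> m2.-integrable D2 (EFin \o h y).
  move=> Dy; apply: (@le_integrable _ _ R m2 _ mD2 _ (fun r => (g1 y)%:E * (g2 r)%:E)%E).
  - apply/measurable_EFinP; apply: measurable_funTS.
    exact: (measurableT_comp mh (pair1_measurable y)).
  - by move=> r Dr; rewrite lee_fin (le_trans (hg _ _ Dy Dr))// ler_norm.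
  - exact: integrableZl.
have ih' r : D2 r -> m1.-integrable D1 (EFin \o h ^~ r).
  move=> Dr; apply: (@le_integrable _ _ R m1 _ mD1 _ (fun y => (g2 r)%:E * (g1 y)%:E)%E).
  - apply/measurable_EFinP; apply: measurable_funTS.
    exact: (measurableT_comp mh (pair2_measurable r)).
  - by move=> y Dy; rewrite lee_fin mulrC (le_trans (hg _ _ Dy Dr))// ler_norm.
  - exact: integrableZl.
pose A y := \int[m2]_(r in D2) h y r.
pose B r := \int[m1]_(y in D1) h y r.
have EA y : (\int[m2]_r (EFin \o H) (y, r) = ((A \_ D1) y)%:E)%E.
  rewrite patchE; case: ifPn => Dy.
    rewrite /A /Rintegral fineK; last by apply: integrable_fin_num => //; apply: ih; exact: set_mem.
    rewrite [RHS]integral_mkcond; apply: eq_integral => r _ /=.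
    rewrite /H/= indicE Dy mul1r patchE indicE.
    by case: ifPn => Dr; rewrite ?(mulr1, mulr0).
  apply: integral0_eq => r _ /=.
  by rewrite /H/= indicE (negbTE Dy) mul0r mulr0.
have EB r : (\int[m1]_y (EFin \o H) (y, r) = ((B \_ D2) r)%:E)%E.
  rewrite patchE; case: ifPn => Dr.
    rewrite /B /Rintegral fineK; last by apply: integrable_fin_num => //; apply: ih'; exact: set_mem.
    rewrite [RHS]integral_mkcond; apply: eq_integral => y _ /=.
    rewrite /H/= [\1_D2 _]indicE Dr mulr1 patchE indicE.
    by case: ifPn => Dy; rewrite ?(mulr1, mulr0).
  apply: integral0_eq => y _ /=.
  by rewrite /H/= [\1_D2 _]indicE (negbTE Dr) !mulr0.
have iH : (m1 \x m2)%E.-integrable setT (EFin \o H).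
  apply/integrable12ltyP => //.
  have /integrableP[mg1 g1fin] := ig1; have /integrableP[mg2 g2fin] := ig2.
  pose K := (\int[m2]_(r in D2) `|(g2 r)%:E|)%E.
  have K0 : (0 <= K)%E by exact: integral_ge0.
  apply: (@le_lt_trans _ _ (\int[m1]_(y in D1) (`|(g1 y)%:E| * K)))%E; last first.
    rewrite ge0_integralZr//; last exact: measurableT_comp.
    apply: lte_mul_pinfty; [exact: integral_ge0| |exact: g2fin].
    by rewrite ge0_fin_numE; [exact: g1fin|exact: integral_ge0].
  rewrite [leRHS]integral_mkcond; apply: ge0_le_integral => //.
  - by move=> y _; exact: integral_ge0.
  - apply: (measurable_fun_fubini_tonelli_F (abse \o (EFin \o H))) => //.
      exact: measurableT_comp.
    by move=> p; exact: abse_ge0.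
  - apply/(measurable_restrictT _ mD1).
    by apply: emeasurable_funM; [exact: measurableT_comp|exact: measurable_cst].
  - move=> y _; rewrite patchE; case: ifPn => Dy; last first.
      rewrite integral0_eq// => r _.
      by rewrite /H/= indicE (negbTE Dy) mul0r mulr0 normr0.
    rewrite /K -ge0_integralZl//; last exact: measurableT_comp.
    rewrite [leRHS]integral_mkcond; apply: ge0_le_integral => //.
    + by do 2 apply: measurableT_comp => //; exact: pair1_measurable.
    + apply/(measurable_restrictT _ mD2).
      by apply: emeasurable_funM; [exact: measurable_cst|exact: measurableT_comp].
    + move=> r _; rewrite patchE /H/= indicE Dy mul1r [\1_D2 _]indicE.
      case: ifPn => Dr; last by rewrite mulr0 normr0.
      rewrite mulr1 -EFinM lee_fin -normrM.
      by apply: (le_trans (hg _ _ (set_mem Dy) (set_mem Dr))); exact: ler_norm.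
have iA : m1.-integrable setT (EFin \o (A \_ D1)).
  have := integrable_fubini_F iH; rewrite /fubini_F.
  by apply: eq_integrable => // y _; rewrite EA.
split.
- have := (@integrable_mkcond _ _ _ m1 D1 (EFin \o A) mD1).2.
  by rewrite restrict_EFin; exact.
- rewrite (Rintegral_mkcond m1) (Rintegral_mkcond m2) /Rintegral; congr fine.
  transitivity (\int[m1]_x \int[m2]_y (EFin \o H) (x, y))%E.
    by apply: eq_integral => y _; rewrite EA.
  by rewrite (Fubini iH); apply: eq_integral => r _; rewrite EB.
Qed.

Lemma Rintegral_lebesgue_Fubini {R : realType} (D1 D2 : set R) (h : R -> R -> R)
    (g1 g2 : R -> R) :
  measurable D1 -> measurable D2 ->
  measurable_fun setT (fun p : R * R => h p.1 p.2) ->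
  (@mu R).-integrable D1 (EFin \o g1) -> (@mu R).-integrable D2 (EFin \o g2) ->
  (forall y r, D1 y -> D2 r -> `|h y r| <= g1 y * g2 r) ->
  (@mu R).-integrable D1 (EFin \o (fun y => \int[mu]_(r in D2) h y r)) /\
  \int[mu]_(y in D1) \int[mu]_(r in D2) h y r =
  \int[mu]_(r in D2) \int[mu]_(y in D1) h y r.
Proof.
exact: (@Rintegral_Fubini_dominated _ _ _ _ R (@mu R) (@mu R)).
Qed.

Lemma eq_integrable_lebesgue {R : realType} (D : set R) (f g : R -> R) :
  measurable D -> (forall y, D y -> f y = g y) ->
  (@mu R).-integrable D (EFin \o f) -> (@mu R).-integrable D (EFin \o g).
Proof.
move=> mD fg; apply: eq_integrable => //= y Dy; congr EFin.
by apply: fg; exact: set_mem.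
Qed.

Lemma eq_Rintegral_lebesgue {R : realType} (D : set R) (f g : R -> R) :
  (forall y, D y -> f y = g y) ->
  \int[mu]_(y in D) f y = \int[mu]_(y in D) g y.
Proof. by move=> fg; apply: eq_Rintegral => y Dy; apply: fg; exact: set_mem. Qed.

Lemma integrable_expRN {R : realType} (u t : R) : 0 < u -> 0 <= t ->
  (@mu R).-integrable `]t, +oo[ (EFin \o (fun y : R => expR (- (u * y)))).
Proof.
move=> u0 t0.
apply: (@integrableS _ _ _ (@mu R) `]0, +oo[%classic) => //.
  by apply: subset_itvr; rewrite bnd_simp.
have [M M0 HM] := @expRN_powR_le R u 1 1 u0 ltr01.
apply: (@integrable_le_oneDsqrV _ _ M).
  apply: measurable_funTS; apply: measurableT_comp => //.
  by apply: measurableT_comp => //; exact: measurable_funM.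
move=> y y0; have := HM y y0; rewrite powRr1 ?(ltW y0)// => h.
rewrite ger0_norm ?expR_ge0// (le_trans h)// ler_wpM2l ?(ltW M0)//.
rewrite lef_pV2 ?posrE ?exprn_gt0 ?addr_gt0 ?exprn_gt0//.
by rewrite sqrrD expr1n mul1r lerD2r lerDl mulrn_wge0// ltW.
Qed.

Lemma cvg_expRN_pinfty {R : realType} (u : R) : 0 < u ->
  expR (- (u * y)) @[y --> +oo] --> 0.
Proof.
move=> u0.
apply: (cvg_comp (fun y : R => u * y) (fun z => expR (- z)) _ (@cvgr_expR R)).
apply/cvgryPge => K; near=> y.
rewrite mulrC -ler_pdivrMr//; near: y; apply: nbhs_pinfty_ge; exact: num_real.
Unshelve. all: by end_near. Qed.

Lemma integrable_expRN_sin {R : realType} (u v B t : R) : 0 < u -> 0 <= t ->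
  (@mu R).-integrable `]t, +oo[
    (EFin \o (fun y : R => expR (- (u * y)) * sin (v * y + B))).
Proof.
move=> u0 t0.
apply: (@le_integrable _ _ R (@mu R) _ _ _ (EFin \o (fun y : R => expR (- (u * y))))) => //.
- apply/measurable_EFinP; apply: measurable_funM; apply: measurable_funTS.
    apply: measurableT_comp => //.
    by apply: measurableT_comp => //; exact: measurable_funM.
  apply: (measurableT_comp (f := sin)).
    exact: continuous_measurable_fun (@continuous_sin R).
  by apply: measurable_funD => //; exact: measurable_funM.
- move=> y _; rewrite lee_fin (@ger0_norm _ (expR _)) ?expR_ge0//.
  by rewrite normrM ger0_norm ?expR_ge0// ler_piMr ?expR_ge0// norm_sin_le1.
- exact: integrable_expRN.
Qed.

(** Imaginary part of the integral of [exp (i B - (u - i v) y)], which is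
    [exp (i B - (u - i v) t) / (u - i v)]; it will be used with [u - i v = s - z]. *)
Lemma Rintegral_expRN_sin {R : realType} (u v B t : R) : 0 < u -> 0 <= t ->
  \int[mu]_(y in `]t, +oo[) (expR (- (u * y)) * sin (v * y + B)) =
  expR (- (u * t)) * (u * sin (v * t + B) + v * cos (v * t + B)) / (u ^+ 2 + v ^+ 2).
Proof.
move=> u0 t0.
have n0 : u ^+ 2 + v ^+ 2 != 0 by rewrite gt_eqF// ltr_wpDr ?sqr_ge0// exprn_gt0.
pose F (y : R) := expR (- (u * y)) * (u * sin (v * y + B) + v * cos (v * y + B)) *
  - (u ^+ 2 + v ^+ 2)^-1.
have dl (c e : R) (y : R) : is_derive y 1 (fun y : R => c * y + e) c.
  have di : is_derive y 1 (fun y : R => y) 1 by exact: is_derive_id.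
  have := is_deriveD (is_deriveZ c di) (is_derive_cst e y (1 : R)).
  rewrite !fctE /GRing.scale/= => d.
  by apply: (is_derive_eq d); rewrite addr0 mulr1.
have dF (y : R) : is_derive y 1 F (expR (- (u * y)) * sin (v * y + B)).
  have d1 := @is_derive1_comp R expR (fun z => - u * z + 0) y _ _ (is_derive_expR _) (dl _ _ _).
  have d2 := @is_derive1_comp R sin (fun z => v * z + B) y _ _ (is_derive_sin _) (dl _ _ _).
  have d3 := @is_derive1_comp R cos (fun z => v * z + B) y _ _ (is_derive_cos _) (dl _ _ _).
  have := is_deriveM (is_deriveM d1 (is_deriveD (is_deriveZ u d2) (is_deriveZ v d3)))
    (is_derive_cst (- (u ^+ 2 + v ^+ 2)^-1) y (1 : R)).
  rewrite !fctE /GRing.scale/= => d.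
  rewrite (_ : F = (fun x => expR (- u * x + 0) * (u * sin (v * x + B) +
    v * cos (v * x + B)) * - (u ^+ 2 + v ^+ 2)^-1)); last first.
    by apply/funext => z; rewrite /F addr0 mulNr.
  apply: (is_derive_eq d); rewrite addr0 mulNr /GRing.scale/=; field.
  exact: n0.
have cF (y : R) : {for y, continuous F}.
  by apply: derivable_continuous_at; have [] := dF y.
have cf (y : R) : t < y -> {for y, continuous (fun y : R => expR (- (u * y)) * sin (v * y + B))}.
  move=> _.
  have c1 : {for y, continuous (fun y : R => expR (- (u * y)))}.
    apply: derivable_continuous_at.
    rewrite (_ : (fun y => _) = expR \o (fun z => - u * z + 0)); last first.
      by apply/funext => z /=; rewrite addr0 mulNr.
    by have [] := @is_derive1_comp R expR (fun z => - u * z + 0) y _ _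
      (is_derive_expR _) (dl _ _ _).
  have c2 : {for y, continuous (fun y : R => sin (v * y + B))}.
    apply: derivable_continuous_at.
    by have [] := @is_derive1_comp R sin (fun z => v * z + B) y _ _
      (is_derive_sin _) (dl _ _ _).
  by apply: cvgM; [exact: c1|exact: c2].
have intf := integrable_expRN_sin v B u0 t0.
have Foo : F y @[y --> +oo] --> 0.
  pose K := (u + `|v|) / (u ^+ 2 + v ^+ 2).
  have hK : expR (- (u * y)) * K @[y --> +oo] --> 0.
    rewrite -[X in _ --> X](mul0r K); apply: cvgM; last exact: cvg_cst.
    exact: cvg_expRN_pinfty.
  apply: norm_cvg0; apply: (squeeze_cvgr _ (cvg_cst 0) hK).
  near=> y; rewrite normr_ge0/= /F mulrN normrN -mulrA normrM ger0_norm ?expR_ge0//.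
  rewrite ler_wpM2l ?expR_ge0// normrM (@ger0_norm _ (_^-1)); last first.
    by rewrite invr_ge0 addr_ge0// sqr_ge0.
  rewrite ler_wpM2r ?invr_ge0 ?addr_ge0 ?sqr_ge0//.
  rewrite (le_trans (ler_normD _ _))// !normrM (gtr0_norm u0) lerD//.
    by rewrite ler_piMr ?norm_sin_le1// ltW.
  by rewrite ler_piMr ?norm_cos_le1.
rewrite (Rintegral_pinfty_FTC2 (fun y _ => dF y) cf intf (cvg_at_right_filter (cF t)) Foo).
by rewrite sub0r /F; ring.
Unshelve. all: by end_near. Qed.

(** Up to the factor [1 / pi], the Bromwich integral inverting [exp (- x s^b)], bent onto the rays
    of angles [th] and [- th] and folded onto the upper one. *)
Definition ray_density {R : realType} (b x th y : R) : R :=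
  \int[mu]_(r in `]0, +oo[)
    (expR (ray_exp_re b x y r th) * sin (ray_exp_im b x y r th)).

Lemma measurable_ray_integrand {R : realType} (b x s th : R) :
  measurable_fun setT (fun p : R * R => expR (- (s * p.1)) *
    (expR (ray_exp_re b x p.1 p.2 th) * sin (ray_exp_im b x p.1 p.2 th))).
Proof.
have m1 : measurable_fun setT (fun p : R * R => p.1) by exact: measurable_fst.
have m2 : measurable_fun setT (fun p : R * R => p.2) by exact: measurable_snd.
have m2b : measurable_fun setT (fun p : R * R => p.2 `^ b).
  by apply: (measurableT_comp (measurable_powR _)).
have me (f : R * R -> R) : measurable_fun setT f -> measurable_fun setT (fun p => expR (f p)).
  by move=> mf; apply: (measurableT_comp (@measurable_expR R)).
have ms (f : R * R -> R) : measurable_fun setT f -> measurable_fun setT (fun p => sin (f p)).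
  by move=> mf; apply: measurableT_comp => //; exact: continuous_measurable_fun (@continuous_sin R).
have mc (k : R) : measurable_fun setT (fun p : R * R => k) by exact: measurable_cst.
have mM (f g : R * R -> R) : measurable_fun setT f -> measurable_fun setT g ->
  measurable_fun setT (fun p => f p * g p) by exact: measurable_funM.
have mB (f g : R * R -> R) : measurable_fun setT f -> measurable_fun setT g ->
  measurable_fun setT (fun p => f p - g p) by exact: measurable_funB.
have mD (f g : R * R -> R) : measurable_fun setT f -> measurable_fun setT g ->
  measurable_fun setT (fun p => f p + g p) by exact: measurable_funD.
have mN (f : R * R -> R) : measurable_fun setT f -> measurable_fun setT (fun p => - f p).
  by move=> mf; apply: measurableT_comp => //.
apply: (mM); first by apply: (me); apply: (mN); exact: (mM).
apply: (mM).
  by apply: (me); apply: (mB); apply: (mM) => //; apply: (mM).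
by apply: (ms); apply: (mD) => //; apply: (mB); apply: (mM) => //; apply: (mM).
Qed.

Lemma norm_ray_integrand_le {R : realType} (b x s y r th : R) :
  0 < x -> 0 <= y -> 0 < r -> cos th <= 0 ->
  `|expR (- (s * y)) * (expR (ray_exp_re b x y r th) * sin (ray_exp_im b x y r th))|
    <= expR (- (s * y)) * expR (- (x * cos (b * th) * r `^ b)).
Proof.
move=> x0 y0 r0 cth; rewrite normrM ger0_norm ?expR_ge0// ler_wpM2l ?expR_ge0//.
rewrite normrM ger0_norm ?expR_ge0// (@le_trans _ _ (expR (ray_exp_re b x y r th)))//.
  by rewrite ler_piMr ?expR_ge0// norm_sin_le1.
rewrite ler_expR /ray_exp_re (_ : x * cos _ * _ = x * r `^ b * cos (b * th)); last by ring.
by rewrite gerDr mulr_ge0_le0// mulr_ge0// ltW.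
Qed.

Lemma integrable_expRN_powR {R : realType} (a b : R) : 0 < a -> 0 < b ->
  (@mu R).-integrable `]0, +oo[ (EFin \o (fun r : R => expR (- (a * r `^ b)))).
Proof.
move=> a0 b0; have [M M0 HM] := @expRN_powR_le R a b 1 a0 b0.
apply: (@integrable_le_oneDsqrV _ _ M).
  apply: measurable_funTS; apply: measurableT_comp => //.
  by apply: measurableT_comp => //; exact: measurable_funM.
move=> r r0; rewrite ger0_norm ?expR_ge0// (le_trans (HM r r0))// ler_wpM2l ?(ltW M0)//.
rewrite lef_pV2 ?posrE ?exprn_gt0 ?addr_gt0 ?exprn_gt0//.
by rewrite sqrrD expr1n mul1r lerD2r lerDl mulrn_wge0// ltW.
Qed.

Lemma integrable_ray_integrand {R : realType} (b x y th : R) :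
  0 < b -> 0 < x -> 0 <= y -> cos th <= 0 -> 0 < cos (b * th) ->
  (@mu R).-integrable `]0, +oo[ (EFin \o (fun r : R =>
    expR (ray_exp_re b x y r th) * sin (ray_exp_im b x y r th))).
Proof.
move=> b0 x0 y0 cth cbth.
have a0 : 0 < x * cos (b * th) by rewrite mulr_gt0.
apply: (@le_integrable _ _ R (@mu R) _ _ _
  (EFin \o (fun r : R => expR (- (x * cos (b * th) * r `^ b))))) => //.
- apply/measurable_EFinP; apply: measurable_funTS.
  have := measurableT_comp (measurable_ray_integrand b x 0 th) (pair1_measurable y).
  apply: eq_measurable_fun => r _ /=.
  by rewrite mul0r oppr0 expR0 mul1r.
- move=> r /=; rewrite in_itv/= andbT => r0.
  rewrite lee_fin (@ger0_norm _ (expR _)) ?expR_ge0//.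
  by have := norm_ray_integrand_le b 0 x0 y0 r0 cth; rewrite mul0r oppr0 expR0 !mul1r.
- exact: integrable_expRN_powR.
Qed.

Lemma integrable_ray_im_left {R : realType} (b x s t th : R) :
  0 < b -> b < 1 -> 0 < x -> 0 < s -> 0 <= t -> cos th <= 0 -> 0 < cos (b * th) ->
  (@mu R).-integrable `]0, +oo[ (EFin \o (fun r : R => ray_im b x s t r th)).
Proof.
move=> b0 b1 x0 s0 t0 cth cbth.
have a0 : 0 < x * cos (b * th) by rewrite mulr_gt0.
have [M M0 HM] := @expRN_powR_le R _ b 5 a0 b0.
have s20 : 0 < s ^+ 2 by rewrite exprn_gt0.
apply: (integrable_ray_im b0 b1 x0 s0 t0 M0 s20) => r r0; split.
  rewrite /ray_nsq (@le_trans _ _ ((s - r * cos th) ^+ 2)) ?lerDl ?sqr_ge0//.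
  have h : r * cos th <= 0 by rewrite mulr_ge0_le0// ltW.
  by rewrite lerXn2r ?nnegrE ?(ltW s0)//; lra.
rewrite (le_trans _ (HM _ r0))// ler_expR /ray_exp_re.
rewrite (_ : x * cos _ * _ = x * r `^ b * cos (b * th)); last by ring.
by rewrite gerDr mulr_ge0_le0// mulr_ge0// ltW.
Qed.

(** After exchanging the integrals, the inner one over [y] produces [1 / (s - z)]. The exchange is
    dominated by a product because [cos th <= 0] removes [y] from the growth in [r], while
    [cos (b th) > 0] gives decay in [r] even at [t = 0]. *)
Lemma ray_density_laplace {R : realType} (b x s t th : R) :
  0 < b -> b < 1 -> 0 < x -> 0 < s -> 0 <= t -> cos th <= 0 -> 0 < cos (b * th) ->
  (@mu R).-integrable `]t, +oo[
    (EFin \o (fun y => expR (- (s * y)) * ray_density b x th y)) /\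
  \int[mu]_(y in `]t, +oo[) (expR (- (s * y)) * ray_density b x th y) =
  expR (- (s * t)) * \int[mu]_(r in `]0, +oo[) ray_im b x s t r th.
Proof.
move=> b0 b1 x0 s0 t0 cth cbth.
pose h (y r : R) := expR (- (s * y)) *
  (expR (ray_exp_re b x y r th) * sin (ray_exp_im b x y r th)).
have hb (y r : R) : `]t, +oo[%classic y -> `]0, +oo[%classic r ->
    `|h y r| <= expR (- (s * y)) * expR (- (x * cos (b * th) * r `^ b)).
  rewrite /= !in_itv/= !andbT => ty r0.
  by apply: norm_ray_integrand_le => //; apply: ltW; exact: le_lt_trans ty.
have a0 : 0 < x * cos (b * th) by rewrite mulr_gt0.
have m0 : measurable (`]0, +oo[%classic : set R) by exact: measurable_itv.
have mt : measurable (`]t, +oo[%classic : set R) by exact: measurable_itv.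
have E (y : R) : `]t, +oo[%classic y ->
    \int[mu]_(r in `]0, +oo[) (expR (- (s * y)) *
      (expR (ray_exp_re b x y r th) * sin (ray_exp_im b x y r th))) =
    expR (- (s * y)) * ray_density b x th y.
  rewrite /= in_itv/= andbT => ty.
  have y0 : 0 <= y by apply: ltW; exact: le_lt_trans ty.
  have m0' : measurable (`]0, +oo[%classic : set (measurableTypeR R)).
    exact: measurable_itv.
  exact: (RintegralZl _ m0' (integrable_ray_integrand b0 x0 y0 cth cbth)).
have m0' : measurable (`]0, +oo[%classic : set (measurableTypeR R)).
  exact: measurable_itv.
have sinth2 (r : R) : 0 < r -> 0 < s - r * cos th.
  by move=> r0; rewrite ltr_wpDr// oppr_ge0 mulr_ge0_le0// ltW.
have E2 (r : R) : `]0, +oo[%classic r ->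
    \int[mu]_(y in `]t, +oo[) (expR (- (s * y)) *
      (expR (ray_exp_re b x y r th) * sin (ray_exp_im b x y r th))) =
    expR (- (s * t)) * ray_im b x s t r th.
  rewrite /= in_itv/= andbT => r0.
  pose A0 := - (x * r `^ b * cos (b * th)).
  pose B0 := - (x * r `^ b * sin (b * th)) + th.
  pose u := s - r * cos th; pose v := r * sin th.
  have u0 : 0 < u by exact: sinth2.
  have mt' : measurable (`]t, +oo[%classic : set (measurableTypeR R)).
    exact: measurable_itv.
  transitivity (\int[mu]_(y in `]t, +oo[)
      (expR A0 * (expR (- (u * y)) * sin (v * y + B0)))).
    apply: eq_Rintegral_lebesgue => y _.
    rewrite !mulrA -!expRD; congr (expR _ * sin _).
      by rewrite /ray_exp_re /A0 /u; ring.
    by rewrite /ray_exp_im /B0 /v; ring.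
  have iy : (@mu R).-integrable `]t, +oo[
      (EFin \o (fun y : R => expR (- (u * y)) * sin (v * y + B0))).
    exact: integrable_expRN_sin.
  rewrite (RintegralZl _ mt' iy) Rintegral_expRN_sin//.
  rewrite /ray_im /ray_nsq -/u -/v.
  rewrite !mulrA -!expRD; congr (expR _ * _ / _).
    by rewrite /ray_exp_re /A0 /u; ring.
  have -> : ray_exp_im b x t r th = v * t + B0 by rewrite /ray_exp_im /B0 /v; ring.
  by rewrite /u /v; ring.
have [ih eh] := Rintegral_lebesgue_Fubini mt m0 (measurable_ray_integrand b x s th)
  (integrable_expRN s0 t0) (integrable_expRN_powR a0 b0) hb.
split; first exact: (eq_integrable_lebesgue mt E ih).
rewrite -(eq_Rintegral_lebesgue E) eh (eq_Rintegral_lebesgue E2) {eh ih E E2}.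
exact: (RintegralZl _ m0' (integrable_ray_im_left b0 b1 x0 s0 t0 cth cbth)).
Qed.

(** * Uniqueness of the Laplace transform on half-lines *)

(** With [v = e^(- m y)] and [N] close to [e^(m t)], [(1 - v)^N] behaves like
    [exp (- e^(m (t - y)))], which tends to 0 below [t] and to 1 above. Rounding the exponent keeps
    the kernel a polynomial in [v]. *)
Definition tail_kernel {R : realType} (t : R) (m : nat) (y : R) : R :=
  (1 - expR (- (m%:R * y))) ^+ (Num.truncn (expR (m%:R * t))).+1.

Lemma tail_kernel_ge0_le1 {R : realType} (t : R) (m : nat) (y : R) : 0 <= y ->
  0 <= tail_kernel t m y <= 1.
Proof.
move=> y0.
have e1 : expR (- (m%:R * y)) <= 1 by rewrite -expR0 ler_expR oppr_le0 mulr_ge0.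
rewrite /tail_kernel exprn_ge0 ?subr_ge0//=.
by rewrite exprn_ile1 ?subr_ge0// gerBl expR_ge0.
Qed.

Lemma cvg_expRN_nat {R : realType} (e : R) : 0 < e ->
  expR (- (e * m%:R)) @[m --> \oo] --> 0.
Proof. by move=> e0; exact: (cvg_comp _ _ (@cvgr_idn R) (cvg_expRN_pinfty e0)). Qed.

Lemma bernoulli_ge {R : realType} (v : R) (n : nat) : 0 <= v -> v <= 1 ->
  1 - n%:R * v <= (1 - v) ^+ n.
Proof.
move=> v0 v1; elim: n => [|n IHn]; first by rewrite mul0r subr0 expr0.
rewrite exprS (@le_trans _ _ ((1 - v) * (1 - n%:R * v)))//; last first.
  by rewrite ler_wpM2l// subr_ge0.
have : 0 <= n%:R * v * v by rewrite !mulr_ge0.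
rewrite -natr1; lra.
Qed.

Lemma cvg_tail_kernel {R : realType} (t y : R) : 0 < t -> 0 <= y -> y != t ->
  tail_kernel t m y @[m --> \oo] --> (\1_`]t, +oo[%classic y : R).
Proof.
move=> t0 y0; rewrite neq_lt => /orP[yt|ty].
  (* Below [t]: [(1 - v)^N <= e^(- N v)], where [N v >= e^(m (t - y)) >= m (t - y)]. *)
  rewrite indicE memNset/=; last by rewrite /= in_itv/= andbT ltNge (ltW yt).
  have ty0 : 0 < t - y by rewrite subr_gt0.
  apply: (squeeze_cvgr _ (cvg_cst 0) (cvg_expRN_nat ty0)).
  apply: nearW => m; have /andP[-> _]/= := tail_kernel_ge0_le1 t m y0.
  rewrite /tail_kernel; set N := _.+1.
  have N1 : expR (m%:R * t) <= N%:R by rewrite ltW// truncnS_gt.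
  have e1 : expR (- (m%:R * y)) <= 1 by rewrite -expR0 ler_expR oppr_le0 mulr_ge0.
  apply: (@le_trans _ _ (expR (- expR (- (m%:R * y))) ^+ N)).
    rewrite lerXn2r ?nnegrE ?expR_ge0 ?subr_ge0//.
    by have := expR_ge1Dx (- expR (- (m%:R * y))).
  rewrite -expRM_natl ler_expR mulrN lerN2.
  apply: (@le_trans _ _ (expR (m%:R * t) * expR (- (m%:R * y)))); last first.
    by rewrite ler_wpM2r ?expR_ge0.
  rewrite -expRD (le_trans _ (expR_ge1Dx _))//.
  rewrite (_ : (t - y) * m%:R = m%:R * t - m%:R * y); last by ring.
  lra.
(* Above [t], Bernoulli's inequality bounds the defect [1 - (1 - v)^N] by [N v], and
   [N <= e^(m t) + 1]. *)
rewrite indicE mem_set/= ?mulr1n; last by rewrite /= in_itv/= andbT.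
have y00 : 0 < y - t by rewrite subr_gt0.
have L : 1 - (expR (- ((y - t) * m%:R)) + expR (- (y * m%:R))) @[m --> \oo] -->
    (1 - (0 + 0) : R).
  apply: cvgB; first exact: cvg_cst.
  apply: cvgD; apply: cvg_expRN_nat => //; exact: lt_trans ty.
rewrite addr0 subr0 in L.
have C1 : (fun=> 1 : R) @ \oo --> (1 : R) by exact: cvg_cst.
apply: (squeeze_cvgr _ L C1); apply: nearW => m.
have /andP[_ ->] := tail_kernel_ge0_le1 t m y0; rewrite andbT.
have e1 : expR (- (m%:R * y)) <= 1 by rewrite -expR0 ler_expR oppr_le0 mulr_ge0.
rewrite /tail_kernel; set N := _.+1.
rewrite (le_trans _ (bernoulli_ge N (expR_ge0 _) e1))// lerD2l lerN2.
have N1 : N%:R <= expR (m%:R * t) + 1.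
  by rewrite /N -natr1 lerD2r truncn_le// expR_ge0.
rewrite (le_trans (ler_wpM2r (expR_ge0 _) N1))// mulrDl mul1r -expRD lerD// ler_expR.
  by rewrite le_eqVlt; apply/orP; left; apply/eqP; ring.
by rewrite mulrC.
Qed.

(** The prefactor with rate [a] makes the induction on [N] close: splitting off one factor shifts
    [a] by [m], and no binomial expansion is needed. *)
Definition exp_poly {R : realType} (m N a : nat) (y : R) : R :=
  expR (- (a%:R * y)) * (1 - expR (- (m%:R * y))) ^+ N.

Lemma exp_polyS {R : realType} (m N a : nat) (y : R) :
  exp_poly m N.+1 a y = exp_poly m N a y - exp_poly m N (a + m) y.
Proof.
have e : expR (- ((a + m)%:R * y)) = expR (- (a%:R * y)) * expR (- (m%:R * y)).
  by rewrite -expRD natrD; congr expR; ring.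
by rewrite /exp_poly exprS e; ring.
Qed.

Lemma laplace_exp_poly d (T : measurableType d) {R : realType}
    (P : {measure set T -> \bar R}) (X : T -> R) (g : R -> R) (m : nat) :
  (forall n : nat, P.-integrable setT (EFin \o (fun w => expR (- (n%:R * X w))))) ->
  (forall n : nat, (@mu R).-integrable `]0, +oo[
    (EFin \o (fun y => expR (- (n%:R * y)) * g y))) ->
  (forall n : nat, \int[P]_w expR (- (n%:R * X w)) =
    \int[mu]_(y in `]0, +oo[) (expR (- (n%:R * y)) * g y)) ->
  forall N a, [/\ P.-integrable setT (EFin \o (fun w => exp_poly m N a (X w))),
    (@mu R).-integrable `]0, +oo[ (EFin \o (fun y => exp_poly m N a y * g y)) &
    \int[P]_w exp_poly m N a (X w) =
    \int[mu]_(y in `]0, +oo[) (exp_poly m N a y * g y)].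
Proof.
move=> iP ig E; elim=> [|N IHN] a.
  have e : exp_poly m 0 a = (fun y : R => expR (- (a%:R * y))).
    by apply/funext => y; rewrite /exp_poly expr0 mulr1.
  by rewrite e.
have [i1 j1 e1] := IHN a; have [i2 j2 e2] := IHN (a + m)%N.
have e : exp_poly m N.+1 a = (fun y : R => exp_poly m N a y - exp_poly m N (a + m) y).
  by apply/funext => y; exact: exp_polyS.
have eg : (fun y : R => exp_poly m N.+1 a y * g y) =
    (fun y : R => exp_poly m N a y * g y - exp_poly m N (a + m) y * g y).
  by apply/funext => y; rewrite exp_polyS mulrBl.
have m0 : measurable (`]0, +oo[%classic : set (measurableTypeR R)).
  exact: measurable_itv.
rewrite eg {}e; split.
- exact: (integrableB measurableT i1 i2).
- exact: (integrableB m0 j1 j2).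
- by rewrite (RintegralB measurableT i1 i2) e1 e2 -(RintegralB m0 j1 j2).
Qed.

(* Since [g] may change sign, approximate the indicator of [(t, oo)] by [tail_kernel t m],
   a polynomial in [e^(-m y)] converging to it pointwise off [t] (Gumbel-type limit). *)
Lemma laplace_tail d (T : measurableType d) {R : realType} (P : probability T R)
    (X : T -> R) (g : R -> R) (t : R) :
  measurable_fun setT X -> {ae P, forall w, 0 <= X w} ->
  (@mu R).-integrable `]0, +oo[ (EFin \o g) ->
  (forall n : nat, P.-integrable setT (EFin \o (fun w => expR (- (n%:R * X w))))) ->
  (forall n : nat, \int[P]_w expR (- (n%:R * X w)) =
    \int[mu]_(y in `]0, +oo[) (expR (- (n%:R * y)) * g y)) ->
  0 < t ->
  fine (P [set w | t < X w]) <= \int[mu]_(y in `]t, +oo[) g y <=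
  fine (P [set w | t < X w]) + fine (P [set w | X w = t]).
Proof.
move=> mX X0 ig iP E t0.
have m0 : measurable (`]0, +oo[%classic : set (measurableTypeR R)).
  exact: measurable_itv.
have mg : measurable_fun (`]0, +oo[%classic : set R) g.
  by apply/measurable_EFinP; exact: measurable_int ig.
have mexp (n : nat) : measurable_fun setT (fun y : R => expR (- (n%:R * y))).
  by apply: measurableT_comp => //; apply: measurableT_comp => //; exact: measurable_funM.
have mk (m : nat) : measurable_fun setT (tail_kernel t m).
  by apply: measurable_funX; apply: measurable_funB => //; exact: mexp.
have ign (n : nat) : (@mu R).-integrable `]0, +oo[
    (EFin \o (fun y => expR (- (n%:R * y)) * g y)).
  apply: (@le_integrable _ _ R (@mu R) _ m0 _ (EFin \o g)) => //.
    apply/measurable_EFinP; apply: measurable_funM => //.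
    by apply: measurable_funTS; exact: mexp.
  move=> y /=; rewrite in_itv/= andbT => y0.
  rewrite lee_fin normrM ger0_norm ?expR_ge0// ler_piMl//.
  by rewrite -expR0 ler_expR oppr_le0 mulr_ge0// ltW.
have kE (m : nat) : tail_kernel t m = exp_poly m (Num.truncn (expR (m%:R * t))).+1 0.
  by apply/funext => y; rewrite /exp_poly mul0r oppr0 expR0 mul1r.
have SE (m : nat) : P.-integrable setT (EFin \o (fun w => tail_kernel t m (X w))) /\
    \int[P]_w tail_kernel t m (X w) =
    \int[mu]_(y in `]0, +oo[) (tail_kernel t m y * g y).
  by rewrite kE; have [] := laplace_exp_poly m iP ign E (Num.truncn (expR (m%:R * t))).+1 0.
have limS : \int[mu]_(y in `]0, +oo[) (tail_kernel t m y * g y) @[m --> \oo] -->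
    \int[mu]_(y in `]t, +oo[) g y.
  have -> : \int[mu]_(y in `]t, +oo[) g y =
      \int[mu]_(y in `]0, +oo[) (\1_`]t, +oo[%classic y * g y).
    transitivity (\int[@mu R]_(y in `]0, +oo[) (g \_ `]t, +oo[%classic) y).
      rewrite -Rintegral_mkcondr setIidr// => y /=.
      by rewrite !in_itv/= !andbT; exact: lt_trans.
    apply: eq_Rintegral_lebesgue => y y0.
    by rewrite patchE indicE; case: ifPn => h; rewrite ?mul1r ?mul0r.
  apply: (@cvg_Rintegral_dominated_ae _ _ R (@mu R) _ _ _ (fun y => `|g y|)) => //.
  - move=> m; apply: measurable_funM => //.
    exact: measurable_funTS (mk m).
  - apply: measurable_funM => //; exact: measurable_indic.
  - exists [set t]; split; [exact: measurable_set1|exact: lebesgue_measure_set1|].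
    move=> y /= /not_implyP[]; rewrite in_itv/= andbT => y0 nc.
    apply: contrapT => /eqP yt; apply: nc; apply: cvgM; last exact: cvg_cst.
    by apply: cvg_tail_kernel => //; exact: ltW.
  - by move/integrable_norm : ig.
  - apply: aeW => y /=; rewrite in_itv/= andbT => y0 m.
    have /andP[k0 k1] := tail_kernel_ge0_le1 t m (ltW y0).
    by rewrite normrM ger0_norm// ler_piMl.
(* On [X = t] the kernels do not tend to the indicator. This possible atom is split off and bounded
   by its probability, whence the two-sided estimate. *)
pose A : set T := [set w | X w <> t].
pose B : set T := [set w | X w = t].
have mB : measurable B.
  by rewrite -[B]setTI; exact: (mX measurableT _ (measurable_set1 t)).
have mA : measurable A by rewrite (_ : A = ~` B)//; exact: measurableC.
have limA : \int[P]_(w in A) tail_kernel t m (X w) @[m --> \oo] -->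
    fine (P [set w | t < X w]).
  have mI : measurable [set w | t < X w].
    have := mX measurableT _ (measurable_itv `]t, +oo[).
    rewrite setTI; congr measurable; apply/seteqP; split => w /=.
      by rewrite in_itv/= andbT.
    by rewrite in_itv/= andbT.
  have -> : fine (P [set w | t < X w]) =
      \int[P]_(w in A) (\1_`]t, +oo[%classic (X w) : R).
    rewrite /Rintegral; congr fine.
    transitivity (\int[P]_(w in A) (\1_[set w | t < X w] w)%:E)%E.
      rewrite integral_indic//; congr (P _).
      by rewrite setIidl// => w /= h e; move: h; rewrite e ltxx.
    apply: eq_integral => w _; rewrite !indicE; congr ((_ : nat)%:R)%:E.
    have [h|h] := ltP t (X w); first by rewrite !mem_set//= in_itv/= h.
    by rewrite !memNset//= ?in_itv/= ?andbT; apply/negP; rewrite -leNgt.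
  apply: (@cvg_Rintegral_dominated_ae _ _ R P _ _ _ (fun=> 1)) => //.
  - by move=> m; apply: measurable_funTS; exact: measurableT_comp.
  - apply: measurable_funTS; apply: measurableT_comp => //; exact: measurable_indic.
  - apply: filterS X0 => w X0 wA; apply: cvg_tail_kernel => //; exact/eqP.
  - by apply: finite_measure_integrable_cst.
  - apply: filterS X0 => w X0 wA m.
    by have /andP[k0 k1] := tail_kernel_ge0_le1 t m X0; rewrite ger0_norm.
have AB : A `|` B = setT.
  by apply/seteqP; split=> // w _; case: (pselect (X w = t)); [right|left].
have split (m : nat) : \int[P]_w tail_kernel t m (X w) =
    \int[P]_(w in A) tail_kernel t m (X w) + \int[P]_(w in B) tail_kernel t m (X w).
  rewrite -Rintegral_setU//; rewrite ?AB//; first exact: (SE m).1.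
  by apply/disj_set2P; apply/seteqP; split=> // w [].
have Bm (m : nat) : 0 <= \int[P]_(w in B) tail_kernel t m (X w) <= fine (P B).
  have /andP[k0 k1] := tail_kernel_ge0_le1 t m (ltW t0).
  have -> : \int[P]_(w in B) tail_kernel t m (X w) = tail_kernel t m t * fine (P B).
    rewrite -(Rintegral_cst P mB); apply: eq_Rintegral => w /set_mem; rewrite /B/= => ->//.
  by rewrite mulr_ge0 ?fine_ge0//= ler_piMl// fine_ge0.
have SA (m : nat) : \int[P]_(w in A) tail_kernel t m (X w) <=
    \int[mu]_(y in `]0, +oo[) (tail_kernel t m y * g y) <=
    \int[P]_(w in A) tail_kernel t m (X w) + fine (P B).
  by rewrite -(SE m).2 split; have /andP[] := Bm m; lra.
apply/andP; split.
- apply: (ler_cvg_to limA limS); apply: nearW => m.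
  by have /andP[] := SA m.
- have limA' : \int[P]_(w in A) tail_kernel t m (X w) + fine (P B) @[m --> \oo] -->
      fine (P [set w | t < X w]) + fine (P B).
    by apply: cvgD limA _; exact: cvg_cst.
  apply: (ler_cvg_to limS limA'); apply: nearW => m.
  by have /andP[] := SA m.
Qed.

(** * The tail as a real integral *)

Lemma cos_lt0_left {R : realType} (th : R) : pi / 2 < th -> th < pi + pi / 2 -> cos th < 0.
Proof.
move=> h1 h2; rewrite -(subrK pi th) cosDpi oppr_lt0.
by rewrite cos_gt0_pihalf//; apply/andP; split; lra.
Qed.

Lemma ray_im_pi {R : realType} (b x s t r : R) : 0 < s -> 0 < r ->
  ray_im b x s t r pi = expR (- (t * r)) / (s + r) *
    (expR (- (x * r `^ b * cos (b * pi))) * sin (x * r `^ b * sin (b * pi))).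
Proof.
move=> s0 r0; rewrite /ray_im /ray_nsq /ray_exp_re /ray_exp_im cospi sinpi.
rewrite !mulr0 add0r sinDpi sinN opprK mulrN1 expRD.
rewrite addr0 expr0n/= addr0 mulrN1 opprK; field.
by rewrite gt_eqF// addr_gt0.
Qed.

(** For [t > 0] the decay comes from [exp (t r cos th)]: [cos] has a negative maximum on the compact
    range of angles, and [cos (b th)] enters only through its lower bound [-1]. *)
Lemma ray_rotation_to_pi {R : realType} (b x s t th : R) :
  0 < b -> b < 1 -> 0 < x -> 0 < s -> 0 < t -> pi / 2 < th -> th < pi ->
  (@mu R).-integrable `]0, +oo[ (EFin \o (fun r => ray_im b x s t r pi)) /\
  \int[mu]_(r in `]0, +oo[) ray_im b x s t r th =
  \int[mu]_(r in `]0, +oo[) ray_im b x s t r pi.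
Proof.
move=> b0 b1 x0 s0 t0 th1 th2.
have pi0 := @pi_gt0 R.
(* [th] and [pi] must both be interior to the range, hence a lower end strictly between [pi / 2] and
   [th] and an upper end beyond [pi]. *)
pose a : R := (pi / 2 + th) / 2.
pose c : R := pi + pi / 4.
have ac : a <= c by rewrite /a /c; lra.
have cf : {within `[a, c], continuous (@cos R)}.
  by apply: derivable_within_continuous => z _; exact: derivable_cos.
have [z] := EVT_max ac cf; rewrite in_itv/= => /andP[az zc] hmax.
have cz : cos z < 0 by apply: cos_lt0_left; move: az zc; rewrite /a /c; lra.
have tz0 : 0 < t * - cos z by rewrite mulr_gt0// oppr_gt0.
have [M M0 HM] := @expR_affine_powR_le R _ x b 5 tz0 x0 b0 b1.
have s20 : 0 < s ^+ 2 by rewrite exprn_gt0.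
have bounded y : a < y < c -> ray_bounded b x s t M (s ^+ 2) y.
  move=> /andP[ay yc] r r0.
  have cyz : cos y <= cos z by apply: hmax; rewrite in_itv/= !ltW.
  have cy0 : cos y <= 0 by rewrite (le_trans cyz)// ltW.
  split.
    rewrite /ray_nsq (@le_trans _ _ ((s - r * cos y) ^+ 2)) ?lerDl ?sqr_ge0//.
    have h : r * cos y <= 0 by rewrite mulr_ge0_le0// ltW.
    by rewrite lerXn2r ?nnegrE ?(ltW s0)//; lra.
  rewrite (le_trans _ (HM _ r0))// ler_expR /ray_exp_re lerD//.
    rewrite mulrN mulNr opprK mulrAC ler_wpM2r ?(ltW r0)//.
    by rewrite ler_wpM2l// ltW.
  have := norm_cos_le1 (b * y); rewrite ler_norml => /andP[h _].
  have q0 : 0 <= x * r `^ b by rewrite mulr_ge0 ?powR_ge0// ltW.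
  by have := ler_wpM2l q0 h; rewrite mulrN1; lra.
split.
  apply: (integrable_ray_im b0 b1 x0 s0 (ltW t0) M0 s20); apply: bounded.
  by rewrite /a /c; lra.
apply: (ray_rotation b0 b1 x0 s0 (ltW t0) M0 s20 bounded).
- by rewrite /a; lra.
- exact: ltW.
- by rewrite /c; lra.
Qed.

Definition tempered_tail {R : realType} (b l x t : R) : R :=
  expR (l `^ b * x) / pi * \int[mu]_(r in `]0, +oo[)
    (expR (- (t * (l + r))) / (l + r) *
      (expR (- (x * r `^ b * cos (b * pi))) * sin (x * r `^ b * sin (b * pi)))).

Lemma tempered_tail_bounds d (T : measurableType d) {R : realType}
    (P : probability T R) (X : {RV P >-> R}) (b l x t : R) :
  0 < b -> b < 1 -> 0 < l -> 0 < x -> 0 < t ->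
  {ae P, forall w, 0 <= X w} ->
  (forall s, 0 < s -> ('E_P[fun w => expR (- s * X w)])%E =
    (expR (- x * ((s + l) `^ b - l `^ b)))%:E) ->
  fine (P [set w | t < X w]) <= tempered_tail b l x t <=
  fine (P [set w | t < X w]) + fine (P [set w | X w = t]).
Proof.
move=> b0 b1 l0 x0 t0 X0 EX.
have pi0 := @pi_gt0 R.
(* Small enough for [b th < pi / 2] at [th = pi / 2 + del], which is possible because [b < 1]; the
   bound [pi / 4] keeps [th] below [pi]. *)
pose del : R := Num.min (pi / 4) ((pi / 2 - b * (pi / 2)) / 2).
have bp : b * (pi / 2) < pi / 2 by rewrite gtr_pMl// divr_gt0.
have del0 : 0 < del by rewrite lt_min; apply/andP; split; lra.
have d1 : del <= pi / 4 by rewrite ge_min lexx.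
have d2 : del <= (pi / 2 - b * (pi / 2)) / 2 by rewrite ge_min lexx orbT.
pose th := pi / 2 + del.
have th1 : pi / 2 < th by rewrite ltrDl.
have th2 : th < pi by rewrite /th; lra.
have bth : b * th < pi / 2.
  have : b * del <= del by rewrite ler_piMl ?ltW.
  by rewrite /th mulrDr; lra.
have th0 : 0 < th by rewrite addr_gt0// divr_gt0.
have cth : cos th <= 0 by apply: ltW; apply: cos_lt0_left; lra.
have cbth : 0 < cos (b * th).
  rewrite cos_gt0_pihalf// bth andbT.
  have : 0 < b * th by rewrite mulr_gt0.
  lra.
pose K := expR (l `^ b * x) / pi.
(* The factor [e^(- l y)] shifts the transform from [s] to [s + l]; [K] combines the normalization
   [exp (x l^b)] with the [1 / pi] of Cauchy's formula. *)
pose g (y : R) := K * (expR (- (l * y)) * ray_density b x th y).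
have m0 : measurable (`]0, +oo[%classic : set (measurableTypeR R)).
  exact: measurable_itv.
have [ig eg] := ray_density_laplace b0 b1 x0 l0 (ltW t0) cth cbth.
have [ig0 eg0] := ray_density_laplace b0 b1 x0 l0 (lexx 0) cth cbth.
have mt : measurable (`]t, +oo[%classic : set (measurableTypeR R)).
  exact: measurable_itv.
have igK : (@mu R).-integrable `]0, +oo[ (EFin \o g) by exact: (integrableZl m0 K ig0).
have Gt : \int[mu]_(y in `]t, +oo[) g y = tempered_tail b l x t.
  have [ipi epi] := ray_rotation_to_pi b0 b1 x0 l0 t0 th1 th2.
  rewrite (RintegralZl K mt ig) eg epi.
  rewrite /tempered_tail -/K -(RintegralZl _ m0 ipi); congr (K * _).
  apply: eq_Rintegral_lebesgue => r; rewrite /= in_itv/= andbT => r0.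
  by rewrite ray_im_pi// !mulrA -expRD; congr (expR _ / _ * _ * _); ring.
rewrite -Gt.
have mE (s : R) : measurable_fun setT (fun w => expR (- (s * X w))).
  apply: measurableT_comp => //; apply: measurableT_comp => //.
  exact: measurable_funM.
have iP (n : nat) : P.-integrable setT (EFin \o (fun w => expR (- (n%:R * X w)))).
  case: n => [|n].
    rewrite (_ : _ \o _ = cst 1%E); last first.
      by apply/funext => w; rewrite /= mul0r oppr0 expR0.
    exact: finite_measure_integrable_cst.
  apply/integrableP; split; first exact/measurable_EFinP.
  have := EX n.+1%:R (ltr0Sn _ _); rewrite unlock.
  rewrite (_ : (\int[P]_x _)%E = (\int[P]_x `|(EFin \o (fun w => expR (- (n.+1%:R * X w)))) x|)%E).
    by move=> ->; rewrite ltry.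
  by apply: eq_integral => w _; rewrite /= ger0_norm ?expR_ge0// mulNr.
have gn (n : nat) : \int[mu]_(y in `]0, +oo[) (expR (- (n%:R * y)) * g y) =
    expR (- x * ((n%:R + l) `^ b - l `^ b)).
  have ln0 : 0 < n%:R + l by rewrite ltr_wpDl.
  have [ign egn] := ray_density_laplace b0 b1 x0 ln0 (lexx 0) cth cbth.
  transitivity (\int[mu]_(y in `]0, +oo[)
      (K * (expR (- ((n%:R + l) * y)) * ray_density b x th y))).
    apply: eq_Rintegral_lebesgue => y _.
    by rewrite mulrDl opprD expRD /g; ring.
  rewrite (RintegralZl K m0 ign) egn mulr0 oppr0 expR0 mul1r.
  rewrite (ray_cauchy b0 b1 x0 ln0 th0 th2 bth) mulrA /K divfK ?gt_eqF//.
  by rewrite -expRD; congr expR; ring.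
apply: (laplace_tail _ X0 igK iP) => // n.
rewrite gn; case: n => [|n].
  (* The assumed transform is available for [s > 0] only. At [n = 0] both sides are 1: one is the
     mass of [P], the other is [gn], that is, Cauchy's formula at [s = l]. *)
  rewrite add0r subrr mulr0 expR0.
  transitivity (\int[P]_(w in setT) (1 : R)).
    by apply: eq_Rintegral => w _; rewrite mul0r oppr0 expR0.
  rewrite (Rintegral_cst P measurableT) mul1r.
  exact: (congr1 fine (probability_setT P)).
have := EX n.+1%:R (ltr0Sn _ _); rewrite unlock => h.
rewrite -[RHS]/(fine _%:E) -h; congr fine; apply: eq_integral => w _.
by rewrite mulNr.
Qed.

(** * The power series of the tail *)

(** Together with [expcos_coef], the Taylor coefficients of the imaginary and real parts of
    [exp (x e^(i phi))]. *)
Definition expsin_coef {R : realType} (phi : R) (k : nat) : R := sin (k%:R * phi) / k`!%:R.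
Definition expcos_coef {R : realType} (phi : R) (k : nat) : R := cos (k%:R * phi) / k`!%:R.

Lemma is_cvg_pseries_le_fact {R : realType} (c : nat -> R) (x : R) :
  (forall k, `|c k| <= k`!%:R^-1) -> cvgn (pseries c x).
Proof.
move=> ck; apply: normed_cvg.
apply: (series_le_cvg _ _ _ (@is_cvg_series_exp_coeff R `|x|)) => k.
- exact: normr_ge0.
- by rewrite /exp_coeff/= divr_ge0// exprn_ge0.
- by rewrite /exp_coeff/= normrM normrX mulrC ler_wpM2l// exprn_ge0.
Qed.

Lemma norm_expsin_coef_le {R : realType} (phi : R) k : `|expsin_coef phi k| <= k`!%:R^-1.
Proof.
by rewrite normrM (@ger0_norm _ (_^-1)) ?invr_ge0// ler_piMl ?invr_ge0// norm_sin_le1.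
Qed.

Lemma norm_expcos_coef_le {R : realType} (phi : R) k : `|expcos_coef phi k| <= k`!%:R^-1.
Proof.
by rewrite normrM (@ger0_norm _ (_^-1)) ?invr_ge0// ler_piMl ?invr_ge0// norm_cos_le1.
Qed.

Lemma pseries_diffs_expsin {R : realType} (phi : R) :
  pseries_diffs (expsin_coef phi) =
  (fun k => cos phi * expsin_coef phi k + sin phi * expcos_coef phi k).
Proof.
apply/funext => k; rewrite /pseries_diffs /expsin_coef /expcos_coef.
have -> : k.+1%:R * phi = k%:R * phi + phi by rewrite -natr1; ring.
rewrite sinD factS natrM; field.
by rewrite nat1r !pnatr_eq0 -lt0n fact_gt0.
Qed.

Lemma pseries_diffs_expcos {R : realType} (phi : R) :
  pseries_diffs (expcos_coef phi) =
  (fun k => cos phi * expcos_coef phi k - sin phi * expsin_coef phi k).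
Proof.
apply/funext => k; rewrite /pseries_diffs /expsin_coef /expcos_coef.
have -> : k.+1%:R * phi = k%:R * phi + phi by rewrite -natr1; ring.
rewrite cosD factS natrM; field.
by rewrite nat1r !pnatr_eq0 -lt0n fact_gt0.
Qed.

Lemma cvg_pseries_comb {R : realType} (p q x : R) (c e : nat -> R) :
  cvgn (pseries c x) -> cvgn (pseries e x) ->
  pseries (fun k => p * c k + q * e k) x @ \oo -->
    p * limn (pseries c x) + q * limn (pseries e x).
Proof.
move=> cc ce.
rewrite (_ : pseries _ x = (fun n => p * pseries c x n + q * pseries e x n)).
  by apply: cvgD; apply: cvgM => //; exact: cvg_cst.
apply/funext => n; rewrite /pseries /series/= !mulr_sumr -big_split/=.
by apply: eq_bigr => k _; ring.
Qed.

(** Differentiating [exp (x e^(i phi))] multiplies it by [e^(i phi)]; on coefficients this is the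
    addition formula for [sin] and [cos]. *)
Lemma is_derive_pseries_expsin {R : realType} (phi x : R) :
  is_derive x 1 (fun x => limn (pseries (expsin_coef phi) x))
    (cos phi * limn (pseries (expsin_coef phi) x) +
     sin phi * limn (pseries (expcos_coef phi) x)) /\
  is_derive x 1 (fun x => limn (pseries (expcos_coef phi) x))
    (cos phi * limn (pseries (expcos_coef phi) x) -
     sin phi * limn (pseries (expsin_coef phi) x)).
Proof.
have cS (y : R) := @is_cvg_pseries_le_fact _ _ y (norm_expsin_coef_le phi).
have cC (y : R) := @is_cvg_pseries_le_fact _ _ y (norm_expcos_coef_le phi).
have cS' (y : R) : cvgn (pseries (pseries_diffs (expsin_coef phi)) y).
  rewrite pseries_diffs_expsin;
  exact: (cvgP _ (@cvg_pseries_comb _ (cos phi) (sin phi) _ _ _ (cS y) (cC y))).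
have diffsN : pseries_diffs (expcos_coef phi) =
    (fun k => cos phi * expcos_coef phi k + (- sin phi) * expsin_coef phi k).
  by rewrite pseries_diffs_expcos; apply/funext => k; rewrite mulNr.
have cC' (y : R) : cvgn (pseries (pseries_diffs (expcos_coef phi)) y).
  rewrite diffsN;
  exact: (cvgP _ (@cvg_pseries_comb _ (cos phi) (- sin phi) _ _ _ (cC y) (cS y))).
have diffs_comb (p q : R) (c e : nat -> R) :
    pseries_diffs (fun k => p * c k + q * e k) =
    (fun k => p * pseries_diffs c k + q * pseries_diffs e k).
  by apply/funext => k; rewrite /pseries_diffs; ring.
have cS'' (y : R) : cvgn (pseries (pseries_diffs (pseries_diffs (expsin_coef phi))) y).
  rewrite [X in pseries_diffs X]pseries_diffs_expsin diffs_comb;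
  exact: (cvgP _ (@cvg_pseries_comb _ (cos phi) (sin phi) _ _ _ (cS' y) (cC' y))).
have cC'' (y : R) : cvgn (pseries (pseries_diffs (pseries_diffs (expcos_coef phi))) y).
  rewrite [X in pseries_diffs X]diffsN diffs_comb;
  exact: (cvgP _ (@cvg_pseries_comb _ (cos phi) (- sin phi) _ _ _ (cC' y) (cS' y))).
have xK : `|x| < `|(`|x| + 1)%R|.
  by rewrite (@ger0_norm _ (_ + 1)) ?addr_ge0// ltrDl.
split.
- have := pseries_snd_diffs (cS _) (cS' _) (cS'' _) xK.
  by rewrite pseries_diffs_expsin (cvg_lim _ (@cvg_pseries_comb _ _ _ _ _ _ (cS x) (cC x))).
- have := pseries_snd_diffs (cC _) (cC' _) (cC'' _) xK.
  by rewrite diffsN (cvg_lim _ (@cvg_pseries_comb _ _ _ _ _ _ (cC x) (cS x)))// mulNr.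
Qed.

Lemma lim_pseries0 {R : realType} (c : nat -> R) : limn (pseries c 0) = c 0%N.
Proof.
apply/cvg_lim => //; rewrite -(cvg_shiftS (pseries c 0)).
apply: cvg_near_cst; apply: nearW => n /=.
rewrite /pseries /series/= big_nat_recl// expr0 mulr1 big1 ?addr0// => i _.
by rewrite expr0n mulr0.
Qed.

(* With [S], [C] the sine and cosine series, [(C + i S) exp (- x e^(i phi))] has derivative
   zero; its real and imaginary parts are [V] and [U] below. *)
Lemma lim_pseries_expsin {R : realType} (phi x : R) :
  limn (pseries (expsin_coef phi) x) = expR (x * cos phi) * sin (x * sin phi).
Proof.
pose S (y : R) := limn (pseries (expsin_coef phi) y).
pose C (y : R) := limn (pseries (expcos_coef phi) y).
have dS (y : R) : is_derive y 1 S (cos phi * S y + sin phi * C y).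
  by have [] := is_derive_pseries_expsin phi y.
have dC (y : R) : is_derive y 1 C (cos phi * C y - sin phi * S y).
  by have [] := is_derive_pseries_expsin phi y.
have S0 : S 0 = 0 by rewrite /S lim_pseries0 /expsin_coef mul0r sin0 mul0r.
have C0 : C 0 = 1 by rewrite /C lim_pseries0 /expcos_coef mul0r cos0 fact0 divr1.
have dlin (c y : R) : is_derive y 1 (fun y : R => y * c) c.
  by apply: (is_derive_eq (is_deriveM (is_derive_id _ _) (is_derive_cst c _ _)));
    rewrite /GRing.scale/= mulr1 mulr0 add0r.
have de (y : R) : is_derive y 1 (fun y : R => expR (y * (- cos phi)))
    (- cos phi * expR (y * (- cos phi))).
  apply: (is_derive_eq (is_derive1_comp (is_derive_expR _) (dlin (- cos phi) y))).
  by rewrite mulrC.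
have ds (y : R) : is_derive y 1 (fun y : R => sin (y * sin phi))
    (sin phi * cos (y * sin phi)).
  apply: (is_derive_eq (is_derive1_comp (is_derive_sin _) (dlin (sin phi) y))).
  by rewrite mulrC.
have dc (y : R) : is_derive y 1 (fun y : R => cos (y * sin phi))
    (- sin phi * sin (y * sin phi)).
  apply: (is_derive_eq (is_derive1_comp (is_derive_cos _) (dlin (sin phi) y))).
  by rewrite mulrC mulNr mulrN.
pose U (y : R) := expR (y * (- cos phi)) *
  (S y * cos (y * sin phi) - C y * sin (y * sin phi)).
pose V (y : R) := expR (y * (- cos phi)) *
  (S y * sin (y * sin phi) + C y * cos (y * sin phi)).
have dU (y : R) : is_derive y 1 U 0.
  apply: (is_derive_eq (is_deriveM (de y)
    (is_deriveB (is_deriveM (dS y) (dc y)) (is_deriveM (dC y) (ds y))))).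
  rewrite ?fctE /GRing.scale/=; ring.
have dV (y : R) : is_derive y 1 V 0.
  apply: (is_derive_eq (is_deriveM (de y)
    (is_deriveD (is_deriveM (dS y) (ds y)) (is_deriveM (dC y) (dc y))))).
  rewrite ?fctE /GRing.scale/=; ring.
have Ux : U x = 0.
  by rewrite (is_derive_0_is_cst x 0 dU) /U S0 C0 !mul0r sin0 mulr0 subr0 mulr0.
have Vx : V x = 1.
  by rewrite (is_derive_0_is_cst x 0 dV) /V S0 C0 !mul0r cos0 expR0 !mul1r add0r.
have e1 : expR (x * cos phi) * expR (x * (- cos phi)) = 1.
  by rewrite -expRD -mulrDr subrr mulr0 expR0.
have cs := cos2Dsin2 (x * sin phi).
rewrite -/(S x); set c := cos (x * sin phi) in cs *; set s := sin (x * sin phi) in cs *.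
have -> : S x = expR (x * cos phi) * expR (x * (- cos phi)) * (c ^+ 2 + s ^+ 2) * S x.
  by rewrite e1 cs !mul1r.
(* The combination [c U + s V] eliminates [C] and undoes the rotation. *)
transitivity (expR (x * cos phi) * (c * U x + s * V x)).
  by rewrite /U /V -/c -/s; ring.
by rewrite Ux Vx mulr0 add0r mulr1.
Qed.

Lemma series_exp_coeff_le {R : realType} (x : R) n : 0 <= x ->
  series (exp_coeff x) n <= expR x.
Proof.
move=> x0; apply: nondecreasing_cvgn_le; last exact: is_cvg_series_exp_coeff.
apply/nondecreasing_seqP => k; rewrite seriesSr lerDl.
by rewrite /exp_coeff/= divr_ge0// exprn_ge0.
Qed.

Lemma exprn_le_fact_expR {R : realType} (x : R) k : 0 <= x -> x ^+ k <= k`!%:R * expR x.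
Proof.
move=> x0; rewrite -ler_pdivrMl ?ltr0n ?fact_gt0// mulrC.
apply: le_trans (series_exp_coeff_le k.+1 x0); rewrite seriesSr lerDr.
by apply: sumr_ge0 => i _; rewrite /exp_coeff/= divr_ge0// exprn_ge0.
Qed.

Lemma norm_pseries_le_expR {R : realType} (c : nat -> R) (x : R) n :
  (forall k, `|c k| <= k`!%:R^-1) -> `|pseries c x n| <= expR `|x|.
Proof.
move=> ck; apply: le_trans (series_exp_coeff_le n (normr_ge0 x)).
rewrite (le_trans (ler_norm_sum _ _ _))//; apply: ler_sum => k _.
by rewrite /exp_coeff/= normrM normrX mulrC ler_wpM2l// exprn_ge0.
Qed.

Definition tail_weight {R : realType} (l t r : R) : R := expR (- (t * (l + r))) / (l + r).

Lemma tail_weight_ge0 {R : realType} (l t r : R) : 0 < l -> 0 < r -> 0 <= tail_weight l t r.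
Proof. by move=> l0 r0; rewrite divr_ge0 ?expR_ge0// addr_ge0// ltW. Qed.

Lemma measurable_tail_weight {R : realType} (l t : R) : 0 < l ->
  measurable_fun (`]0, +oo[ : set R) (tail_weight l t).
Proof.
move=> l0; apply: measurable_funM.
  apply: measurableT_comp => //; apply: measurableT_comp => //.
  by apply: measurable_funM => //; exact: measurable_funD.
apply: derivable_measurable_pos => r r0.
by apply: derivableV => //; rewrite gt_eqF// addr_gt0.
Qed.

(** For [b < 1] the weight, of order [exp (- t r)], absorbs [exp (x r^b)] however large [x] is; this
    is why the power series of the tail converges everywhere. *)
Lemma integrable_tail_weight {R : realType} (b l x t : R) (f : R -> R) (K : R) :
  0 < b -> b < 1 -> 0 < l -> 0 < x -> 0 < t ->
  measurable_fun (`]0, +oo[ : set R) f ->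
  (forall r, 0 < r -> `|f r| <= K * expR (x * r `^ b)) ->
  (@mu R).-integrable `]0, +oo[ (EFin \o (fun r : R => tail_weight l t r * f r)).
Proof.
move=> b0 b1 l0 x0 t0 mf fK.
have [M M0 HM] := @expR_affine_powR_le R t x b 1 t0 x0 b0 b1.
have K0 : 0 <= K.
  by rewrite -(pmulr_lge0 _ (expR_gt0 (x * 1 `^ b))) (le_trans _ (fK 1 ltr01)).
apply: (@integrable_le_oneDsqrV _ _ (l^-1 * K * M)).
  by apply: measurable_funM => //; exact: measurable_tail_weight.
move=> r r0; rewrite normrM ger0_norm ?tail_weight_ge0//.
have r1 : (M / (1 + r) ^+ 2) <= M / (1 + r ^+ 2).
  rewrite ler_wpM2l ?(ltW M0)// lef_pV2 ?posrE ?exprn_gt0 ?addr_gt0 ?exprn_gt0//.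
  by rewrite sqrrD expr1n mul1r lerD2r lerDl mulrn_wge0// ltW.
have w1 : tail_weight l t r <= l^-1 * expR (- (t * r)).
  rewrite /tail_weight mulrC ler_pM ?invr_ge0 ?expR_ge0 ?addr_ge0 ?(ltW l0) ?(ltW r0)//.
    by rewrite lef_pV2 ?posrE ?addr_gt0// lerDl ltW.
  by rewrite ler_expR lerN2 ler_wpM2l ?(ltW t0)// lerDr ltW.
apply: (le_trans (ler_pM (tail_weight_ge0 _ l0 r0) (normr_ge0 _) w1 (fK r r0))).
rewrite mulrACA -expRD -!mulrA !ler_wpM2l ?invr_ge0 ?(ltW l0)//.
by rewrite (le_trans (HM r r0)).
Qed.

Definition tail_moment {R : realType} (b l t : R) (k : nat) : R :=
  \int[mu]_(r in `]0, +oo[) (tail_weight l t r * (r `^ b) ^+ k).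

(** The sine series is evaluated at [- x r^b]: its powers give [(-1)^k], and the leading minus
    compensates the oddness of [sin]. *)
Definition tail_coef {R : realType} (b l t : R) (k : nat) : R :=
  - (-1) ^+ k * expsin_coef (b * pi) k * tail_moment b l t k.

Lemma measurable_powR_pos {R : realType} (b : R) :
  measurable_fun (`]0, +oo[ : set R) (fun r : R => r `^ b).
Proof. by apply: measurable_funTS; exact: measurable_powR. Qed.

Lemma integrable_tail_moment {R : realType} (b l t : R) k :
  0 < b -> b < 1 -> 0 < l -> 0 < t ->
  (@mu R).-integrable `]0, +oo[ (EFin \o (fun r : R => tail_weight l t r * (r `^ b) ^+ k)).
Proof.
move=> b0 b1 l0 t0; apply: (integrable_tail_weight (K := k`!%:R) b0 b1 l0 ltr01 t0).
  by apply: measurable_funX; exact: measurable_powR_pos.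
move=> r r0; rewrite ger0_norm ?exprn_ge0 ?powR_ge0// mul1r.
exact/exprn_le_fact_expR/powR_ge0.
Qed.

(** All partial sums of the sine series at [- x r^b] are bounded by [exp (x r^b)], which is
    integrable against the weight, so dominated convergence allows termwise integration. *)
Lemma cvg_pseries_tail_coef {R : realType} (b l x t : R) :
  0 < b -> b < 1 -> 0 < l -> 0 < x -> 0 < t ->
  pseries (tail_coef b l t) x @ \oo --> \int[mu]_(r in `]0, +oo[)
    (tail_weight l t r *
      (expR (- (x * r `^ b * cos (b * pi))) * sin (x * r `^ b * sin (b * pi)))).
Proof.
move=> b0 b1 l0 x0 t0.
have m0 : measurable (`]0, +oo[%classic : set (measurableTypeR R)).
  exact: measurable_itv.
have mp (n : nat) : measurable_fun (`]0, +oo[ : set R)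
    (fun r => pseries (expsin_coef (b * pi)) (- (x * r `^ b)) n).
  rewrite /pseries /series/=; apply: measurable_sum => i.
  apply: measurable_funM => //; apply: measurable_funX; apply: measurableT_comp => //.
  by apply: measurable_funM => //; exact: measurable_powR_pos.
have bnd (n : nat) (r : R) : 0 < r ->
    `|- pseries (expsin_coef (b * pi)) (- (x * r `^ b)) n| <= 1 * expR (x * r `^ b).
  move=> r0; rewrite normrN mul1r.
  rewrite (le_trans (norm_pseries_le_expR _ _ (norm_expsin_coef_le _)))//.
  by rewrite normrN ger0_norm// mulr_ge0 ?powR_ge0// ltW.
have ie : (@mu R).-integrable `]0, +oo[
    (EFin \o (fun r : R => tail_weight l t r * expR (x * r `^ b))).
  apply: (integrable_tail_weight (K := 1) b0 b1 l0 x0 t0).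
    apply: measurableT_comp => //.
    by apply: measurable_funM => //; exact: measurable_powR_pos.
  by move=> r r0; rewrite ger0_norm ?expR_ge0// mul1r.
pose f_ (n : nat) (r : R) := tail_weight l t r *
  - pseries (expsin_coef (b * pi)) (- (x * r `^ b)) n.
have mf (n : nat) : measurable_fun (`]0, +oo[ : set R) (f_ n).
  by apply: measurable_funM; [exact: measurable_tail_weight|exact: measurable_funN].
have fn (n : nat) : (@mu R).-integrable `]0, +oo[ (EFin \o f_ n) /\
    \int[mu]_(r in `]0, +oo[) f_ n r = pseries (tail_coef b l t) x n.
  split.
    apply: (integrable_tail_weight (K := 1) b0 b1 l0 x0 t0); last exact: bnd.
    exact: measurable_funN.
  elim: n => [|n IHn].
    rewrite /pseries/= /series/= big_geq//.
    rewrite /Rintegral integral0_eq// => r _.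
    by rewrite /f_ /pseries /series/= big_geq// oppr0 mulr0.
  pose K := - (-1) ^+ n * expsin_coef (b * pi) n * x ^+ n.
  have im := integrable_tail_moment n b0 b1 l0 t0.
  rewrite (_ : pseries _ x n.+1 = pseries (tail_coef b l t) x n + K * tail_moment b l t n).
    rewrite -IHn /tail_moment -(RintegralZl K m0 im) -RintegralD//.
    - apply: eq_Rintegral_lebesgue => r _.
      have -> : K * (tail_weight l t r * r `^ b ^+ n) = - (tail_weight l t r *
          (expsin_coef (b * pi) n * (- (x * r `^ b)) ^+ n)).
        by rewrite /K (exprNn (x * r `^ b)) exprMn; ring.
      by rewrite /f_ /pseries seriesSr opprD mulrDr [X in _ + X]mulrN.
    - apply: (integrable_tail_weight (K := 1) b0 b1 l0 x0 t0); last exact: bnd.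
      exact: measurable_funN.
    - exact: (integrableZl m0 K im).
  by rewrite /pseries seriesSr; congr (_ + _); rewrite /= /tail_coef /K mulrAC.
pose f (r : R) := tail_weight l t r *
  (expR (- (x * r `^ b * cos (b * pi))) * sin (x * r `^ b * sin (b * pi))).
have limf (r : R) : `]0, +oo[%classic r -> f_ n r @[n --> \oo] --> f r.
  rewrite /= in_itv/= andbT => r0; apply: cvgM; first exact: cvg_cst.
  have := @is_cvg_pseries_le_fact _ _ (- (x * r `^ b)) (norm_expsin_coef_le (b * pi)).
  move/cvgN; rewrite lim_pseries_expsin.
  by rewrite !mulNr sinN mulrN opprK.
have dom (n : nat) (r : R) : `]0, +oo[%classic r ->
    `|f_ n r| <= tail_weight l t r * expR (x * r `^ b).
  rewrite /= in_itv/= andbT => r0.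
  rewrite normrM ger0_norm ?tail_weight_ge0// ler_wpM2l ?tail_weight_ge0//.
  by have := bnd n r r0; rewrite mul1r.
have [_] := cvg_Rintegral_dominated m0 mf limf ie dom.
rewrite (_ : (fun n => \int[mu]_(r in _) f_ n r) = pseries (tail_coef b l t) x)//.
by apply/funext => n; have [] := fn n.
Qed.

(** * Moments of the tail weight as products of gamma functions *)

Lemma ge0_RintegralZl {R : realType} (D : set R) (f : R -> R) (c : R) : 0 <= c ->
  measurable D -> measurable_fun D f -> (forall y, D y -> 0 <= f y) ->
  \int[mu]_(y in D) (c * f y) = c * \int[mu]_(y in D) f y.
Proof.
rewrite le_eqVlt => /predU1P[<-|c0] mD mf f0.
  rewrite mul0r /Rintegral integral0_eq// => y _.
  by rewrite mul0r.
(* If the integral is infinite, [fine] sends both sides to 0, so the identity persists. *)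
rewrite /Rintegral; under eq_integral do rewrite EFinM.
rewrite ge0_integralZl_EFin//; first last.
- exact: ltW.
- exact/measurable_EFinP.
case: (\int[_]_(_ in _) _)%E => [r| |]//=.
- by rewrite gt0_muley ?lte_fin//= mulr0.
- by rewrite gt0_muleNy ?lte_fin//= mulr0.
Qed.

Lemma Rintegral_scale_pos {R : realType} (G : R -> R) (c t : R) : 0 < c ->
  measurable_fun setT G -> {within `[c * t, +oo[, continuous G} ->
  (forall y, 0 <= G y) ->
  \int[mu]_(y in `]t, +oo[) G (c * y) = c^-1 * \int[mu]_(y in `]c * t, +oo[) G y.
Proof.
move=> c0 mG cG G0.
have dF (y : R) : is_derive y 1 (fun y : R => c * y) c.
  by apply: (is_derive_eq (is_deriveM (is_derive_cst c _ _) (is_derive_id _ _)));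
    rewrite /GRing.scale/= mulr1 mulr0 addr0.
have F'E : derive1 (fun y : R => c * y) = cst c.
  by apply/funext => y; rewrite derive1E; have [_ ->] := dF y.
have cF (y : R) : {for y, continuous (fun y : R => c * y)}.
  by apply: derivable_continuous_at; have [] := dF y.
have mcG : measurable_fun setT (fun y => G (c * y)).
  by apply: measurableT_comp => //; exact: measurable_funM.
rewrite /Rintegral !integral_itv_obnd_cbnd; last 2 first.
- by apply/measurable_EFinP; exact: measurable_funTS.
- by apply/measurable_EFinP; exact: measurable_funTS.
rewrite (@increasing_ge0_integration_by_substitutiony _ (fun y : R => c * y) G t); first last.
- by move=> y _; exact: G0.
- exact: cG.
- exact: gt0_cvgMry.
- split; first by move=> y _; have [] := dF y.
  apply: cvg_at_right_filter; exact: cF.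
- by rewrite F'E; exact: is_cvg_cst.
- by rewrite F'E; exact: is_cvg_cst.
- by rewrite F'E => y _; exact: cst_continuous.
- by move=> x y _ _ xy; rewrite ltr_pM2l.
rewrite F'E.
have h : \int[mu]_(y in `[t, +oo[) (c * G (c * y)) =
    c * \int[mu]_(y in `[t, +oo[) G (c * y).
  apply: ge0_RintegralZl => //; first exact: ltW.
  exact: measurable_funTS.
apply: (mulfI (lt0r_neq0 c0)); rewrite mulVKf ?gt_eqF//.
apply: (etrans (esym h)); congr (fine _); apply: eq_integral => y _.
by rewrite /= mulrC.
Qed.

(** The case [t = 0] is for the complete gamma integral, whose exponent is nonnegative here; the
    incomplete one has a negative exponent but starts at [l t > 0]. *)
Lemma continuous_powR_expRN {R : realType} (a t : R) : 0 < t \/ (t = 0 /\ 0 <= a) ->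
  {within `[t, +oo[, continuous (fun y : R => y `^ a * expR (- y))}.
Proof.
move=> ta.
have cp (z : R) : 0 < z -> {for z, continuous (fun y : R => y `^ a * expR (- y))}.
  move=> z0; apply: derivable_continuous_at; apply: derivableM => //.
  by apply: derivable_powR; rewrite in_itv/= z0.
apply/continuous_within_itvcyP; split=> [z|].
  rewrite in_itv/= andbT => tz; apply: cp.
  by case: ta => [t0|[t0 _]]; [exact: lt_trans tz|rewrite -t0].
case: ta => [t0|[-> a0]]; first by apply: cvg_at_right_filter; exact: cp.
apply: cvgM; last first.
  apply: cvg_at_right_filter; apply: (@derivable_continuous_at _ (fun y : R => expR (- y))).
  by [].
move: a0; rewrite le_eqVlt => /predU1P[<-|a0].
  by rewrite powRr0; apply: cvg_near_cst; near=> y; rewrite powRr0.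
by rewrite powR0 ?gt_eqF//; exact: powR_cvg0.
Unshelve. all: by end_near. Qed.

Lemma measurable_powR_expRN {R : realType} (a : R) :
  measurable_fun setT (fun y : R => y `^ a * expR (- y)).
Proof.
apply: measurable_funM; first exact: measurable_powR.
by apply: measurableT_comp.
Qed.

Lemma integrable_powR_expRN {R : realType} (a u : R) : 0 <= a -> 0 < u ->
  (@mu R).-integrable `]0, +oo[ (EFin \o (fun r : R => r `^ a * expR (- (u * r)))).
Proof.
move=> a0 u0; pose m := (Num.truncn a).+1.
have am : a <= m%:R by rewrite ltW// /m; exact: truncnS_gt.
have [M M0 HM] := @expRN_powR_le R u 1 m.+1 u0 ltr01.
apply: (@integrable_le_oneDsqrV _ _ M).
  apply: measurable_funM; first by apply: measurable_powR_pos.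
  apply: measurable_funTS; apply: measurableT_comp => //.
  by apply: measurableT_comp => //; exact: measurable_funM.
move=> r r0; rewrite ger0_norm ?mulr_ge0 ?powR_ge0 ?expR_ge0//.
have r1 : 1 <= 1 + r by rewrite lerDl ltW.
have rp : 0 < 1 + r by rewrite addr_gt0.
have ra : r `^ a <= (1 + r) ^+ m.
  rewrite -powR_mulrn ?(ltW rp)//.
  apply: (@le_trans _ _ ((1 + r) `^ a)); last exact: ler_powR.
  by rewrite ge0_ler_powR// ?nnegrE ?(ltW rp) ?(ltW r0)// lerDr.
have er := HM r r0; rewrite powRr1 ?(ltW r0)// in er.
rewrite (le_trans (ler_pM (powR_ge0 _ _) (expR_ge0 _) ra er))//.
rewrite mulrCA ler_wpM2l ?(ltW M0)// -[m.+2]addn2 exprD invfM mulrA divff ?mul1r ?gt_eqF ?exprn_gt0//.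
rewrite lef_pV2 ?posrE ?exprn_gt0 ?addr_gt0 ?exprn_gt0//.
by rewrite sqrrD expr1n mul1r lerD2r lerDl mulrn_wge0// ltW.
Qed.

Lemma Rintegral_powR_expRN {R : realType} (a y : R) : 0 <= a -> 0 < y ->
  \int[mu]_(r in `]0, +oo[) (r `^ a * expR (- (y * r))) = y `^ (- a - 1) * Gamma (1 + a).
Proof.
move=> a0 y0.
have := @Rintegral_scale_pos R (fun z => z `^ a * expR (- z)) y 0 y0 (measurable_powR_expRN a).
rewrite mulr0 => /(_ (continuous_powR_expRN (or_intror (conj erefl a0)))).
have G0 (z : R) : 0 <= z `^ a * expR (- z) by rewrite mulr_ge0 ?powR_ge0 ?expR_ge0.
move=> /(_ G0) h.
have ya0 : 0 < y `^ a by rewrite powR_gt0.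
apply: (mulfI (lt0r_neq0 ya0)); rewrite -ge0_RintegralZl ?(ltW ya0)//; first last.
- by move=> r _; rewrite mulr_ge0 ?powR_ge0 ?expR_ge0.
- apply: measurable_funM; first by apply: measurable_powR_pos.
  apply: measurable_funTS; apply: measurableT_comp => //.
  by apply: measurableT_comp => //; exact: measurable_funM.
transitivity (\int[mu]_(r in `]0, +oo[) ((y * r) `^ a * expR (- (y * r)))).
  apply: eq_Rintegral_lebesgue => r; rewrite /= in_itv/= andbT => r0.
  by rewrite powRM ?(ltW y0) ?(ltW r0)// mulrA.
apply: (etrans h); clear h; rewrite mulrA -powRD; last by rewrite (gt_eqF y0) implybT.
rewrite (_ : a + _ = - 1); last by ring.
rewrite powRN powRr1 ?(ltW y0)// /Gamma; congr (_ * _).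
by apply: eq_Rintegral_lebesgue => r _; congr (_ `^ _ * _); ring.
Qed.

(** The weight is the integral of [e^(- (l + r) y)] over [y > t]. After exchanging the integrals,
    the one over [r] gives [Gamma (1 + a) y^(- a - 1)], and the one over [y] becomes the incomplete
    gamma function on rescaling by [l]. *)
Lemma Rintegral_tail_weight_powR {R : realType} (a l t : R) :
  0 <= a -> 0 < l -> 0 < t ->
  \int[mu]_(r in `]0, +oo[) (tail_weight l t r * r `^ a) =
  l `^ a * Gamma (1 + a) * upper_gamma (- a) (l * t).
Proof.
move=> a0 l0 t0.
have G0 : 0 <= Gamma (1 + a) by apply: Rintegral_ge0 => r _; rewrite mulr_ge0 ?powR_ge0 ?expR_ge0.
pose h (y r : R) := r `^ a * expR (- ((l + r) * y)).
have mh : measurable_fun setT (fun p : R * R => h p.1 p.2).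
  apply: measurable_funM; first by apply: (measurableT_comp (measurable_powR _)).
  apply: (measurableT_comp (@measurable_expR R)); apply: measurableT_comp => //.
  by apply: measurable_funM => //; exact: measurable_funD.
have hb (y r : R) : `]t, +oo[%classic y -> `]0, +oo[%classic r ->
    `|h y r| <= expR (- (l * y)) * (r `^ a * expR (- (t * r))).
  rewrite /= !in_itv/= !andbT => ty r0; rewrite ger0_norm ?mulr_ge0 ?powR_ge0 ?expR_ge0//.
  rewrite mulrCA ler_wpM2l ?powR_ge0// -expRD ler_expR -opprD lerN2 mulrDl lerD2l.
  by rewrite mulrC ler_wpM2l ?(ltW r0)// ltW.
have E2 (r : R) : `]0, +oo[%classic r ->
    tail_weight l t r * r `^ a = \int[mu]_(y in `]t, +oo[) h y r.
  rewrite /= in_itv/= andbT => r0.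
  have lr0 : 0 < l + r by rewrite addr_gt0.
  rewrite /h ge0_RintegralZl ?powR_ge0//; first last.
    apply: measurable_funTS; apply: measurableT_comp => //.
    by apply: measurableT_comp => //; exact: measurable_funM.
  rewrite mulrC; congr (_ * _).
  (* With frequency 0 and phase [pi / 2] the sine is 1, which leaves the plain exponential
     integral. *)
  have := Rintegral_expRN_sin 0 (pi / 2) lr0 (ltW t0).
  rewrite mul0r add0r mul0r addr0 sin_pihalf mulr1 expr0n addr0 => e.
  transitivity (expR (- ((l + r) * t)) * (l + r) / (l + r) ^+ 2).
    by rewrite /tail_weight mulrC [t * _]mulrC; field; rewrite gt_eqF.
  rewrite -e; apply: eq_Rintegral_lebesgue => y _.
  by rewrite mul0r add0r sin_pihalf mulr1.
apply: (etrans (eq_Rintegral_lebesgue E2)).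
have [_ I12] := Rintegral_lebesgue_Fubini (measurable_itv _) (measurable_itv _) mh
  (integrable_expRN l0 (ltW t0)) (integrable_powR_expRN a0 t0) hb.
apply: (etrans (esym I12)); clear I12 E2 hb mh.
pose K := Gamma (1 + a) * l `^ (a + 1).
have K0 : 0 <= K by rewrite mulr_ge0 ?powR_ge0.
transitivity (\int[mu]_(y in `]t, +oo[) (K * ((l * y) `^ (- a - 1) * expR (- (l * y))))).
  apply: eq_Rintegral_lebesgue => y; rewrite /= in_itv/= andbT => ty.
  have y0 : 0 < y by exact: lt_trans ty.
  rewrite /K powRM ?(ltW l0) ?(ltW y0)//.
  transitivity (\int[mu]_(r in `]0, +oo[) (expR (- (l * y)) * (r `^ a * expR (- (y * r))))).
    apply: eq_Rintegral_lebesgue => r _.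
    by rewrite /h mulrCA -expRD mulrDl opprD [r * y]mulrC.
  rewrite ge0_RintegralZl ?expR_ge0//; first last.
  - by move=> r _; rewrite mulr_ge0 ?powR_ge0 ?expR_ge0.
  - apply: measurable_funM; first by apply: measurable_powR_pos.
    apply: measurable_funTS; apply: measurableT_comp => //.
    by apply: measurableT_comp => //; exact: measurable_funM.
  rewrite Rintegral_powR_expRN//.
  have e : l `^ (a + 1) * l `^ (- a - 1) = 1.
    rewrite -powRD; last by rewrite (gt_eqF l0) implybT.
    by rewrite (_ : _ + _ = 0) ?powRr0//; ring.
  by apply: (etrans (esym (mul1r _))); rewrite -{1}e; ring.
have mG : measurable_fun setT (fun z : R => (l * z) `^ (- a - 1) * expR (- (l * z))).
  apply: (@measurableT_comp _ _ _ _ _ _ (fun z : R => z `^ (- a - 1) * expR (- z))).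
    exact: measurable_powR_expRN.
  exact: measurable_funM.
rewrite ge0_RintegralZl//; first last.
- by move=> y _; rewrite mulr_ge0 ?powR_ge0 ?expR_ge0.
- exact: measurable_funTS.
rewrite (@Rintegral_scale_pos R (fun z => z `^ (- a - 1) * expR (- z)) l t l0).
- rewrite mulrA /K -/(upper_gamma _ _); congr (_ * _).
  rewrite powRD; last by rewrite (gt_eqF l0) implybT.
  by rewrite powRr1 ?(ltW l0)//; field; rewrite gt_eqF.
- exact: measurable_powR_expRN.
- by apply: continuous_powR_expRN; left; rewrite mulr_gt0.
- by move=> z; rewrite mulr_ge0 ?powR_ge0 ?expR_ge0.
Qed.

Lemma tail_momentE {R : realType} (b l t : R) k : 0 < b -> 0 < l -> 0 < t ->
  tail_moment b l t k =
  l `^ (b * k%:R) * Gamma (1 + b * k%:R) * upper_gamma (- (b * k%:R)) (l * t).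
Proof.
move=> b0 l0 t0; rewrite -Rintegral_tail_weight_powR ?mulr_ge0 ?(ltW b0)//.
apply: eq_Rintegral_lebesgue => r; rewrite /= in_itv/= andbT => r0.
by rewrite powRrM powR_mulrn ?powR_ge0.
Qed.

(** * Termwise differentiation of the tail *)

Lemma is_cvg_pseries_diffs {R : realType} (c : nat -> R) :
  (forall z, cvgn (pseries c z)) -> forall z, cvgn (pseries (pseries_diffs c) z).
Proof.
move=> cc z; apply: normed_cvg.
(* Large enough that [(k + 1) |z|^k <= (2 |z|)^k <= w^k]; since [w >= 1], one more power of [w] can
   be inserted to match the shifted series. *)
pose w := 2 * `|z| + 1.
have w1 : 1 <= w by rewrite lerDr mulr_ge0.
have w0 : 0 < w by exact: lt_le_trans w1.
have h : cvgn (pseries (fun i => `|c i|) w).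
  apply: (@is_cvg_pseries_inside_norm _ _ (w + 1)); first exact: cc.
  by rewrite !ger0_norm ?addr_ge0 ?(ltW w0)// ltrDl.
have hS : cvgn (series (fun k => `|c k.+1| * w ^+ k.+1)).
  have hc : cvgn (fun n => pseries (fun i => `|c i|) w n.+1 - `|c 0%N|).
    apply: is_cvgB; last exact: is_cvg_cst.
    by move/cvg_ex: h => [y hy]; apply: (cvgP y); rewrite (cvg_shiftS (pseries (fun i => `|c i|) w)).
  move: hc; rewrite (_ : (fun n => _ - _) = series (fun k => `|c k.+1| * w ^+ k.+1))//.
  apply/funext => n; rewrite /pseries /series/= big_nat_recl//.
  by rewrite expr0 mulr1 addrC addKr.
apply: (series_le_cvg _ _ _ hS) => k /=.
- exact: normr_ge0.
- by rewrite mulr_ge0// exprn_ge0// ltW.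
rewrite /pseries_diffs !normrM normrX normr_nat mulrAC mulrC ler_wpM2l//.
apply: (@le_trans _ _ ((2 * `|z|) ^+ k)).
  rewrite exprMn ler_wpM2r ?exprn_ge0//.
  by rewrite -natrX ler_nat; exact: ltn_expl.
apply: (@le_trans _ _ (w ^+ k)).
  by rewrite lerXn2r ?nnegrE ?mulr_ge0 ?(ltW w0)// lerDl.
by rewrite exprS ler_peMl// exprn_ge0// ltW.
Qed.

Lemma is_derive_pseries {R : realType} (c : nat -> R) :
  (forall z, cvgn (pseries c z)) -> forall z : R,
  is_derive z 1 (fun z => limn (pseries c z)) (limn (pseries (pseries_diffs c) z)).
Proof.
move=> cc z; have cd := is_cvg_pseries_diffs cc; have cdd := is_cvg_pseries_diffs cd.
have zK : `|z| < `|(`|z| + 1)%R| by rewrite (@ger0_norm _ (_ + 1)) ?addr_ge0// ltrDl.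
exact: (pseries_snd_diffs (cc _) (cd _) (cdd _) zK).
Qed.

Lemma is_cvg_pseries_tail_coef {R : realType} (b l t z : R) :
  0 < b -> b < 1 -> 0 < l -> 0 < t -> cvgn (pseries (tail_coef b l t) z).
Proof.
move=> b0 b1 l0 t0.
have x0 : 0 < `|z| + 1 by rewrite ltr_wpDl.
apply: (@is_cvg_pseries_inside _ _ (`|z| + 1)).
  exact: (cvgP _ (cvg_pseries_tail_coef b0 b1 l0 x0 t0)).
by rewrite (ger0_norm (ltW x0)) ltrDl.
Qed.

(** Replacing the integral by its power series gives a function differentiable on the whole line, in
    particular across [x = 0], where the mass of the density is read off. *)
Definition tail_series {R : realType} (b l t x : R) : R :=
  expR (l `^ b * x) / pi * limn (pseries (tail_coef b l t) x).

(** Product rule for [exp (l^b x) S(x)]: the terms [S'] and [l^b S] are the origin of the two gamma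
    products, of indices [k + 1] and [k], in the formula. *)
Definition density_coef {R : realType} (b l t : R) (k : nat) : R :=
  pseries_diffs (tail_coef b l t) k + l `^ b * tail_coef b l t k.

Definition density_series {R : realType} (b l t x : R) : R :=
  expR (l `^ b * x) / pi * limn (pseries (density_coef b l t) x).

Lemma tempered_tailE {R : realType} (b l x t : R) :
  0 < b -> b < 1 -> 0 < l -> 0 < x -> 0 < t ->
  tempered_tail b l x t = tail_series b l t x.
Proof.
move=> b0 b1 l0 x0 t0; rewrite /tail_series.
by rewrite (cvg_lim _ (cvg_pseries_tail_coef b0 b1 l0 x0 t0)).
Qed.

Lemma tail_series0 {R : realType} (b l t : R) : tail_series b l t 0 = 0.
Proof.
by rewrite /tail_series lim_pseries0 /tail_coef /expsin_coef !mul0r sin0 !mul0r !mulr0 mul0r mulr0.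
Qed.

Lemma cvg_pseries_density_coef {R : realType} (b l t x : R) :
  0 < b -> b < 1 -> 0 < l -> 0 < t ->
  pseries (density_coef b l t) x @ \oo -->
    limn (pseries (pseries_diffs (tail_coef b l t)) x) +
    l `^ b * limn (pseries (tail_coef b l t) x).
Proof.
move=> b0 b1 l0 t0.
have cc (z : R) := @is_cvg_pseries_tail_coef _ b l t z b0 b1 l0 t0.
have := @cvg_pseries_comb _ 1 (l `^ b) _ _ _ (@is_cvg_pseries_diffs _ _ cc x) (cc x).
by rewrite mul1r; under eq_fun do rewrite mul1r.
Qed.

Lemma is_derive_tail_series {R : realType} (b l t : R) :
  0 < b -> b < 1 -> 0 < l -> 0 < t -> forall x : R,
  is_derive x 1 (tail_series b l t) (density_series b l t x).
Proof.
move=> b0 b1 l0 t0 x.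
have cc (z : R) := @is_cvg_pseries_tail_coef _ b l t z b0 b1 l0 t0.
have dl : is_derive x 1 (fun y : R => l `^ b * y) (l `^ b).
  by apply: (is_derive_eq (is_deriveM (is_derive_cst (l `^ b) _ _) (is_derive_id _ _)));
    rewrite /GRing.scale/= mulr1 mulr0 addr0.
have de := is_derive1_comp (is_derive_expR _) dl.
apply: (is_derive_eq (is_deriveM (is_deriveM de (is_derive_cst (pi^-1 : R) _ _))
  (is_derive_pseries cc x))).
rewrite /density_series (cvg_lim _ (@cvg_pseries_density_coef _ b l t x b0 b1 l0 t0))//.
rewrite ?fctE /GRing.scale/=; ring.
Qed.

Lemma continuous_density_series {R : realType} (b l t : R) :
  0 < b -> b < 1 -> 0 < l -> 0 < t -> continuous (density_series b l t).
Proof.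
move=> b0 b1 l0 t0 x.
have cc (z : R) := @is_cvg_pseries_tail_coef _ b l t z b0 b1 l0 t0.
rewrite /density_series.
have -> : (fun x : R => expR (l `^ b * x) / pi * limn (pseries (density_coef b l t) x)) =
  (fun x : R => expR (l `^ b * x) / pi *
    (limn (pseries (pseries_diffs (tail_coef b l t)) x) +
     l `^ b * limn (pseries (tail_coef b l t) x))).
  apply/funext => y.
  by rewrite (cvg_lim _ (@cvg_pseries_density_coef _ b l t y b0 b1 l0 t0)).
have d1 := is_derive_pseries cc x.
have d2 := is_derive_pseries (@is_cvg_pseries_diffs _ _ cc) x.
apply: cvgM.
  apply: cvgM; last exact: cvg_cst.
  apply: continuous_comp; last exact: continuous_expR.
  by apply: cvgM; [exact: cvg_cst|exact: cvg_id].
apply: cvgD; first by apply: derivable_continuous_at; have [] := d2.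
apply: cvgM; first exact: cvg_cst.
by apply: derivable_continuous_at; have [] := d1.
Qed.

Lemma density_coefE {R : realType} (b l t : R) k : 0 < b -> 0 < l -> 0 < t ->
  density_coef b l t k = (-1) ^+ k * (l `^ (b * k.+1%:R) / k`!%:R) *
    (Gamma (1 + b * k.+1%:R) * upper_gamma (- (b * k.+1%:R)) (l * t)
       * sin (k.+1%:R * b * pi)
     - Gamma (1 + b * k%:R) * upper_gamma (- (b * k%:R)) (l * t)
       * sin (k%:R * b * pi)).
Proof.
move=> b0 l0 t0.
rewrite /density_coef /pseries_diffs /tail_coef /expsin_coef !tail_momentE// !mulrA.
have -> : l `^ (b * k.+1%:R) = l `^ b * l `^ (b * k%:R).
  rewrite -powRD; last by rewrite (gt_eqF l0) implybT.
  by congr (_ `^ _); rewrite -natr1; ring.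
rewrite exprS factS natrM; field.
by rewrite nat1r !pnatr_eq0 -lt0n fact_gt0.
Qed.

(** * The inverse process *)

(** Continuity in [t], used to exclude atoms; the lower bound [t / 2] on the sequence makes the
    weight at [t / 2] a common dominating function. *)
Lemma cvg_tempered_tail {R : realType} (b l x t : R) (u : nat -> R) :
  0 < b -> b < 1 -> 0 < l -> 0 < x -> 0 < t ->
  u @ \oo --> t -> (forall n, t / 2 <= u n) ->
  tempered_tail b l x (u n) @[n --> \oo] --> tempered_tail b l x t.
Proof.
move=> b0 b1 l0 x0 t0 ut tu.
have t20 : 0 < t / 2 by rewrite divr_gt0.
pose osc (r : R) := expR (- (x * r `^ b * cos (b * pi))) * sin (x * r `^ b * sin (b * pi)).
have mosc : measurable_fun (`]0, +oo[ : set R) osc.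
  have mp : measurable_fun (`]0, +oo[ : set R) (fun r : R => x * r `^ b).
    by apply: measurable_funM => //; exact: measurable_powR_pos.
  apply: measurable_funM; last first.
    apply: (measurableT_comp (continuous_measurable_fun (@continuous_sin R))).
    exact: measurable_funM.
  apply: measurableT_comp => //; apply: measurableT_comp => //.
  exact: measurable_funM.
have osc_le (r : R) : 0 < r -> `|osc r| <= 1 * expR (x * r `^ b).
  move=> r0; rewrite mul1r normrM (@ger0_norm _ (expR _)) ?expR_ge0//.
  apply: (@le_trans _ _ (expR (- (x * r `^ b * cos (b * pi))))).
    by rewrite ler_piMr ?expR_ge0// norm_sin_le1.
  have q0 : 0 <= x * r `^ b by rewrite mulr_ge0 ?powR_ge0// ltW.
  have c1 : - cos (b * pi) <= 1.
    by rewrite lerNl; have := norm_cos_le1 (b * pi); rewrite ler_norml => /andP[].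
  by rewrite ler_expR -mulrN ler_piMr.
have ie : (@mu R).-integrable `]0, +oo[
    (EFin \o (fun r : R => tail_weight l (t / 2) r * expR (x * r `^ b))).
  apply: (integrable_tail_weight (K := 1) b0 b1 l0 x0 t20).
    apply: measurableT_comp => //.
    by apply: measurable_funM => //; exact: measurable_powR_pos.
  by move=> r r0; rewrite ger0_norm ?expR_ge0// mul1r.
have m0 : measurable (`]0, +oo[%classic : set (measurableTypeR R)).
  exact: measurable_itv.
pose f_ (n : nat) (r : R) := tail_weight l (u n) r * osc r.
pose f (r : R) := tail_weight l t r * osc r.
have mf (n : nat) : measurable_fun (`]0, +oo[ : set R) (f_ n).
  by apply: measurable_funM; [exact: measurable_tail_weight|].
have limf (r : R) : `]0, +oo[%classic r -> f_ n r @[n --> \oo] --> f r.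
  rewrite /= in_itv/= andbT => r0; apply: cvgM; last exact: cvg_cst.
  apply: cvgM; last exact: cvg_cst.
  apply: continuous_cvg; first exact: continuous_expR.
  by apply: cvgN; apply: cvgM => //; exact: cvg_cst.
have dom (n : nat) (r : R) : `]0, +oo[%classic r ->
    `|f_ n r| <= tail_weight l (t / 2) r * expR (x * r `^ b).
  rewrite /= in_itv/= andbT => r0.
  have lr0 : 0 < l + r by rewrite addr_gt0.
  rewrite normrM ger0_norm ?tail_weight_ge0//.
  apply: ler_pM; rewrite ?tail_weight_ge0//; last first.
    by have := osc_le r r0; rewrite mul1r.
  by rewrite /tail_weight ler_wpM2r ?invr_ge0 ?(ltW lr0)// ler_expR lerN2 ler_wpM2r ?(ltW lr0).
have [_ h] := cvg_Rintegral_dominated m0 mf limf ie dom.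
by apply: cvgM; [exact: cvg_cst|exact: h].
Qed.

Lemma cvg_scale_harmonic {R : realType} (t c : R) :
  (t + c / n.+2%:R : R) @[n --> \oo] --> t.
Proof.
rewrite -[X in _ --> X]addr0; apply: cvgD; first exact: cvg_cst.
rewrite -[X in _ --> X](mulr0 c); apply: cvgM; first exact: cvg_cst.
by rewrite (cvg_shiftS (fun n => n.+1%:R^-1 : R)); exact: cvg_harmonic.
Qed.

Lemma fine_probability_le d (T : measurableType d) {R : realType}
    (P : probability T R) (A B : set T) :
  measurable A -> measurable B -> {ae P, forall w, A w -> B w} ->
  fine (P A) <= fine (P B).
Proof.
move=> mA mB [N [mN N0 ABN]].
rewrite fine_le ?fin_num_measure//.
apply: (@le_trans _ _ (P (B `|` N))).
  apply: le_measure; rewrite ?inE//; first exact: measurableU.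
  move=> w Aw; have [Bw|Bw] := pselect (B w); [by left|right].
  by apply: ABN => /= /(_ Aw).
by apply: le_trans (measureU2 _ mB mN) _; rewrite -[leRHS]adde0 -N0.
Qed.

Lemma fine_probability_setC d (T : measurableType d) {R : realType}
    (P : probability T R) (A : set T) : measurable A ->
  fine (P (~` A)) = 1 - fine (P A).
Proof.
move=> mA; rewrite probability_setC// fineB ?fin_num_measure//.
Qed.

Lemma measurable_RV_gt_eq d (T : measurableType d) {R : realType}
    (P : probability T R) (X : {RV P >-> R}) (t : R) :
  measurable [set w | t < X w] /\ measurable [set w | X w = t].
Proof.
split.
- have -> : [set w | t < X w] = X @^-1` `]t, +oo[%classic.
    by apply/seteqP; split => w; rewrite /= in_itv/= andbT.
  exact: measurable_sfunP.
- have -> : [set w | X w = t] = X @^-1` [set t] by [].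
  exact: measurable_sfunP.
Qed.

(* The tail is squeezed between values of the continuous [tempered_tail] on both sides,
   so the law has no atom. *)
Lemma tempered_tail_probability d (T : measurableType d) {R : realType}
    (P : probability T R) (X : {RV P >-> R}) (b l x t : R) :
  0 < b -> b < 1 -> 0 < l -> 0 < x -> 0 < t ->
  {ae P, forall w, 0 <= X w} ->
  (forall s, 0 < s -> ('E_P[fun w => expR (- s * X w)])%E =
    (expR (- x * ((s + l) `^ b - l `^ b)))%:E) ->
  fine (P [set w | t < X w]) = tempered_tail b l x t.
Proof.
move=> b0 b1 l0 x0 t0 X0 EX.
have bounds (s : R) (s0 : 0 < s) := tempered_tail_bounds b0 b1 l0 x0 s0 X0 EX.
apply/eqP; rewrite eq_le (andP (bounds _ t0)).1/=.
pose u (n : nat) : R := t + t / n.+2%:R.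
have ut : u @ \oo --> t by exact: cvg_scale_harmonic.
have tu n : t < u n by rewrite ltrDl divr_gt0.
have h := cvg_tempered_tail b0 b1 l0 x0 t0 ut.
have tn : forall n, t / 2 <= u n.
  by move=> n; rewrite (le_trans _ (ltW (tu n)))// ler_pdivrMr// ler_peMr ?(ltW t0)// ler1n.
have C : (fun=> fine (P [set w | t < X w])) @ \oo --> fine (P [set w | t < X w]).
  exact: cvg_cst.
apply: (ler_cvg_to (h tn) C); apply: nearW => n.
have un0 : 0 < u n by exact: lt_trans (tu n).
have [m1 m2] := measurable_RV_gt_eq X (u n).
have [m3 _] := measurable_RV_gt_eq X t.
rewrite (le_trans (andP (bounds _ un0)).2)//.
rewrite -fineD ?fin_num_measure// -measureU//; last first.
  by apply/seteqP; split => // w [/= h1 h2]; rewrite h2 ltxx in h1.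
apply: fine_probability_le => //; first exact: measurableU.
by apply: aeW => w [/=|/= ->]; [exact: lt_trans|].
Qed.

Lemma subordinator_ge0 d (T : measurableType d) {R : realType} (P : probability T R)
    (D : R -> {RV P >-> R}) (x : R) :
  increasing_subordinator D -> 0 < x -> {ae P, forall w, 0 <= D x w}.
Proof.
move=> hD x0; have D0 := subordinator0 hD; have Di := subordinator_increasing hD.
apply: filterS2 D0 Di => w D0w Diw.
by rewrite -D0w ltW//; apply: Diw.
Qed.

Lemma tempered_stable_tail d (T : measurableType d) {R : realType} (P : probability T R)
    (D : R -> {RV P >-> R}) (b l x t : R) :
  0 < b -> b < 1 -> 0 < l -> tempered_stable_subordinator b l D ->
  0 < x -> 0 < t -> fine (P [set w | t < D x w]) = tail_series b l t x.
Proof.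
move=> b0 b1 l0 [iD lD] x0 t0; rewrite -tempered_tailE//.
apply: tempered_tail_probability => //; first exact: subordinator_ge0.
by move=> s s0; apply: lD => //; exact: ltW.
Qed.

(** Markov's inequality for [exp (- D x)], that is, the Laplace transform at [s = 1]. The
    exponential decay in [x] yields both the finiteness of passage times and the limit of the tail
    at infinity. *)
Lemma tail_series_compl_le d (T : measurableType d) {R : realType} (P : probability T R)
    (D : R -> {RV P >-> R}) (b l x t : R) :
  0 < b -> b < 1 -> 0 < l -> tempered_stable_subordinator b l D ->
  0 < x -> 0 < t ->
  1 - tail_series b l t x <= expR t * expR (- (((1 + l) `^ b - l `^ b) * x)).
Proof.
move=> b0 b1 l0 hD x0 t0; rewrite -(tempered_stable_tail b0 b1 l0 hD x0 t0).
have [mA _] := measurable_RV_gt_eq (D x) t.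
rewrite -fine_probability_setC//.
have mA' : measurable (~` [set w | t < D x w]) by exact: measurableC.
have mf : measurable_fun setT (fun w => (expR (-1 * D x w))%:E).
  apply/measurable_EFinP; apply: measurableT_comp => //.
  exact: measurable_funM.
have h : ((expR (- t))%:E * P (~` [set w | (t < D x w)%R]) <=
    (expR (- x * ((1 + l) `^ b - l `^ b)))%:E)%E.
  have <- := hD.2 1 x ltr01 (ltW x0).
  rewrite unlock -integral_cst//.
  apply: (@le_trans _ _ (\int[P]_(w in ~` [set w | (t < D x w)%R]) (expR (-1 * D x w))%:E)%E).
    apply: ge0_le_integral => //.
    - by move=> w _; rewrite lee_fin expR_ge0.
    - exact: measurable_funTS.
    - by move=> w /= /negP; rewrite -leNgt => Dt; rewrite lee_fin ler_expR mulN1r lerN2.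
  exact: ge0_subset_integral.
rewrite -(@fineK _ (P (~` _))) ?fin_num_measure// -EFinM lee_fin in h.
rewrite -(ler_pM2l (expR_gt0 (- t))) (le_trans h)// mulrA -expRD addNr expR0 mul1r.
by rewrite ler_expR mulNr mulrC.
Qed.

Lemma tempered_exponent_gt0 {R : realType} (b l : R) : 0 < b -> 0 < l ->
  0 < (1 + l) `^ b - l `^ b.
Proof.
by move=> b0 l0; rewrite subr_gt0 gt0_ltr_powR ?nnegrE ?addr_ge0 ?(ltW l0)// ltrDr.
Qed.

(** Guarantees that the infimum defining [E t] is almost surely over a nonempty set. Staying below
    [t] at all positive integer times is less likely than at any one of them, and those
    probabilities tend to 0. *)
Lemma passage_time_exists d (T : measurableType d) {R : realType} (P : probability T R)
    (D : R -> {RV P >-> R}) (b l t : R) :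
  0 < b -> b < 1 -> 0 < l -> tempered_stable_subordinator b l D -> 0 < t ->
  {ae P, forall w, exists2 u, 0 < u & t < D u w}.
Proof.
move=> b0 b1 l0 hD t0.
pose N := \bigcap_(n : nat) ~` [set w | t < D n.+1%:R w].
have mn (n : nat) : measurable (~` [set w | t < D n.+1%:R w]).
  by apply: measurableC; have [] := measurable_RV_gt_eq (D n.+1%:R) t.
have mN : measurable N by exact: bigcapT_measurable.
exists N; split => //; last first.
  move=> w /= hw n _ /= tD; apply: hw; exists n.+1%:R => //.
apply/eqP; rewrite -(@fineK _ (P N)) ?fin_num_measure// eqe eq_le.
rewrite fine_ge0// andbT.
have k0 := tempered_exponent_gt0 b0 l0.
have := cvg_expRN_nat k0; rewrite -(cvg_shiftS (fun m : nat => expR (- (_ * m%:R)))) => h.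
have h' : expR t * expR (- (((1 + l) `^ b - l `^ b) * n.+1%:R)) @[n --> \oo] --> 0.
  by rewrite -[X in _ --> X](mulr0 (expR t)); apply: cvgM => //; exact: cvg_cst.
have C0 : (fun=> fine (P N)) @ \oo --> fine (P N) by exact: cvg_cst.
apply: (ler_cvg_to C0 h'); apply: nearW => n /=.
apply: le_trans (tail_series_compl_le b0 b1 l0 hD (ltr0Sn _ n) t0).
rewrite -(tempered_stable_tail b0 b1 l0 hD (ltr0Sn _ n) t0).
have [mA _] := measurable_RV_gt_eq (D n.+1%:R) t.
rewrite -fine_probability_setC// fine_le ?fin_num_measure//.
by apply: le_measure; rewrite ?inE//; exact: bigcap_inf.
Qed.

Lemma tail_series_nondecreasing d (T : measurableType d) {R : realType}
    (P : probability T R) (D : R -> {RV P >-> R}) (b l t x y : R) :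
  0 < b -> b < 1 -> 0 < l -> tempered_stable_subordinator b l D -> 0 < t ->
  0 < x -> x < y -> tail_series b l t x <= tail_series b l t y.
Proof.
move=> b0 b1 l0 hD t0 x0 xy; have y0 : 0 < y by exact: lt_trans xy.
rewrite -(tempered_stable_tail b0 b1 l0 hD x0 t0) -(tempered_stable_tail b0 b1 l0 hD y0 t0).
apply: fine_probability_le; [by have [] := measurable_RV_gt_eq (D x) t|
  by have [] := measurable_RV_gt_eq (D y) t|].
apply: filterS (subordinator_increasing hD.1) => w /(_ x y (ltW x0) xy).
by move=> /[swap]; exact: lt_trans.
Qed.

Lemma continuous_tail_series {R : realType} (b l t : R) :
  0 < b -> b < 1 -> 0 < l -> 0 < t -> continuous (tail_series b l t).
Proof.
move=> b0 b1 l0 t0 x; apply: derivable_continuous_at.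
by have [] := is_derive_tail_series b0 b1 l0 t0 x.
Qed.

(** On almost every path, for [x > 0], [D x > t] forces [E t <= x], and [D y <= t] with [y > x]
    forces [E t >= y > x]. Letting [y] decrease to [x], the continuity of the tail in [x] closes the
    gap. For [x <= 0] the maximum leads to the value 0 of the tail at 0. *)
Lemma inverse_tail d (T : measurableType d) {R : realType} (P : probability T R)
    (D E : R -> {RV P >-> R}) (b l t x : R) :
  0 < b -> b < 1 -> 0 < l -> tempered_stable_subordinator b l D ->
  inverse_process D E -> 0 < t ->
  fine (P [set w | x < E t w]) = 1 - tail_series b l t (Num.max x 0).
Proof.
move=> b0 b1 l0 hD hE t0.
have [mE _] := measurable_RV_gt_eq (E t) x.
have Et := hE t (ltW t0).
have Ex := passage_time_exists b0 b1 l0 hD t0.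
have inc := subordinator_increasing hD.1.
apply/eqP; rewrite eq_le; apply/andP; split.
  have [x0|x0] := ltP 0 x; last first.
    rewrite tail_series0 subr0.
    by rewrite -lee_fin fineK ?fin_num_measure// probability_le1.
  rewrite -(tempered_stable_tail b0 b1 l0 hD x0 t0).
  have [mA _] := measurable_RV_gt_eq (D x) t.
  rewrite -fine_probability_setC//; apply: fine_probability_le => //.
    exact: measurableC.
  apply: filterS Et => w /= -> xE tD; move: xE; apply/negP; rewrite -leNgt.
  apply: ge_inf => //; exists 0 => u /= [u0 _]; exact: ltW.
pose u (n : nat) : R := Num.max x 0 + 1 / n.+2%:R.
have cu : u @ \oo --> Num.max x 0 by exact: cvg_scale_harmonic.
have h : 1 - tail_series b l t (u n) @[n --> \oo] --> 1 - tail_series b l t (Num.max x 0).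
  apply: cvgB; first exact: cvg_cst.
  by apply: continuous_cvg => //; exact: continuous_tail_series.
have C : (fun=> fine (P [set w | x < E t w])) @ \oo --> fine (P [set w | x < E t w]).
  exact: cvg_cst.
apply: (ler_cvg_to h C); apply: nearW => n.
have un : Num.max x 0 < u n by rewrite ltrDl.
have xu : x < u n by rewrite (le_lt_trans _ un)// le_max lexx.
have u0 : 0 < u n by rewrite (le_lt_trans _ un)// le_max lexx orbT.
rewrite -(tempered_stable_tail b0 b1 l0 hD u0 t0).
have [mA _] := measurable_RV_gt_eq (D (u n)) t.
rewrite -fine_probability_setC//; apply: fine_probability_le => //.
  exact: measurableC.
apply: filterS3 Et Ex inc => w /= -> [v v0 tv] incw Dt.
apply: (lt_le_trans xu); apply: lb_le_inf; first by exists v.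
move=> z /= [z0 tz]; rewrite leNgt; apply/negP => zu.
by apply: Dt; rewrite (lt_trans tz)// incw// ltW.
Qed.

Lemma cvg_tail_series d (T : measurableType d) {R : realType}
    (P : probability T R) (D : R -> {RV P >-> R}) (b l t : R) :
  0 < b -> b < 1 -> 0 < l -> tempered_stable_subordinator b l D -> 0 < t ->
  tail_series b l t x @[x --> +oo%R] --> (1 : R).
Proof.
move=> b0 b1 l0 hD t0; have k0 := tempered_exponent_gt0 b0 l0.
have C1 : (1 : R) @[_ --> (+oo%R : set_system R)] --> (1 : R) by exact: cvg_cst.
have h : 1 - expR t * expR (- (((1 + l) `^ b - l `^ b) * x)) @[x --> +oo%R] --> (1 : R).
  rewrite -[X in _ --> X]subr0; apply: cvgB; first exact: cvg_cst.
  rewrite -[X in _ --> X](mulr0 (expR t)); apply: cvgM; first exact: cvg_cst.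
  exact: cvg_expRN_pinfty.
apply: (squeeze_cvgr _ h C1); near=> x.
have x0 : 0 < x by near: x; exact: nbhs_pinfty_gt.
have := tail_series_compl_le b0 b1 l0 hD x0 t0; rewrite lerBlDl -lerBlDr => ->/=.
rewrite -(tempered_stable_tail b0 b1 l0 hD x0 t0).
have [mA _] := measurable_RV_gt_eq (D x) t.
by rewrite -lee_fin fineK ?fin_num_measure// probability_le1.
Unshelve. all: by end_near. Qed.

Lemma density_series_ge0 d (T : measurableType d) {R : realType}
    (P : probability T R) (D : R -> {RV P >-> R}) (b l t x : R) :
  0 < b -> b < 1 -> 0 < l -> tempered_stable_subordinator b l D -> 0 < t ->
  0 <= x -> 0 <= density_series b l t x.
Proof.
move=> b0 b1 l0 hD t0.
have pos (y : R) : 0 < y -> 0 <= density_series b l t y.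
  (* The slope [e] makes the nondecreasing tail strictly increasing, as the derivative criterion
     used here asks; [e] is arbitrary. *)
  move=> y0; apply/ler_addgt0Pr => e e0; rewrite addrC.
  have dG (z : R) : is_derive z 1 (fun z => e * z + tail_series b l t z)
      (e + density_series b l t z).
    apply: is_deriveD; last exact: is_derive_tail_series.
    by apply: (is_derive_eq (is_deriveM (is_derive_cst e _ _) (is_derive_id _ _)));
      rewrite /GRing.scale/= mulr1 mulr0 addr0.
  have [_ <-] := dG y; rewrite -derive1E.
  apply: (@incr_derive1_ge0_itvy _ _ false 0).
  - by move=> z _; have [] := dG z.
  - move=> u v; rewrite !in_itv/= !andbT => u0 v0 uv.
    by rewrite ltr_leD ?ltr_pM2l// (tail_series_nondecreasing b0 b1 l0 hD t0 u0 uv).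
  - by rewrite in_itv/= y0.
(* The endpoint 0 is reached from the right, by continuity of the series. *)
move=> x0; pose u (n : nat) : R := x + 1 / n.+2%:R.
have cu : u @ \oo --> x by exact: cvg_scale_harmonic.
have C0 : (fun=> 0 : R) @ \oo --> (0 : R) by exact: cvg_cst.
have h : density_series b l t (u n) @[n --> \oo] --> density_series b l t x.
  by apply: continuous_cvg => //; exact: continuous_density_series.
apply: (ler_cvg_to C0 h); apply: nearW => n.
by apply: pos; rewrite ltr_wpDl.
Qed.

(** * The law of the inverse process and its density *)

Section density_measure.
Context {R : realType} (h : R -> R).
Hypotheses (h0 : forall x, 0 <= h x) (mh : measurable_fun setT h).

(* The two hypotheses are arguments so that the measure structure below can depend on
   them. *)
Definition density_measure of (forall x, 0 <= h x) & measurable_fun setT h :=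
  fun A : set R => (\int[@mu R]_(x in A) (h x)%:E)%E.

Let m := density_measure h0 mh.

Let m_set0 : m set0 = 0%E.
Proof. by rewrite /m /density_measure integral_set0. Qed.

Let m_ge0 A : (0 <= m A)%E.
Proof. by apply: integral_ge0 => x _; rewrite lee_fin. Qed.

Let m_sigma_additive : semi_sigma_additive m.
Proof.
move=> F mF tF mUF; rewrite /m /density_measure; apply: cvg_toP.
  apply: ereal_nondecreasing_is_cvgn => i j ij.
  apply: lee_sum_nneg_natr => // k _ _; apply: integral_ge0 => x _.
  by rewrite lee_fin.
rewrite ge0_integral_bigcup//=.
- by apply/measurable_EFinP; exact: measurable_funTS.
- by move=> x _; rewrite lee_fin.
Qed.

HB.instance Definition _ := isMeasure.Build _ _ _ m m_set0 m_ge0 m_sigma_additive.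

Definition measure_of_density : {measure set R -> \bar R} := m.

End density_measure.

Definition inverse_density {R : realType} (b l t : R) : R -> R :=
  density_series b l t \_ `]0, +oo[.

Lemma integral_inverse_density d (T : measurableType d) {R : realType}
    (P : probability T R) (D : R -> {RV P >-> R}) (b l t x : R) :
  0 < b -> b < 1 -> 0 < l -> tempered_stable_subordinator b l D -> 0 < t ->
  (\int[mu]_(y in `]x, +oo[) (inverse_density b l t y)%:E)%E =
  (1 - tail_series b l t (Num.max x 0))%:E.
Proof.
move=> b0 b1 l0 hD t0.
have -> : (\int[mu]_(y in `]x, +oo[) (inverse_density b l t y)%:E)%E =
    (\int[mu]_(y in `](Num.max x 0)%R, +oo[) (density_series b l t y)%:E)%E.
  rewrite (_ : `](Num.max x 0), +oo[%classic = `]x, +oo[ `&` `]0, +oo[); last first.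
    by apply/seteqP; split => y; rewrite /= !in_itv/= !andbT gt_max => /andP.
  rewrite integral_mkcondr; apply: eq_integral => y _.
  by rewrite /inverse_density !patchE; case: ifPn.
have cd := continuous_density_series b0 b1 l0 t0.
have m0 : 0 <= Num.max x 0 by rewrite le_max lexx orbT.
have md : measurable_fun setT (density_series b l t).
  exact: continuous_measurable_fun.
rewrite integral_itv_obnd_cbnd; last by apply/measurable_EFinP; exact: measurable_funTS.
have dG (z : R) := is_derive_tail_series b0 b1 l0 t0 z.
rewrite EFinB; apply: ge0_continuous_FTC2y.
- move=> y xy; apply: (density_series_ge0 b0 b1 l0 hD t0).
  exact: le_trans xy.
- exact: continuous_subspaceT.
- exact: (cvg_tail_series b0 b1 l0 hD t0).
- by move=> y _; have [] := dG y.
- by apply: cvg_at_right_filter; exact: continuous_tail_series.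
- by move=> y _; rewrite derive1E; have [] := dG y.
Qed.

Lemma is_density_inverse d (T : measurableType d) {R : realType}
    (P : probability T R) (D E : R -> {RV P >-> R}) (b l t : R) :
  0 < b -> b < 1 -> 0 < l -> tempered_stable_subordinator b l D ->
  inverse_process D E -> 0 < t -> is_continuous_density (E t) (inverse_density b l t).
Proof.
move=> b0 b1 l0 hD hE t0.
have cd := continuous_density_series b0 b1 l0 t0.
have mh : measurable_fun setT (inverse_density b l t).
  apply/(measurable_restrictT _ _).1 => //.
  by apply: measurable_funTS; exact: continuous_measurable_fun.
have h0 (x : R) : 0 <= inverse_density b l t x.
  rewrite /inverse_density patchE; case: ifPn => // /set_mem.
  rewrite /= in_itv/= andbT => x0.
  by apply: (density_series_ge0 b0 b1 l0 hD t0); exact: ltW.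
split; last first.
  (* Near a positive point the cut-off at 0 is invisible, so continuity is that of the series. *)
  move=> x x0; apply: (@cvg_trans _ (density_series b l t @ x)); last first.
    by rewrite /inverse_density patchE mem_set ?in_itv/= ?in_itv/= ?x0//; exact: cd.
  apply: near_eq_cvg; near=> y.
  rewrite /inverse_density patchE mem_set//= in_itv/= andbT.
  by near: y; exact: lt_nbhsr.
split => // A mA.
have DE (x : R) : distribution P (E t) `]x, +oo[%classic =
    (1 - tail_series b l t (Num.max x 0))%:E.
  have [mE _] := measurable_RV_gt_eq (E t) x.
  rewrite -(inverse_tail _ b0 b1 l0 hD hE t0) fineK ?fin_num_measure//.
  rewrite /distribution /pushforward; congr (P _).
  by apply/seteqP; split => w; rewrite /= in_itv/= andbT.
change (distribution P (E t) A = measure_of_density h0 mh A).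
pose m1 : {measure set R -> \bar R} := distribution P (E t).
(* Open right half-lines are stable under intersection and generate the Borel sets, so equality of
   the tails is enough; the half-lines from [- n] exhaust the line with finite mass. *)
have uniq (c1 : _) (c2 : _) (c3 : _) (c4 : _) :=
  @measure_unique _ R R (@RGenOInfty.G R)
  (fun n => `](- n%:R), +oo[%classic) c1 c2 c3 c4 m1 (measure_of_density h0 mh).
apply: uniq => //.
- exact: RGenOInfty.measurableE.
- move=> _ _ [x ->] [y ->]; exists (Num.max x y).
  by apply/seteqP; split => z; rewrite /= !in_itv/= !andbT gt_max => /andP.
- by move=> n; exists (- n%:R).
- apply/seteqP; split => // x _; exists (Num.truncn `|x|).+1 => //=.
  rewrite in_itv/= andbT ltrNl (le_lt_trans (ler_norm _))// normrN.
  exact: truncnS_gt.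
- move=> _ [x ->]; apply: (etrans (DE x)); apply/esym.
  exact: (integral_inverse_density x b0 b1 l0 hD t0).
- move=> n; exact: (le_lt_trans (@probability_le1 _ _ _ (distribution P (E t)) _ (measurable_itv _)) (ltry 1)).
Unshelve. all: by end_near. Qed.

(** Both densities have the same distribution function, and each is its derivative at every point
    where it is continuous. *)
Lemma continuous_density_unique d (T : measurableType d) {R : realType}
    (P : probability T R) (X : {RV P >-> R}) (g h : R -> R) :
  is_continuous_density X g -> is_continuous_density X h ->
  forall x, 0 < x -> g x = h x.
Proof.
move=> [[mg g0 Xg] cg] [[mh h0 Xh] ch] x x0.
have int (f : R -> R) : measurable_fun setT f -> (forall x, 0 <= f x) ->
    (forall A, measurable A -> distribution P X A = \int[mu]_(x in A) (f x)%:E)%E ->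
    mu.-integrable `]-oo, (x + 1)%R] (EFin \o f).
  move=> mf f0 Xf; apply/integrableP; split.
    by apply/measurable_EFinP; exact: measurable_funTS.
  under eq_integral do rewrite /= ger0_norm//.
  by rewrite -Xf// (le_lt_trans (probability_le1 _ _))// ltry.
have x1 : x < x + 1 by rewrite ltrDl.
have [_ <-] := continuous_FTC1 x1 (int g mg g0 Xg) (ltNyr _) (cg x x0).
have [_ <-] := continuous_FTC1 x1 (int h mh h0 Xh) (ltNyr _) (ch x x0).
congr (derive1 _ x); apply/funext => y.
by rewrite /Rintegral -Xg// -Xh.
Qed.

Theorem proposition2p1 (R : realType) (beta lambda : R)
    (hbeta0 : 0 < beta) (hbeta1 : beta < 1) (hlambda : 0 < lambda)
    (d : measure_display) (T : measurableType d) (P : probability T R)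
    (D E : R -> {RV P >-> R})
    (hD : tempered_stable_subordinator beta lambda D)
    (hE : inverse_process D E) (t : R) (ht : 0 < t) :
  (exists h : R -> R, is_continuous_density (E t) h) /\
  forall h : R -> R, is_continuous_density (E t) h ->
  forall x : R, 0 < x ->
  let a (k : nat) : R :=
    (-1) ^+ k * (x ^+ k * lambda `^ (beta * k.+1%:R) / k`!%:R) *
    (Gamma (1 + beta * k.+1%:R) * upper_gamma (- (beta * k.+1%:R)) (lambda * t)
       * sin (k.+1%:R * beta * pi)
     - Gamma (1 + beta * k%:R) * upper_gamma (- (beta * k%:R)) (lambda * t)
       * sin (k%:R * beta * pi)) in
  cvgn (series a) /\
  h x = expR (lambda `^ beta * x) / pi * limn (series a).
Proof.
have hdens := is_density_inverse hbeta0 hbeta1 hlambda hD hE ht.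
split; first by exists (inverse_density beta lambda t).
move=> h hh x x0 a.
have -> : series a = pseries (density_coef beta lambda t) x.
  rewrite /pseries; congr series; apply/funext => k.
  by rewrite /a /= density_coefE// [RHS]mulrAC; congr (_ * _); ring.
split; first exact: (cvgP _ (@cvg_pseries_density_coef _ beta lambda t x hbeta0 hbeta1 hlambda ht)).
rewrite (continuous_density_unique hh hdens x0) /inverse_density patchE mem_set//=.
by rewrite in_itv/= x0.
Qed.
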